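(* Let $\mu=a\omega_1+b\omega_2$ with $a,b\in\mathbb N$. For every $i\in\{0,\dots,a\}$, as $\mathrm{End}(V^K_\mu)$-valued functions of $a_{\mathbf t}$, $\mathbf t\in\mathbb R^2$, $$\Phi^\mu_{\nu_i}=\frac{(m+b+i)_i}{(m)_i}\sum_{r=0}^i\frac{(-i)_{i-r}(-i-b)_{i-r}}{(i-r)!\,(1-m-2i-b)_{i-r}}\,Q^\mu_{\nu_r}.$$
   Context: $\mathbb N=\{0,1,2,\dots\}$, $m>2$ an integer, $G=\mathrm{SU}(m+2)$, $K=\mathrm S(\mathrm U(2)\times\mathrm U(m))\subset G$ embedded block-diagonally with $\mathrm U(2)$ in the upper left $2\times2$ block. $\omega_i(\mathrm{diag}(t_1,\dots,t_{m+2}))=t_1\cdots t_i$, $1\le i\le m+1$ (characters of the diagonal torus, written additively). Dominant weights: $\bigoplus_i\mathbb N\omega_i$ for $G$; $\sum_ia_i\omega_i$ with $a_2\in\mathbb Z$, $a_i\in\mathbb N$ ($i\ne2$) for $K$. $(\pi^G_\lambda,V^G_\lambda)$, $(\pi^K_\mu,V^K_\mu)$ are irreducible unitary representations of highest weight $\lambda$, $\mu$. $(x)_n=\prod_{l=0}^{n-1}(x+l)$. For $\mathbf t=(t_1,t_2)\in\mathbb R^2$, $a_{\mathbf t}\in G$ acts on $\mathbb C^{m+2}$ by $e_1\mapsto\cos t_1e_1+i\sin t_1e_{m+2}$, $e_{m+2}\mapsto i\sin t_1e_1+\cos t_1e_{m+2}$, $e_2\mapsto\cos t_2e_2+i\sin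 t_2e_{m+1}$, $e_{m+1}\mapsto i\sin t_2e_2+\cos t_2e_{m+1}$, fixing $e_3,\dots,e_m$. $\nu_i=(a-i)\omega_1+(i+b)\omega_2+i\omega_{m+1}$, $0\le i\le a$. $V^K_\mu$ occurs exactly once in $V^G_{\nu_i}|_K$; $\Phi^\mu_{\nu_i}(g)=j^\ast\circ\pi^G_{\nu_i}(g)\circ j$ where $j\colon V^K_\mu\to V^G_{\nu_i}$ is a unitary $K$-intertwiner. With $v_\mu$ a highest weight vector of $V^K_\mu$ and $F_1=E_{2,1}$, the vectors $F_1^k\cdot v_\mu$, $0\le k\le a$, form an orthogonal basis of $V^K_\mu$. The functions $Q^\mu_{\nu_i}$ are given by $Q^\mu_{\nu_i}(a_{\mathbf t})F_1^k\cdot v_\mu=q^\mu_{\nu_i,\sigma_k}(a_{\mathbf t})F_1^k\cdot v_\mu$ with $$q^\mu_{\nu_i,\sigma_k}(a_{\mathbf t})=(\cos t_1)^{a+b-k}\sum_{p=0}^{\min(i,k)}\frac{(-i)_p(-k)_p}{p!\,(-a)_p}(\cos^2t_2-\cos^2t_1)^p(\cos t_2)^{b+2i+k-2p}.$$ *)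

(* Defs.v *)
From HB Require Import structures.
From mathcomp Require Import all_boot all_order all_algebra.
From mathcomp Require Import all_classical all_reals all_analysis.
From mathcomp Require Import complex.
Set Implicit Arguments.
Unset Strict Implicit.
Unset Printing Implicit Defensive.
Import Order.TTheory GRing.Theory Num.Theory.
Import numFieldNormedType.Exports.
Local Open Scope classical_set_scope.
Local Open Scope ring_scope.
Local Open Scope sesquilinear_scope.

(* The usual topology on R[i], hence on matrices over R[i]: MathComp-Analysis
   provides it on the regular module R[i]^o only. *)
HB.instance Definition _ (R : rcfType) := PseudoPointedMetric.copy R[i] R[i]^o.
HB.instance Definition _ (R : rcfType) := NormedModule.copy R[i] R[i]^o.

Definition poch (T : pzRingType) (x : T) (n : nat) : T :=
  \prod_(l < n) (x + l%:R).

Section Representations.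
Variable R : realType.
Local Notation C := R[i].

Definition SU n : set 'M[C]_n := [set g | g \is unitarymx /\ \det g = 1].

(* S(U(2) x U(m)), block-diagonal in SU(m+2) *)
Definition SU2m m : set 'M[C]_m.+2 :=
  [set g | SU g /\ forall k l : 'I_m.+2, (k < 2)%N != (l < 2)%N -> g k l = 0].

(* A representation of H on C^d, with its standard Hermitian inner product, is
   given by matrices acting on column vectors; only its values on H matter. *)
Definition unitary_rep n d (H : set 'M[C]_n) (pi : 'M[C]_n -> 'M[C]_d) : Prop :=
  [/\ pi 1%:M = 1%:M,
      forall g h, H g -> H h -> pi (g *m h) = pi g *m pi h,
      forall g, H g -> pi g \is unitarymx
    & {within H, continuous pi}].

(* Subspaces of C^d are encoded by the row space of a matrix W, whose rows are
   the transposes of column vectors; whence the transpose of pi g. *)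
Definition irreducible_rep n d (H : set 'M[C]_n) (pi : 'M[C]_n -> 'M[C]_d)
    : Prop :=
  (0 < d)%N /\
  forall W : 'M[C]_d, (forall g, H g -> stablemx W (pi g)^T) ->
    W = 0 \/ row_full W.

Definition expmx n (A : 'M[C]_n.+1) : 'M[C]_n.+1 :=
  limn (fun N => \sum_(0 <= k < N) (k`!%:R)^-1 *: A ^+ k : 'M[C]_n.+1).

(* d/ds pi(exp(sA)) at s = 0, for A in the (real) Lie algebra of the group *)
Definition dreal n d (pi : 'M[C]_n.+1 -> 'M[C]_d) (A : 'M[C]_n.+1) : 'M[C]_d :=
  lim ((fun s : R => (s%:C%C)^-1 *: (pi (expmx (s%:C%C *: A)) - 1%:M) : 'M[C]_d)
       @ (0 : R)^').

(* The complexified derived representation: X is decomposed as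
   A + iB with A and B skew-Hermitian. *)
Definition dcplx n d (pi : 'M[C]_n.+1 -> 'M[C]_d) (X : 'M[C]_n.+1) : 'M[C]_d :=
  dreal pi (2^-1 *: (X - X^t*)) +
  'i%C *: dreal pi ((2 * 'i%C)^-1 *: (X + X^t*)).

(* Weights of the diagonal torus of SU(n+1) are coordinate vectors in the basis
   omega_1, ..., omega_n; omega j is indexed from 1. *)
Definition omega n (j : nat) : 'rV[int]_n := \row_(i < n) (i.+1 == j)%:R.

Definition wchar n (lam : 'rV[int]_n) (t : 'rV[C]_n.+1) : C :=
  \prod_(i < n) (\prod_(l < n.+1 | (l <= i)%N) t 0 l) ^ (lam 0 i).

(* pos k l says that E_{k,l} is a positive root vector of H. *)
Definition highest_weight_vector n d (H : set 'M[C]_n.+1)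
    (pos : rel 'I_n.+1) (lam : 'rV[int]_n) (pi : 'M[C]_n.+1 -> 'M[C]_d)
    (v : 'cV[C]_d) : Prop :=
  [/\ v != 0,
      forall t, H (diag_mx t) -> pi (diag_mx t) *m v = wchar lam t *: v
    & forall k l, pos k l -> dcplx pi (delta_mx k l) *m v = 0].

Definition irrep_of_hw n d (H : set 'M[C]_n.+1) (pos : rel 'I_n.+1)
    (lam : 'rV[int]_n) (pi : 'M[C]_n.+1 -> 'M[C]_d) : Prop :=
  [/\ unitary_rep H pi, irreducible_rep H pi
    & exists v, highest_weight_vector H pos lam pi v].

Definition posG m : rel 'I_m.+2 := fun k l => (k < l)%N.
Definition posK m : rel 'I_m.+2 :=
  fun k l => (k < l)%N && ((k < 2)%N == (l < 2)%N).

Definition intertwiner n dK dG (K : set 'M[C]_n) (piK : 'M[C]_n -> 'M[C]_dK)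
    (piG : 'M[C]_n -> 'M[C]_dG) (j : 'M[C]_(dG, dK)) : Prop :=
  forall g, K g -> piG g *m j = j *m piK g.

Definition Phi n dK dG (piG : 'M[C]_n -> 'M[C]_dG) (j : 'M[C]_(dG, dK))
    (g : 'M[C]_n) : 'M[C]_dK := j^t* *m piG g *m j.

(* e_1, e_2, e_{m+1}, e_{m+2} have indices 0, 1, m, m.+1; column l of the matrix
   is the image of the basis vector of index l. *)
Definition a_t m (t1 t2 : R) : 'M[C]_m.+2 :=
  \matrix_(k < m.+2, l < m.+2)
    let: (c1, s1) := ((cos t1)%:C%C, 'i%C * (sin t1)%:C%C) in
    let: (c2, s2) := ((cos t2)%:C%C, 'i%C * (sin t2)%:C%C) in
    if l == 0 :> nat then c1 *+ (k == 0 :> nat) + s1 *+ (k == m.+1 :> nat)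
    else if l == m.+1 :> nat
      then s1 *+ (k == 0 :> nat) + c1 *+ (k == m.+1 :> nat)
    else if l == 1 :> nat
      then c2 *+ (k == 1 :> nat) + s2 *+ (k == m :> nat)
    else if l == m :> nat
      then s2 *+ (k == 1 :> nat) + c2 *+ (k == m :> nat)
    else (k == l)%:R.

Definition E21 m : 'M[C]_m.+2 := delta_mx 1 0.

Definition mu m (a b : nat) : 'rV[int]_m.+1 :=
  omega _ 1 *+ a + omega _ 2 *+ b.

Definition nu m (a b i : nat) : 'rV[int]_m.+1 :=
  omega _ 1 *+ (a - i) + omega _ 2 *+ (i + b) + omega _ m.+1 *+ i.

Definition q_ (a b i k : nat) (t1 t2 : R) : R :=
  cos t1 ^+ (a + b - k) *
  \sum_(p < (minn i k).+1)
    poch (- i%:R) p * poch (- k%:R) p / (p`!%:R * poch (- a%:R) p) *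
    (cos t2 ^+ 2 - cos t1 ^+ 2) ^+ p * cos t2 ^+ (b + 2 * i + k - 2 * p).

End Representations.

(* Main.v *)
(* The idea is to compute phi(g) = <pi(g) u, u> for the highest weight vector u
   of V^K_mu inside V^G_nu, up to a scalar. If w is a highest weight vector of
   V^G_nu and y is any vector that transforms under K like u, then <pi(g) w, y>
   is an eigenfunction on the left of the Lie algebra of S(B x U(m)), B a Borel
   subgroup of GL(2), and on the right of that of the stabilizer of a flag; as
   the two Lie algebras can be moved into general position, where they span
   sl(m+2), this function is a multiple of the product g_11^(a-i) Delta^(b+i)
   conj(g_(2,m+2))^i, Delta being the upper left 2x2 minor. Hence y is unique up
   to a scalar. Averaging pi(h) w over suitable h (finite cubature formulas
   replace integration) produces such a y whose matrix coefficient <pi(g) y, u>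
   is explicit, and so phi is the sum over r of C_r g_11^(a-r) Delta^(b+r)
   conj(g_22)^r, where C_r are the coefficients of the theorem by Vandermonde's
   identity. Evaluating phi at k a_t k' for k in K and k' in SU(2), and
   extracting the coefficients of the matrix entries of k', yields the
   eigenvalues of Phi on the vectors F_1^k v. *)
Require Import Defs.
From mathcomp Require Import all_boot all_order all_algebra.
From mathcomp Require Import all_classical all_reals all_analysis.
From mathcomp Require Import complex mxtens ring lra zify perm.
Set Implicit Arguments.
Unset Strict Implicit.
Unset Printing Implicit Defensive.
Import Order.TTheory GRing.Theory Num.Theory.
Import numFieldNormedType.Exports.
Local Open Scope ring_scope.
Local Open Scope sesquilinear_scope.

(** * Norms and one-parameter groups *)

(** The representations are only known to be continuous, so the Lie algebra enters through
    estimates: [pi] is Lipschitz at 1, one-parameter groups then have a quadratic remainder, and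
    brackets follow from first-order expansions. Conversely, group elements are limits of Euler
    iterates of the derivative, so identities between words in the Lie algebra become identities of
    functions on SU(m+2). The averaged vector must be killed by $E_{12}$ and still have an explicit
    coefficient. The elements [h] therefore fix $e_1$ and rotate $e_2$ towards a unit vector $\xi$
    of $\mathbb C^m$: moments of $\xi$ over the sphere produce the symbols $(m)_s$, and the phase
    between $e_2$ and $\xi$ matches powers in two binomial expansions. No constant of
    proportionality is computed. At $\mathbf t=0$ the function $\Phi$ and all $Q_r$ are the
    identity, and the coefficients of the theorem add up to 1; this fixes the scale. On K one has
    $\Delta\overline{g_{22}}=g_{11}$. The dependence on the element of K then factors out of every
    summand in the same way, which is why the vectors extracted from SU(2) are eigenvectors of
    $\Phi$. *)

Section EntrywiseNorm.
Variable R : realType.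
Local Notation C := R[i].
Local Notation normc := ComplexField.Normc.normc.

Lemma normc_norm (z : C) : `|z| = (normc z)%:C%C.
Proof. by []. Qed.

Lemma normc_ge0 (z : C) : 0 <= normc z.
Proof. by rewrite -lecR; exact: (normr_ge0 z). Qed.

Lemma normc_conj (z : C) : normc z^* = normc z.
Proof. by have := norm_conjC z; rewrite !normc_norm => /complexI. Qed.

Lemma normc_real (x : R) : normc x%:C%C = `|x|.
Proof. by rewrite /normc /= expr0n /= addr0 sqrtr_sqr. Qed.

(** The entrywise sum norm takes values in [R], is submultiplicative and is multiplicative on tensor
    products, so every estimate below is an explicit real inequality. *)
Definition nm m n (M : 'M[C]_(m, n)) : R := \sum_i \sum_j normc (M i j).

Lemma nm_ge0 m n (M : 'M[C]_(m, n)) : 0 <= nm M.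
Proof. by apply: sumr_ge0 => i _; apply: sumr_ge0 => j _; exact: normc_ge0. Qed.

Lemma normc_le_nm m n (M : 'M[C]_(m, n)) i j : normc (M i j) <= nm M.
Proof.
rewrite /nm (bigD1 i) //= (bigD1 j) //= -addrA lerDl.
by rewrite addr_ge0 ?sumr_ge0 // => *; rewrite ?sumr_ge0 // => *;
  exact: normc_ge0.
Qed.

Lemma nm0 m n : nm (0 : 'M[C]_(m, n)) = 0.
Proof.
by rewrite /nm !big1 // => i _; rewrite big1 // => j _; rewrite mxE
  ComplexField.Normc.normc0.
Qed.

Lemma nm0_eq0 m n (M : 'M[C]_(m, n)) : nm M <= 0 -> M = 0.
Proof.
move=> M0; apply/matrixP => i j; rewrite mxE.
apply: ComplexField.Normc.eq0_normc; apply/eqP; rewrite eq_le normc_ge0 andbT.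
exact: le_trans (normc_le_nm M i j) M0.
Qed.

Lemma nmD m n (M N : 'M[C]_(m, n)) : nm (M + N) <= nm M + nm N.
Proof.
rewrite /nm -big_split /=; apply: ler_sum => i _; rewrite -big_split /=.
by apply: ler_sum => j _; rewrite mxE; exact: le_normcD.
Qed.

Lemma nmN m n (M : 'M[C]_(m, n)) : nm (- M) = nm M.
Proof.
by apply: eq_bigr => i _; apply: eq_bigr => j _; rewrite mxE normcN.
Qed.

Lemma nmB m n (M N : 'M[C]_(m, n)) : nm (M - N) <= nm M + nm N.
Proof. by rewrite -(nmN N) nmD. Qed.

Lemma nm_sum m n I (r : seq I) (P : pred I) (F : I -> 'M[C]_(m, n)) :
  nm (\sum_(i <- r | P i) F i) <= \sum_(i <- r | P i) nm (F i).
Proof.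
elim/big_rec2: _ => [|i y1 y2 _ h]; first by rewrite nm0.
by apply: le_trans (nmD _ _) _; rewrite lerD2l.
Qed.

Lemma nmZ m n c (M : 'M[C]_(m, n)) : nm (c *: M) = normc c * nm M.
Proof.
rewrite /nm mulr_sumr; apply: eq_bigr => i _; rewrite mulr_sumr.
by apply: eq_bigr => j _; rewrite mxE ComplexField.Normc.normcM.
Qed.

Lemma normc_sum I (r : seq I) (P : pred I) (F : I -> C) :
  normc (\sum_(i <- r | P i) F i) <= \sum_(i <- r | P i) normc (F i).
Proof.
elim/big_rec2: _ => [|i y1 y2 _ h]; first by rewrite ComplexField.Normc.normc0.
by apply: le_trans (le_normcD _ _) _; rewrite lerD2l.
Qed.

Lemma nmM m n p (A : 'M[C]_(m, n)) (B : 'M[C]_(n, p)) :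
  nm (A *m B) <= nm A * nm B.
Proof.
rewrite /nm mulr_suml; apply: ler_sum => i _.
apply: (@le_trans _ _ (\sum_j \sum_k normc (A i k) * normc (B k j))).
  apply: ler_sum => j _; rewrite mxE; apply: le_trans (normc_sum _ _ _) _.
  by apply: ler_sum => k _; rewrite ComplexField.Normc.normcM.
rewrite exchange_big mulr_suml /=; apply: ler_sum => k _.
rewrite -mulr_sumr ler_wpM2l ?normc_ge0 // (bigD1 k) //= lerDl.
by do 2![apply: sumr_ge0 => *]; exact: normc_ge0.
Qed.

Lemma nm_trC m n (M : 'M[C]_(m, n)) : nm (M^t*) = nm M.
Proof.
rewrite /nm exchange_big; apply: eq_bigr => i _; apply: eq_bigr => j _.
by rewrite !mxE normc_conj.
Qed.

Lemma nm_tens m n p q (A : 'M[C]_(m, n)) (B : 'M[C]_(p, q)) :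
  nm (A *t B) = nm A * nm B.
Proof.
rewrite /nm mulr_sum; apply: eq_bigr => i _; rewrite mulr_sum.
by apply: eq_bigr => j _; rewrite mxE ComplexField.Normc.normcM.
Qed.

Lemma nm_unitary d (M : 'M[C]_d) : M \is unitarymx -> nm M <= (d * d)%:R.
Proof.
move=> /unitarymxP MM.
have -> : (d * d)%:R = \sum_(i < d) \sum_(j < d) 1 :> R.
  by rewrite !sumr_const !card_ord natrM mulr_natl.
apply: ler_sum => i _; apply: ler_sum => j _.
have := congr1 (fun X : 'M[C]_d => X i i) MM; rewrite !mxE eqxx /=.
under eq_bigr do rewrite !mxE -normCK normc_norm -rmorphXn.
rewrite -rmorph_sum => /complexI h.
rewrite -(ler_pXn2r (n := 2)) ?nnegrE ?normc_ge0 // expr1n -h.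
by rewrite (bigD1 j) //= lerDl sumr_ge0 // => *; rewrite exprn_ge0 ?normc_ge0.
Qed.

Lemma nm1 d : nm (1%:M : 'M[C]_d) = d%:R.
Proof.
rewrite -[d in RHS]card_ord -sumr_const; apply: eq_bigr => i _.
rewrite (bigD1 i) //= big1 => [|j ij]; rewrite mxE.
  by rewrite eqxx ComplexField.Normc.normc1 addr0.
by rewrite eq_sym (negPf ij) ComplexField.Normc.normc0.
Qed.

Lemma unitaryM m n p (A : 'M[C]_(m, n)) (B : 'M[C]_(n, p)) :
  A \is unitarymx -> B \is unitarymx -> A *m B \is unitarymx.
Proof. by move=> hA hB; exact: (mul_unitarymx hA hB). Qed.

Lemma unitaryV n (A : 'M[C]_n) : A \is unitarymx -> A^t* \is unitarymx.
Proof. by rewrite trmxC_unitary. Qed.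

Lemma unitary_mulV n (P : 'M[C]_n) : P \is unitarymx -> P^t* *m P = 1%:M.
Proof. by move=> /unitarymxP; exact: mulmx1C. Qed.

Lemma unitary_mulK m n (P : 'M[C]_n) (A : 'M[C]_(m, n)) :
  P \is unitarymx -> A *m P *m P^t* = A.
Proof. by move=> PU; rewrite -mulmxA (unitarymxP PU) mulmx1. Qed.

Lemma unitary_mulVK m n (P : 'M[C]_n) (A : 'M[C]_(m, n)) :
  P \is unitarymx -> A *m P^t* *m P = A.
Proof. by move=> PU; rewrite -mulmxA unitary_mulV // mulmx1. Qed.

Lemma unitary1 n : (1%:M : 'M[C]_n) \is unitarymx.
Proof.
by apply/unitarymxP; rewrite mul1mx trmx1 map_mx1.
Qed.

End EntrywiseNorm.

Section Topology.
Variable R : realType.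
Local Notation C := R[i].
Local Notation normc := (@ComplexField.Normc.normc R).
Local Open Scope classical_set_scope.

Lemma gt0_complexP (e : C) : 0 < e -> exists2 r : R, 0 < r & e = r%:C%C.
Proof.
case: e => r s; rewrite ltcE /= => /andP[/eqP -> r0]; exists r => //.
Qed.

Lemma mx_ball_nm m n (A B : 'M[C]_(m, n)) (e : R) : nm (A - B) < e ->
  ball A e%:C%C B.
Proof.
move=> ABe; split=> [|i j]; first by rewrite ltcR (le_lt_trans (nm_ge0 _) ABe).
rewrite /ball /= normc_norm ltcR; apply: le_lt_trans ABe.
by have := normc_le_nm (A - B) i j; rewrite !mxE.
Qed.

Lemma cvg_nm m n T (F : set_system T) (FF : Filter F) (f : T -> 'M[C]_(m, n))
    (L : 'M[C]_(m, n)) :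
  (forall e : R, 0 < e -> \forall x \near F, nm (L - f x) < e) ->
  f x @[x --> F] --> L.
Proof.
move=> h; apply/cvg_ballP => e /gt0_complexP[r r0 ->].
by apply: filterS (h r r0) => x; exact: mx_ball_nm.
Qed.

Lemma mx_ball_nmE m n (A B : 'M[C]_(m, n)) (e : R) :
  ball A e%:C%C B -> nm (A - B) <= (m * n)%:R * e.
Proof.
move=> [_ h].
have -> : (m * n)%:R * e = \sum_(i < m) \sum_(j < n) e.
  by rewrite !sumr_const !card_ord -mulrnA mulnC mulr_natl.
apply: ler_sum => i _; apply: ler_sum => j _.
have := h i j; rewrite /ball /= normc_norm ltcR => /ltW.
by rewrite !mxE.
Qed.

Lemma within_continuous_nm n d (H : set 'M[C]_n) (pi : 'M[C]_n -> 'M[C]_d) x :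
  {within H, continuous pi} -> H x ->
  forall e : R, 0 < e -> exists2 del : R, 0 < del &
    forall g, H g -> nm (x - g) < del -> nm (pi x - pi g) < e.
Proof.
move=> /subspace_continuousP/(_ x) + Hx e e0; move=> /(_ Hx) h.
have e'0 : 0 < e / ((d * d).+1)%:R by rewrite divr_gt0.
have /cvg_ballP/(_ (e / ((d * d).+1)%:R)%:C%C) := h.
rewrite ltcR => /(_ e'0).
rewrite near_withinE => /nbhs_ballP[r /= /gt0_complexP[del del0 ->] hdel].
exists del => // g Hg /mx_ball_nm /hdel /(_ Hg) /mx_ball_nmE /le_lt_trans; apply.
rewrite mulrCA gtr_pMr // ltr_pdivrMr // mul1r ltr_nat //.
Qed.

Lemma cvg_lim_nm m n T (F : set_system T) (FF : ProperFilter F)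
    (f : T -> 'M[C]_(m, n)) (L : 'M[C]_(m, n)) :
  (forall e : R, 0 < e -> \forall x \near F, nm (L - f x) < e) ->
  lim (f x @[x --> F]) = L.
Proof. by move=> h; apply: cvg_lim => //; exact: cvg_nm. Qed.

(** A second-order remainder divided by [s] is of order [s]: the limit defining [dreal] is always
    evaluated in this way. *)
Lemma dreal_eq n d (pi : 'M[C]_n.+1 -> 'M[C]_d) A (X : 'M[C]_d) (K : R) :
  (forall s : R, `|s| <= 1 ->
    nm (pi (expmx (s%:C%C *: A)) - 1%:M - s%:C%C *: X) <= K * s ^+ 2) ->
  dreal pi A = X.
Proof.
move=> h; apply: cvg_lim_nm => e e0.
have K0 : 0 <= K.
  have := h 1; rewrite normr1 => /(_ (lexx _)); rewrite expr1n mulr1.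
  exact: le_trans (nm_ge0 _).
have : \forall s \near (0 : R)^', `|s| < Num.min 1 (e / (K + 1)).
  have m0 : 0 < Num.min 1 (e / (K + 1)).
    by rewrite lt_min ltr01 divr_gt0 // ltr_wpDl.
  apply/nbhs_ballP; exists (Num.min 1 (e / (K + 1))) => //= y.
  by rewrite /ball /= sub0r normrN.
have : \forall s \near (0 : R)^', s != 0 by exact: nbhs_dnbhs_neq.
apply: filterS2 => s s0; rewrite lt_min => /andP[s1 se].
have s'0 : s%:C%C != 0 :> C by rewrite eq_complex /= (negPf s0).
rewrite -[X](scalerK s'0) -scalerBr nmZ -nmN opprB.
have -> : normc (s%:C%C)^-1 = `|s|^-1.
  by rewrite ComplexField.Normc.normcV normc_real.
rewrite mulrC ltr_pdivrMr ?normr_gt0 //.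
apply: le_lt_trans (h s (ltW s1)) _; rewrite -real_normK ?num_real // expr2 mulrA.
rewrite ltr_pM2r ?normr_gt0 //.
have : `|s| * (K + 1) < e by rewrite -ltr_pdivlMr // ltr_wpDl.
apply: le_lt_trans; rewrite mulrC ler_wpM2l // lerDl //.
Qed.

End Topology.

(** * The exponential of skew-Hermitian matrices *)

Section Exponential.
Variable R : realType.
Local Notation C := R[i].
Local Notation normc := (@ComplexField.Normc.normc R).
Local Open Scope classical_set_scope.

Definition expi (x : R) : C := Complex (cos x) (sin x).

Lemma expi0 : expi 0 = 1.
Proof. by rewrite /expi cos0 sin0. Qed.

Lemma expiD x y : expi (x + y) = expi x * expi y.
Proof.
rewrite /expi cosD sinD; apply/eqP; rewrite eq_complex /=.
by apply/andP; split; apply/eqP; ring.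
Qed.

Lemma conj_expi x : (expi x)^* = expi (- x).
Proof. by rewrite /expi cosN sinN. Qed.

Lemma expi_sum I (r : seq I) (P : pred I) (F : I -> R) :
  expi (\sum_(i <- r | P i) F i) = \prod_(i <- r | P i) expi (F i).
Proof. by rewrite (big_morph expi expiD expi0). Qed.

Lemma expiMn x n : expi (x *+ n) = expi x ^+ n.
Proof.
by elim: n => [|n ih]; rewrite ?expi0 // mulrS exprS expiD ih.
Qed.

Lemma expi_mulC x : expi x * (expi x)^* = 1.
Proof. by rewrite conj_expi -expiD subrr expi0. Qed.

Lemma expi_surj (z : C) : z * z^* = 1 -> exists x, z = expi x.
Proof.
case: z => x y; rewrite /Num.conj /= => /eqP.
rewrite eq_complex /= => /andP[/eqP h _].
have {}h : x ^+ 2 + y ^+ 2 = 1 by rewrite -h mulrN opprK.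
have x1 : -1 <= x <= 1.
  rewrite -ler_norml -(ler_pXn2r (n := 2)) ?nnegrE // expr1n real_normK ?num_real //.
  by rewrite -h lerDl sqr_ge0.
have hs : sin (acos x) = `|y|.
  by rewrite sin_acos // -h addrC addKr sqrtr_sqr.
have hc : cos (acos x) = x by rewrite acosK // in_itv.
have [y0|y0] := leP 0 y.
  by exists (acos x); rewrite /expi hc hs ger0_norm.
by exists (- acos x); rewrite /expi cosN sinN hc hs ltr0_norm // opprK.
Qed.

(** The mean value theorem for [sin], for [cos] and then for [sin z - z], with sine and cosine
    bounded by 1. *)
Lemma sin_cos_approx (x : R) : 0 < x ->
  `|cos x - 1| <= x ^+ 2 /\ `|sin x - x| <= x ^+ 2.
Proof.
move=> x0.
have ccont (f : R -> R) df a b : (forall x : R, is_derive x 1 f (df x)) ->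
    {within `[a, b], continuous f}.
  move=> h; apply: continuous_subspaceT => y.
  by apply: differentiable_continuous; apply/derivable1_diffP; apply: ex_derive.
have mvt (f df : R -> R) (y : R) : (forall x : R, is_derive x 1 f (df x)) ->
    0 < y -> exists2 c, 0 < c < y & f y - f 0 = df c * y.
  move=> hf y0; have [c] := MVT y0 (fun z _ => hf z) (ccont f df 0 y hf).
  by rewrite in_itv subr0; exists c.
have sin_le (y : R) : 0 < y -> `|sin y| <= y.
  move=> y0; have [c _] := mvt sin cos y (@is_derive_sin R) y0.
  rewrite sin0 !subr0 => ->; rewrite normrM (gtr0_norm y0).
  by rewrite ler_piMl ?cos_max // ltW.
have cos_le (y : R) : 0 < y -> exists2 c, 0 < c < y & cos y - 1 = - sin c * y.
  move=> y0; have [c cy] := mvt cos _ y (@is_derive_cos R) y0.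
  by rewrite cos0; exists c.
have [c /andP[c0 cx] ->] := cos_le x x0; split.
  rewrite normrM normrN (gtr0_norm x0) expr2 ler_wpM2r ?ltW //.
  exact: le_lt_trans (sin_le _ c0) cx.
have hd (y : R) : is_derive y 1 (fun z => sin z - z) (cos y - 1).
  by apply: is_deriveB.
have [d /andP[d0 dx]] := mvt _ _ x hd x0.
rewrite sin0 !subr0 => ->; rewrite normrM (gtr0_norm x0) expr2 ler_wpM2r ?ltW //.
have [c' _ ->] := cos_le d d0; rewrite normrM normrN (gtr0_norm d0).
by apply: le_lt_trans dx; rewrite ler_piMl ?sin_max // ltW.
Qed.

Lemma expi_approx (x : R) :
  normc (expi x - 1 - 'i%C * x%:C%C) <= 2 * x ^+ 2.
Proof.
wlog x0 : x / 0 < x => [hw|].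
  have [->|xN0] := eqVneq x 0.
    rewrite expi0 subrr sub0r mulr0 oppr0 ComplexField.Normc.normc0.
    by rewrite expr0n mulr0.
  have [/hw//|x0] := ltP 0 x.
  have xN : 0 < - x by rewrite oppr_gt0 lt_neqAle xN0.
  have := hw _ xN; rewrite sqrrN -[X in X <= _ -> _]normc_conj.
  congr (normc _ <= _); rewrite !rmorphB /= conj_expi opprK rmorph1.
  by congr (_ - _); rewrite /Num.conj /=; apply/eqP; rewrite eq_complex /=; apply/andP; split; apply/eqP; ring.
have [h1 h2] := sin_cos_approx x0.
have -> : expi x - 1 - 'i%C * x%:C%C =
    (cos x - 1)%:C%C + 'i%C * (sin x - x)%:C%C.
  by apply/eqP; rewrite eq_complex /=; apply/andP; split; apply/eqP; ring.
apply: le_trans (le_normcD _ _) _; rewrite ComplexField.Normc.normcM !normc_real.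
have -> : normc 'i%C = 1 by rewrite /= expr0n expr1n add0r sqrtr1.
rewrite mul1r; lra.
Qed.

(** Matches the exponential series on an imaginary eigenvalue with the real series that define [cos]
    and [sin]. *)
Lemma expi_series (x : R) k :
  (k`!%:R)^-1 * ('i%C * x%:C%C) ^+ k =
  Complex (cos_coeff x k) (sin_coeff x k).
Proof.
have -> : (k`!%:R : C)^-1 = ((k`!%:R : R)^-1)%:C%C by rewrite fmorphV rmorph_nat.
rewrite exprMn -rmorphXn /cos_coeff /sin_coeff /=.
have hi j : ('i%C : C) ^+ j.*2 = ((-1) ^+ j)%:C%C.
  by rewrite -muln2 mulnC exprM sqr_i rmorphXn rmorphN rmorph1.
have := odd_double_half k; set j := k./2; case: (odd k) => /= <-.
  rewrite add1n exprS hi /= doubleK -exprnP.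
  move: (_ ^-1) (_ ^+ j) (_ ^+ _.+1) => u e X.
  by apply/eqP; rewrite eq_complex /=; apply/andP; split; apply/eqP; ring.
rewrite add0n hi -exprnP; move: (_ ^-1) (_ ^+ j) (_ ^+ _.*2) => u e X.
by apply/eqP; rewrite eq_complex /=; apply/andP; split; apply/eqP; ring.
Qed.


Lemma diag_mxX n (d : 'rV[C]_n.+1) k :
  diag_mx d ^+ k = diag_mx (map_mx (fun x => x ^+ k) d).
Proof.
elim: k => [|k ih].
  by rewrite expr0; apply/matrixP => i j; rewrite !mxE expr0.
rewrite exprS ih -mulmxE mulmx_diag; congr diag_mx.
by apply/rowP => i; rewrite !mxE exprS.
Qed.

Lemma conj_unitaryX n (P D : 'M[C]_n.+1) k : P \is unitarymx ->
  (P^t* *m D *m P) ^+ k = P^t* *m D ^+ k *m P.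
Proof.
move=> PU; elim: k => [|k ih].
  by rewrite !expr0 mulmx1 unitary_mulV.
by rewrite !exprS ih -!mulmxE !mulmxA (unitary_mulK _ PU).
Qed.

Definition imdiag n (th : 'rV[R]_n) : 'M[C]_n :=
  diag_mx (map_mx (fun x => 'i%C * x%:C%C) th).

Lemma expmx_spectral n (P : 'M[C]_n.+1) (th : 'rV[R]_n.+1) :
  P \is unitarymx ->
  expmx (P^t* *m imdiag th *m P) =
  P^t* *m diag_mx (map_mx expi th) *m P.
Proof.
move=> PU; apply: cvg_lim_nm => e e0.
have E N : \sum_(0 <= k < N) (k`!%:R : C)^-1 *: (P^t* *m imdiag th *m P) ^+ k =
  P^t* *m diag_mx (\row_l Complex (series (cos_coeff (th 0 l)) N)
    (series (sin_coeff (th 0 l)) N)) *m P.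
  under eq_bigr do rewrite conj_unitaryX // diag_mxX scalemxAl scalemxAr.
  rewrite -mulmx_suml -mulmx_sumr; congr (_ *m _ *m _).
  apply/matrixP => i j; rewrite summxE !mxE.
  have [<-|ij] := eqVneq i j; last first.
    rewrite mulr0n big1 // => k _.
    by rewrite !mxE (negPf ij) mulr0n mulr0.
  rewrite mulr1n; under eq_bigr do rewrite !mxE eqxx mulr1n expi_series.
  rewrite /series /=.
  elim: N => [|N ih]; first by rewrite !big_geq.
  by rewrite !big_nat_recr //= ih.
(* The tolerance is shared among the [n.+1] diagonal entries and the two factors [nm P]; the [+ 1]
   keeps the denominator positive. *)
have key l : \forall N \near \oo,
    normc (expi (th 0 l) - Complex (series (cos_coeff (th 0 l)) N)
      (series (sin_coeff (th 0 l)) N)) < e / ((n.+1)%:R * (nm P ^+ 2 + 1)).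
  set e' := _ / _.
  have e'0 : 0 < e' / 2.
    by rewrite !divr_gt0 // mulr_gt0 // ltr_wpDl // sqr_ge0.
  have /cvgrPdist_lt/(_ _ e'0) : series (cos_coeff (th 0 l)) @ \oo --> cos (th 0 l).
    by rewrite unlock; exact: is_cvg_series_cos_coeff.
  have /cvgrPdist_lt/(_ _ e'0) : series (sin_coeff (th 0 l)) @ \oo --> sin (th 0 l).
    by rewrite unlock; exact: is_cvg_series_sin_coeff.
  apply: filterS2 => N hc hs; rewrite /expi.
  have -> : forall a b c d : R, Complex a b - Complex c d =
    (a - c)%:C%C + 'i%C * (b - d)%:C%C.
    by move=> a' b' c' d'; apply/eqP; rewrite eq_complex /=; apply/andP; split; apply/eqP; ring.
  apply: le_lt_trans (le_normcD _ _) _.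
  rewrite ComplexField.Normc.normcM !normc_real.
  have -> : normc 'i%C = 1 by rewrite /= expr0n expr1n add0r sqrtr1.
  rewrite mul1r; rewrite [X in _ < X](_ : _ = e' / 2 + e' / 2); last by field.
  by rewrite ltrD.
near=> N.
have hN l : normc (expi (th 0 l) - Complex (series (cos_coeff (th 0 l)) N)
    (series (sin_coeff (th 0 l)) N)) < e / (n.+1%:R * (nm P ^+ 2 + 1)).
  by move: l; near: N; apply: filter_forall => l; exact: key.
rewrite E -mulmxBl -mulmxBr.
apply: le_lt_trans (nmM _ _) _.
apply: (@le_lt_trans _ _ (nm P ^+ 2 * \sum_(l < n.+1)
   e / ((n.+1)%:R * (nm P ^+ 2 + 1)))).
  rewrite expr2 mulrAC ler_wpM2r ?nm_ge0 //.
  apply: le_trans (nmM _ _) _; rewrite nm_trC ler_wpM2l ?nm_ge0 //.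
  apply: ler_sum => l _.
  rewrite (bigD1 l) //= big1 ?addr0 => [|j jl].
    by rewrite !mxE eqxx !mulr1n; exact: ltW.
  by rewrite !mxE eq_sym (negPf jl) !mulr0n subr0 ComplexField.Normc.normc0.
rewrite sumr_const card_ord -[X in _ * X]mulr_natl.
have h0 : 0 < nm P ^+ 2 + 1 by rewrite ltr_wpDl // sqr_ge0.
have -> : nm P ^+ 2 * (n.+1%:R * (e / (n.+1%:R * (nm P ^+ 2 + 1)))) =
  e * (nm P ^+ 2 / (nm P ^+ 2 + 1)).
  by field; rewrite gt_eqF //= pnatr_eq0.
by rewrite gtr_pMr // ltr_pdivrMr // mul1r ltrDl.
Unshelve. all: by end_near.
Qed.

Lemma unitary_conj_diag n (P : 'M[C]_n) (d : 'rV[C]_n) : P \is unitarymx ->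
  (forall i, d 0 i * (d 0 i)^* = 1) -> P^t* *m diag_mx d *m P \is unitarymx.
Proof.
move=> PU hd; apply: (fun h => unitaryM (unitaryM (unitaryV PU) h) PU).
apply/unitarymxP/matrixP => i j; rewrite !mxE (bigD1 j) //= big1 ?addr0.
  rewrite !mxE eqxx mulr1n.
  by case: eqVneq => [->|]; rewrite ?mulr0n ?mul0r // mulr1n hd.
by move=> k kj; rewrite !mxE [j == k]eq_sym (negPf kj) mulr0n conjC0 mulr0.
Qed.

Lemma det_conj_unitary n (P D : 'M[C]_n) : P \is unitarymx ->
  \det (P^t* *m D *m P) = \det D.
Proof.
move=> /unitarymxP PU; rewrite !det_mulmx mulrAC -det_mulmx.
have -> : P^t* *m P = 1%:M by exact: mulmx1C.
by rewrite det1 mul1r.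
Qed.

Lemma trace_conj_unitary n (P D : 'M[C]_n) : P \is unitarymx ->
  \tr (P^t* *m D *m P) = \tr D.
Proof.
by move=> /unitarymxP PU; rewrite mxtrace_mulC !mulmxA PU mul1mx.
Qed.

Definition su n : set 'M[C]_n := [set A | A^t* = - A /\ \tr A = 0].

(** A skew-Hermitian matrix is normal, so the spectral theorem applies; skewness makes the
    eigenvalues imaginary and the trace makes the angles add up to 0. *)
Lemma su_spectral n (A : 'M[C]_n) : su A ->
  exists P, exists2 th : 'rV[R]_n,
    P \is unitarymx /\ \sum_i th 0 i = 0 & A = P^t* *m imdiag th *m P.
Proof.
move=> [AH A0].
have /orthomx_spectralP : A \is normalmx.
  by apply/normalmxP; rewrite AH mulNmx mulmxN.
set P := spectralmx A; set d := spectral_diag A => EA.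
have PU : P \is unitarymx by exact: spectral_unitarymx.
rewrite invmx_unitary // in EA.
have dE i : d 0 i = 'i%C * (complex.Im (d 0 i))%:C%C.
  have Ed : diag_mx d = P *m A *m P^t*.
    by rewrite EA !mulmxA (unitarymxP PU) mul1mx -mulmxA (unitarymxP PU) mulmx1.
  have : (diag_mx d)^t* = - diag_mx d.
    by rewrite Ed !trmx_mul !map_mxM trmxCK AH mulNmx mulmxN mulmxA.
  move/(congr1 (fun X : 'M[C]_n => X i i)); rewrite !mxE eqxx !mulr1n.
  case: (d 0 i) => x y /eqP; rewrite /Num.conj /= eq_complex /= => /andP[/eqP h _].
  by apply/eqP; rewrite eq_complex /=; apply/andP; split; apply/eqP; [lra|ring].
exists P, (\row_i complex.Im (d 0 i)).
  split=> //; apply: complexI; rewrite rmorph0 rmorph_sum /=.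
  have := trace_conj_unitary (diag_mx d) PU.
  rewrite -EA A0 mxtrace_diag => /esym h.
  under eq_bigr do rewrite mxE.
  apply: (mulfI (_ : 'i%C != 0)); first by rewrite eq_complex /= oner_eq0 andbF.
  by rewrite mulr0 -[RHS]h mulr_sumr; apply: eq_bigr => i _; rewrite -dE.
rewrite /imdiag.
have <- : d = map_mx (fun x => 'i%C * x%:C%C) (\row_i complex.Im (d 0 i)).
  by apply/rowP => i; rewrite !mxE -dE.
exact: EA.
Qed.

End Exponential.

Section ExponentialSurjective.
Variable R : realType.
Local Notation C := R[i].
Local Notation normc := (@ComplexField.Normc.normc R).
Local Open Scope classical_set_scope.

Lemma imdiagZ n (s : R) (th : 'rV[R]_n) :
  s%:C%C *: imdiag th = imdiag (s *: th).
Proof.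
apply/matrixP => i j; rewrite !mxE rmorphM.
by case: (i == j); rewrite ?mulr1n ?mulr0n ?mulr0 // mulrCA mulrA.
Qed.

Lemma imdiag_trC n (th : 'rV[R]_n) : (imdiag th)^t* = - imdiag th.
Proof.
apply/matrixP => i j; rewrite !mxE [j == i]eq_sym.
case: eqVneq => [->|_]; last by rewrite !mulr0n oppr0 [LHS]conjC0.
rewrite !mulr1n; apply/eqP; rewrite eq_complex /Num.conj /=.
by apply/andP; split; apply/eqP; ring.
Qed.

(** All real multiples of [A] share one eigenbasis, so the group law and the remainder reduce to
    [expiD] and [expi_approx] on each eigenvalue. *)
Lemma expmx_su n (A : 'M[C]_n.+1) : su A ->
  [/\ forall s : R, SU (expmx (s%:C%C *: A)),
      forall s t : R, expmx ((s + t)%:C%C *: A) =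
        expmx (s%:C%C *: A) *m expmx (t%:C%C *: A)
    & exists K : R, forall s : R,
        nm (expmx (s%:C%C *: A) - 1%:M - s%:C%C *: A) <= K * s ^+ 2].
Proof.
move=> /su_spectral[P [th [PU th0] ->]].
have E (s : R) : expmx (s%:C%C *: (P^t* *m imdiag th *m P)) =
    P^t* *m diag_mx (map_mx (@expi R) (s *: th)) *m P.
  by rewrite scalemxAl scalemxAr imdiagZ expmx_spectral.
split=> [s|s t|].
- rewrite E; split.
    by apply: unitary_conj_diag => // i; rewrite !mxE expi_mulC.
  rewrite det_conj_unitary // det_diag.
  under eq_bigr do rewrite mxE.
  rewrite -expi_sum; under eq_bigr do rewrite mxE.
  by rewrite -mulr_sumr th0 mulr0 expi0.
- rewrite !E.
  have -> : diag_mx (map_mx (@expi R) ((s + t) *: th)) =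
      diag_mx (map_mx (@expi R) (s *: th)) *m diag_mx (map_mx (@expi R) (t *: th)).
    rewrite mulmx_diag; congr diag_mx.
    by apply/rowP => i; rewrite !mxE mulrDl expiD.
  by rewrite !mulmxA (unitary_mulK _ PU).
exists (nm P * (\sum_i 2 * th 0 i ^+ 2) * nm P) => s.
rewrite E scalemxAl scalemxAr imdiagZ.
have -> : 1%:M = P^t* *m 1%:M *m P by rewrite mulmx1 unitary_mulV.
rewrite -!(mulmxBl, mulmxBr).
apply: le_trans (nmM _ _) _; rewrite mulrAC ler_wpM2r ?nm_ge0 //.
apply: le_trans (nmM _ _) _; rewrite nm_trC -mulrA ler_wpM2l ?nm_ge0 //.
rewrite mulr_suml; apply: ler_sum => i _.
rewrite (bigD1 i) //= big1 ?addr0 => [|j ji].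
  rewrite !mxE eqxx !mulr1n.
  apply: le_trans (expi_approx _) _; rewrite exprMn le_eqVlt; apply/orP; left.
  by apply/eqP; ring.
by rewrite !mxE eq_sym (negPf ji) !mulr0n subr0 subrr ComplexField.Normc.normc0.
Qed.

Lemma expmx_surj n (g : 'M[C]_n.+1) : SU g ->
  exists2 A : 'M[C]_n.+1, su A & g = expmx A.
Proof.
move=> [gU g1].
have /orthomx_spectralP : g \is normalmx.
  apply/normalmxP; rewrite (unitarymxP gU).
  by rewrite (mulmx1C (unitarymxP gU)).
set P := spectralmx g; set d := spectral_diag g => Eg.
have PU : P \is unitarymx by exact: spectral_unitarymx.
rewrite invmx_unitary // in Eg.
have dU i : d 0 i * (d 0 i)^* = 1.
  have Ed : diag_mx d = P *m g *m P^t*.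
    by rewrite Eg !mulmxA (unitarymxP PU) mul1mx -mulmxA (unitarymxP PU) mulmx1.
  have : diag_mx d \is unitarymx.
    by rewrite Ed; exact: unitaryM (unitaryM PU gU) (unitaryV PU).
  move=> /unitarymxP/matrixP/(_ i i); rewrite !mxE (bigD1 i) //= big1 ?addr0.
    by rewrite !mxE eqxx !mulr1n.
  by move=> k ki; rewrite !mxE [i == k]eq_sym (negPf ki) mulr0n mul0r.
have [th hth] := choice (fun i => expi_surj (dU i)).
have dprod : expi (\sum_i th i) = 1.
  rewrite expi_sum -[RHS]g1 Eg det_conj_unitary // det_diag.
  by apply: eq_bigr => i _; rewrite hth.
(* Determinant 1 only says that the angles add up to a multiple of $2\pi$. Subtracting the whole sum
   from one of them kills the trace without changing the exponential. *)
pose th' := \row_i (th i - (\sum_i th i) *+ (i == 0)).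
exists (P^t* *m imdiag th' *m P).
  split.
    by rewrite !trmx_mul !map_mxM trmxCK imdiag_trC mulNmx mulmxN mulmxA.
  rewrite trace_conj_unitary // mxtrace_diag.
  under eq_bigr do rewrite !mxE.
  rewrite -mulr_sumr -rmorph_sum sumrB (bigD1 ord0) //= [X in _ - X](bigD1 ord0) //=.
  rewrite [X in _ - (_ + X)]big1 => [|i /negPf ->]; last by rewrite mulr0n.
  by rewrite mulr1n addr0 subrr mulr0.
rewrite expmx_spectral //.
have <- : d = map_mx (@expi R) th'.
  apply/rowP => i; rewrite !mxE hth; case: (i == 0); last by rewrite mulr0n subr0.
  by rewrite mulr1n expiD -conj_expi dprod conjC1 mulr1.
exact: Eg.
Qed.

End ExponentialSurjective.

(** * Differentiability of one-parameter groups *)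

Section OneParameter.
Variable R : realType.
Local Notation C := R[i].
Local Notation normc := (@ComplexField.Normc.normc R).

Lemma le0_archi (x c : R) : (forall k : nat, x <= c / k.+1%:R) -> x <= 0.
Proof.
move=> h; rewrite leNgt; apply/negP => x0.
have := h (Num.truncn (c / x)).
rewrite ler_pdivlMr // leNgt => /negP; apply.
by rewrite mulrC -ltr_pdivrMr // truncnS_gt.
Qed.

Lemma le_lim_archi (x y c : R) : (forall k : nat, x <= y + c / k.+1%:R) -> x <= y.
Proof.
move=> h; rewrite -subr_le0; apply: (@le0_archi _ c) => k.
by rewrite lerBlDl.
Qed.

Lemma ltn_exp2 k : (k.+1%:R : R) <= 2 ^+ k.
Proof. by rewrite -natrX ler_nat ltn_expl. Qed.

Lemma le_lim_exp2 (x y c : R) : 0 <= c ->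
  (forall k : nat, x <= y + c / 2 ^+ k) -> x <= y.
Proof.
move=> c0 h; apply: (@le_lim_archi _ _ c) => k; apply: le_trans (h k) _.
by rewrite lerD2l ler_wpM2l // lef_pV2 ?ltn_exp2 // posrE ?exprn_gt0.
Qed.

(** The intervals of radius $2c/2^k$ around [u k] are nested, and the supremum of their left ends
    lies in all of them. *)
Lemma cauchy_geometric (u : nat -> R) (c : R) :
  (forall k, `|u k.+1 - u k| <= c / 2 ^+ k) ->
  exists l, forall k, `|l - u k| <= 2 * c / 2 ^+ k.
Proof.
move=> h; pose a k := u k - 2 * c / 2 ^+ k; pose b k := u k + 2 * c / 2 ^+ k.
have c0 : 0 <= c by have := le_trans (normr_ge0 _) (h 0); rewrite expr0 divr1.
have step k : (2 * c / 2 ^+ k) = c / 2 ^+ k + 2 * c / 2 ^+ k.+1.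
  by rewrite exprS; field; rewrite expf_neq0.
have aS k : a k <= a k.+1.
  by rewrite /a (step k); have := h k; rewrite ler_norml => /andP[]; lra.
have bS k : b k.+1 <= b k.
  by rewrite /b (step k); have := h k; rewrite ler_norml => /andP[]; lra.
have ab k : a k <= b k.
  rewrite /a /b lerD2l; apply: (@le_trans _ _ 0); rewrite ?oppr_le0;
  by rewrite !mulr_ge0 ?invr_ge0 ?exprn_ge0.
have am k l : (k <= l)%N -> a k <= a l 
  by move=> /subnKC <-; elim: (l - k)%N => [|p ih]; rewrite ?addn0 ?addnS // (le_trans ih).
have bm k l : (k <= l)%N -> b l <= b k.
  by move=> /subnKC <-; elim: (l - k)%N => [|p ih]; rewrite ?addn0 ?addnS // (le_trans _ ih).
have abl k l : a k <= b l.
  by apply: le_trans (am _ _ (leq_maxl k l)) (le_trans (ab _) (bm _ _ (leq_maxr k l))).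
pose A : set R := [set a k | k in setT]%classic.
have hub l : ubound A (b l) by move=> _ [k _ <-].
have A0 : has_sup A by split; [exists (a 0%N), 0%N|exists (b 0%N)].
exists (sup A) => k; rewrite ler_distl -/(a k) -/(b k); apply/andP; split.
  by apply: sup_upper_bound => //; exists k.
by apply: ge_sup => //; case: A0.
Qed.

Lemma normc_le_Re_Im (z : C) : normc z <= `|complex.Re z| + `|complex.Im z|.
Proof.
rewrite {1}[z]complexE; apply: le_trans (le_normcD _ _) _.
rewrite ComplexField.Normc.normcM !normc_real.
have -> : normc 'i%C = 1 by rewrite /= expr0n expr1n add0r sqrtr1.
by rewrite mul1r.
Qed.

Lemma Re_Im_le_normc (z : C) :
  `|complex.Re z| <= normc z /\ `|complex.Im z| <= normc z.
Proof.
case: z => x y /=; split; rewrite -sqrtr_sqr ler_wsqrtr //.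
  by rewrite lerDl sqr_ge0.
by rewrite lerDr sqr_ge0.
Qed.

Lemma mx_cauchy_geometric m n (U : nat -> 'M[C]_(m, n)) (c : R) :
  (forall k, nm (U k.+1 - U k) <= c / 2 ^+ k) ->
  exists L, forall k, nm (L - U k) <= (m * n)%:R * (4 * c) / 2 ^+ k.
Proof.
move=> h.
have hr i j : exists l, forall k,
    `|l - complex.Re (U k i j)| <= 2 * c / 2 ^+ k.
  apply: cauchy_geometric => k; apply: le_trans (h k).
  have := normc_le_nm (U k.+1 - U k) i j; apply: le_trans.
  have [+ _] := Re_Im_le_normc ((U k.+1 - U k) i j).
  by rewrite !mxE; case: (U k.+1 i j) => ? ?; case: (U k i j).
have hi i j : exists l, forall k,
    `|l - complex.Im (U k i j)| <= 2 * c / 2 ^+ k.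
  apply: cauchy_geometric => k; apply: le_trans (h k).
  have := normc_le_nm (U k.+1 - U k) i j; apply: le_trans.
  have [_] := Re_Im_le_normc ((U k.+1 - U k) i j).
  by rewrite !mxE; case: (U k.+1 i j) => ? ?; case: (U k i j).
exists (\matrix_(i, j) Complex (projT1 (cid (hr i j))) (projT1 (cid (hi i j)))) => k.
have -> : (m * n)%:R * (4 * c) / 2 ^+ k =
    \sum_(i < m) \sum_(j < n) (4 * c / 2 ^+ k).
  by rewrite !sumr_const !card_ord -mulrnA -[RHS]mulr_natr !natrM; ring.
apply: ler_sum => i _; apply: ler_sum => j _; rewrite !mxE.
case: (cid _) => r /= /(_ k) hr'; case: (cid _) => l /= /(_ k) hi'.
apply: le_trans (normc_le_Re_Im _) _.
move: hr' hi'; case: (U k i j) => x y /= hr' hi'.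
apply: le_trans (lerD hr' hi') _.
by rewrite -!mulrA -mulrDl; lra.
Qed.

(** The difference [Z] with the linear map is additive and vanishes at 1, so it has period 1 and is
    bounded on the half line; $Z(kt)=kZ(t)$ then forces it to be 0. *)
Lemma additive_bounded_linear m n (Y : R -> 'M[C]_(m, n)) (L : R) :
  (forall s t, Y (s + t) = Y s + Y t) -> (forall s, nm (Y s) <= L * `|s|) ->
  forall s, Y s = s%:C%C *: Y 1.
Proof.
move=> YD YL s; pose Z t := Y t - t%:C%C *: Y 1.
have ZD t t' : Z (t + t') = Z t + Z t'.
  by rewrite /Z YD rmorphD scalerDl opprD addrACA.
have Z1 : Z 1 = 0 by rewrite /Z rmorph1 scale1r subrr.
have Z0 : Z 0 = 0 by apply: (addIr (Z 0)); rewrite -ZD addr0 add0r.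
have Zn k t : Z (k%:R * t) = k%:R *: Z t.
  elim: k => [|k ih]; first by rewrite mul0r scale0r.
  by rewrite -addn1 natrD mulrDl mul1r ZD ih natrD scalerDl scale1r.
have ZN t : Z (- t) = - Z t by apply: (addrI (Z t)); rewrite -ZD !subrr.
have ZL t : nm (Z t) <= (L + nm (Y 1)) * `|t|.
  apply: le_trans (nmB _ _) _; rewrite nmZ normc_real mulrDl mulrC [nm _ * _]mulrC.
  by rewrite lerD // mulrC.
have Zb t : 0 <= t -> nm (Z t) <= L + nm (Y 1).
  move=> t0; have /andP[h1 h2] := truncn_itv t0.
  have := Zn (Num.truncn t) 1; rewrite mulr1 Z1 scaler0 => Zt.
  rewrite -(subrK (Num.truncn t)%:R t) ZD Zt addr0; apply: le_trans (ZL _) _.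
  have LY : 0 <= L + nm (Y 1).
    by have := le_trans (nm_ge0 _) (ZL 1); rewrite normr1 mulr1.
  rewrite ler_piMr // ger0_norm ?subr_ge0 // lerBlDl.
  by rewrite natr1 ltW.
suff Zp t : 0 <= t -> Z t = 0.
  have : Z s = 0.
    have [/Zp//|s0] := leP 0 s.
    by rewrite -[s]opprK ZN Zp ?oppr0 // oppr_ge0 ltW.
  by move/eqP; rewrite subr_eq0 => /eqP.
move=> t0; apply: nm0_eq0; apply: (@le0_archi _ (L + nm (Y 1))) => k.
rewrite ler_pdivlMr // mulrC.
have := Zb (k.+1%:R * t); rewrite Zn nmZ => /(_ (mulr_ge0 _ t0)) h.
have -> : k.+1%:R = normc (k.+1%:R) :> R.
  by rewrite -[RHS]/(normc k.+1%:R) -(rmorph_nat (real_complex R)) normc_real ger0_norm.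
by apply: h.
Qed.

(** The dyadic difference quotients [E k s] are Cauchy at a geometric rate because
    $\phi(2h)-1=2(\phi(h)-1)+(\phi(h)-1)^2$. Their limit is additive in [s], hence linear, and the
    distance from the limit to the term [k = 0] is already the quadratic remainder. *)
Lemma one_parameter_differentiable d (phi : R -> 'M[C]_d) (L : R) :
  (forall s t, phi (s + t) = phi s *m phi t) ->
  (forall s, nm (phi s - 1%:M) <= L * `|s|) ->
  exists X, exists K, forall s, nm (phi s - 1%:M - s%:C%C *: X) <= K * s ^+ 2.
Proof.
move=> phiD phiL.
have n2 k : normc (2 ^+ k) = 2 ^+ k.
  by rewrite -(rmorph_nat (real_complex R)) -rmorphXn normc_real ger0_norm ?exprn_ge0.
pose E k s : 'M[C]_d := 2 ^+ k *: (phi (s / 2 ^+ k) - 1%:M).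
have phiLL s t : nm ((phi s - 1%:M) *m (phi t - 1%:M)) <= L ^+ 2 * (`|s| * `|t|).
  apply: le_trans (nmM _ _) _.
  by apply: le_trans (ler_pM (nm_ge0 _) (nm_ge0 _) (phiL _) (phiL _)) _; rewrite mulrACA.
have mulB (M N : 'M[C]_d) :
    M *m N - 1%:M = (M - 1%:M) *m (N - 1%:M) + (M - 1%:M) + (N - 1%:M).
  by rewrite mulmxBl mulmxBr mulmx1 mul1mx addrAC subrK addrA subrK.
have step s k : nm (E k.+1 s - E k s) <= (L ^+ 2 * s ^+ 2) / 2 ^+ k.
  have -> : E k.+1 s - E k s =
     - 2 ^+ k *: ((phi (s / 2 ^+ k.+1) - 1%:M) *m (phi (s / 2 ^+ k.+1) - 1%:M)).
    have e : s / 2 ^+ k = s / 2 ^+ k.+1 + s / 2 ^+ k.+1.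
      by rewrite exprS; field; rewrite expf_neq0.
    rewrite /E e phiD mulB; move: (phi _ - 1%:M) => a.
    move: (a *m a) => q; apply/matrixP => i j; rewrite exprS !mxE; ring.
  rewrite scaleNr nmN nmZ n2.
  apply: (@le_trans _ _ (2 ^+ k * (L ^+ 2 * (`|s / 2 ^+ k.+1| * `|s / 2 ^+ k.+1|)))).
    by rewrite ler_wpM2l ?exprn_ge0.
  rewrite -expr2 real_normK ?num_real // expr_div_n -!exprM mulnC.
  have -> : 2 ^+ k * (L ^+ 2 * (s ^+ 2 / 2 ^+ (2 * k.+1))) =
     L ^+ 2 * s ^+ 2 / 2 ^+ k * 4^-1.
    by rewrite mulnS mul2n -addnn !exprD; field; rewrite expf_neq0.
  rewrite ler_piMr ?invf_le1 //; last by rewrite ler1n.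
  by rewrite divr_ge0 ?exprn_ge0 // mulr_ge0 ?sqr_ge0.
have lim s := mx_cauchy_geometric (step s).
pose Y s := projT1 (cid (lim s)).
have hY s k : nm (Y s - E k s) <= (d * d)%:R * (4 * (L ^+ 2 * s ^+ 2)) / 2 ^+ k.
  by rewrite /Y; case: (cid _).
have YD s t : Y (s + t) = Y s + Y t.
  apply/eqP; rewrite -subr_eq0; apply/eqP; apply: nm0_eq0.
  pose c u := (d * d)%:R * (4 * (L ^+ 2 * u ^+ 2)).
  have c0 u : 0 <= c u by do 3!rewrite mulr_ge0 ?sqr_ge0 //.
  apply: (@le_lim_exp2 _ _ (c (s + t) + c s + c t + L ^+ 2 * (`|s| * `|t|))).
    by rewrite !addr_ge0 // mulr_ge0 ?sqr_ge0 // mulr_ge0.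
  move=> k; rewrite add0r.
  have EE : E k (s + t) - (E k s + E k t) =
      2 ^+ k *: ((phi (s / 2 ^+ k) - 1%:M) *m (phi (t / 2 ^+ k) - 1%:M)).
    rewrite /E mulrDl phiD mulB.
    move: (phi (s / _) - _) (phi (t / _) - _) => x y; move: (x *m y) => q.
    by apply/matrixP => i j; rewrite !mxE; ring.
  have -> : Y (s + t) - (Y s + Y t) = (Y (s + t) - E k (s + t))
      - (Y s - E k s) - (Y t - E k t) + (E k (s + t) - (E k s + E k t)).
    by rewrite !opprD !opprK !addrA; apply/matrixP => i j; rewrite !mxE; ring.
  apply: le_trans (nmD _ _) _; rewrite mulrDl lerD //.
    apply: le_trans (nmB _ _) _; rewrite mulrDl lerD //.
    by apply: le_trans (nmB _ _) _; rewrite mulrDl lerD.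
  rewrite EE nmZ n2; apply: le_trans (ler_wpM2l (exprn_ge0 _ _) (phiLL _ _)) _ => //.
  rewrite !normrM normfV (ger0_norm (exprn_ge0 _ _)) //.
  rewrite le_eqVlt; apply/orP; left; apply/eqP.
  by field; rewrite expf_neq0.
have YL s : nm (Y s) <= L * `|s|.
  apply: (@le_lim_exp2 _ _ ((d * d)%:R * (4 * (L ^+ 2 * s ^+ 2)))).
    by do 3!rewrite mulr_ge0 ?sqr_ge0 //.
  move=> k; rewrite -[Y s](subrK (E k s)) addrC; apply: le_trans (nmD _ _) _.
  rewrite lerD // /E nmZ n2.
  apply: le_trans (ler_wpM2l (exprn_ge0 _ _) (phiL _)) _ => //.
  rewrite normrM normfV (ger0_norm (exprn_ge0 _ _)) //.
  rewrite le_eqVlt; apply/orP; left; apply/eqP.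
  by field; rewrite expf_neq0.
exists (Y 1), ((d * d)%:R * (4 * L ^+ 2)) => s.
rewrite -(additive_bounded_linear YD YL) -nmN opprB.
by have := hY s 0%N; rewrite /E expr0 scale1r divr1 divr1 -!mulrA.
Qed.

End OneParameter.

(** * Derived representations *)

Section Tangent.
Variable R : realType.
Local Notation C := R[i].
Local Notation normc := (@ComplexField.Normc.normc R).

Lemma trCD m n (A B : 'M[C]_(m, n)) : (A + B)^t* = A^t* + B^t*.
Proof. by apply/matrixP => i j; rewrite !mxE rmorphD. Qed.

Lemma trCN m n (A : 'M[C]_(m, n)) : (- A)^t* = - A^t*.
Proof. by apply/matrixP => i j; rewrite !mxE rmorphN. Qed.

Lemma trCB m n (A B : 'M[C]_(m, n)) : (A - B)^t* = A^t* - B^t*.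
Proof. by rewrite trCD trCN. Qed.

Lemma trCZ m n c (A : 'M[C]_(m, n)) : (c *: A)^t* = c^* *: A^t*.
Proof. by apply/matrixP => i j; rewrite !mxE rmorphM. Qed.

Lemma trCM m n p (A : 'M[C]_(m, n)) (B : 'M[C]_(n, p)) :
  (A *m B)^t* = B^t* *m A^t*.
Proof. by rewrite trmx_mul map_mxM. Qed.

Lemma trC1 n : (1%:M : 'M[C]_n)^t* = 1%:M.
Proof. by rewrite trmx1 map_mx1. Qed.

Lemma trace_trC n (A : 'M[C]_n) : \tr (A^t*) = (\tr A)^*.
Proof. by rewrite rmorph_sum; apply: eq_bigr => i _; rewrite !mxE. Qed.

Lemma SU1 n : SU (1%:M : 'M[C]_n).
Proof. by split; [exact: unitary1|exact: det1]. Qed.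

Lemma SUM n (g h : 'M[C]_n) : SU g -> SU h -> SU (g *m h).
Proof.
move=> [gU g1] [hU h1]; split; first exact: unitaryM.
by rewrite det_mulmx g1 h1 mulr1.
Qed.

Lemma SUV n (g : 'M[C]_n) : SU g -> SU (g^t*).
Proof.
move=> [gU g1]; split; first exact: unitaryV.
by rewrite det_map_mx det_tr g1 rmorph1.
Qed.

Lemma SU_mulV n (g : 'M[C]_n) : SU g -> g *m g^t* = 1%:M.
Proof. by case=> /unitarymxP. Qed.

Lemma SU_Vmul n (g : 'M[C]_n) : SU g -> g^t* *m g = 1%:M.
Proof. by case=> /unitary_mulV. Qed.

(** First-order contact with $1+sX$. The remainder is controlled on all of [R], so no neighbourhoods
    occur, and boundedness of [f] keeps the class stable under products. *)
Definition tangent d (f : R -> 'M[C]_d) (X : 'M[C]_d) :=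
  (exists K, forall s, nm (f s - 1%:M - s%:C%C *: X) <= K * s ^+ 2) /\
  (exists D, forall s, nm (f s) <= D).

Lemma tangentP d f (X : 'M[C]_d) : tangent f X ->
  exists2 K : R, 0 <= K & forall s, [/\ nm (f s) <= K,
    nm (f s - 1%:M - s%:C%C *: X) <= K * s ^+ 2 & nm (f s - 1%:M) <= K * `|s|].
Proof.
move=> [[K hK] [D hD]]; exists (`|K| + nm X + `|D| + d%:R).
  by rewrite !addr_ge0 ?nm_ge0.
move=> s; have X0 := nm_ge0 X; have d0 : 0 <= d%:R :> R by [].
have D0 := normr_ge0 D; have K0 := normr_ge0 K.
have hK' : nm (f s - 1%:M - s%:C%C *: X) <= `|K| * s ^+ 2.
  by apply: le_trans (hK s) _; rewrite ler_wpM2r ?sqr_ge0 // ler_norm.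
split.
- by apply: le_trans (hD s) _; apply: le_trans (ler_norm _) _; lra.
- by apply: le_trans hK' _; rewrite ler_wpM2r ?sqr_ge0 //; lra.
(* For small [s] the Lipschitz bound comes from the expansion, for large [s] from boundedness. *)
have [s1|s1] := leP `|s| 1.
  rewrite -[f s - 1%:M](subrK (s%:C%C *: X)); apply: le_trans (nmD _ _) _.
  rewrite nmZ normc_real.
  apply: (@le_trans _ _ ((`|K| + nm X) * `|s|)).
    rewrite mulrDl [nm X * _]mulrC lerD2r; apply: le_trans hK' _.
    by rewrite ler_wpM2l // -real_normK ?num_real // expr2 ler_piMl.
  by rewrite ler_wpM2r //; lra.
apply: le_trans (nmB _ _) _; rewrite nm1.
apply: (@le_trans _ _ (`|D| + d%:R)).
  by rewrite lerD2r; apply: le_trans (hD s) (ler_norm _).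
apply: (@le_trans _ _ ((`|D| + d%:R) * `|s|)); first by rewrite ler_peMr ?addr_ge0 // ltW.
by rewrite ler_wpM2r //; lra.
Qed.

Lemma quadratic_eq0 m n (M : 'M[C]_(m, n)) (K : R) :
  (forall s : R, nm (s%:C%C *: M) <= K * s ^+ 2) -> M = 0.
Proof.
move=> h; apply: nm0_eq0; apply: (@le0_archi _ _ K) => k.
have := h k.+1%:R^-1; rewrite nmZ normc_real normfV normr_nat.
rewrite mulrC ler_pdivrMr // => /le_trans; apply.
by rewrite expr2 -!mulrA mulVf ?mulr1 // pnatr_eq0.
Qed.

Lemma tangent_uniq d f (X Y : 'M[C]_d) : tangent f X -> tangent f Y -> X = Y.
Proof.
move=> [[K hK] _] [[L hL] _]; apply/eqP; rewrite -subr_eq0; apply/eqP.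
apply: (@quadratic_eq0 _ _ _ (K + L)) => s; rewrite mulrDl.
apply: le_trans (lerD (hK s) (hL s)); rewrite -nmN.
have -> : - (s%:C%C *: (X - Y)) =
  (f s - 1%:M - s%:C%C *: X) - (f s - 1%:M - s%:C%C *: Y).
  by apply/matrixP => i j; rewrite !mxE; ring.
exact: nmB.
Qed.

Lemma tangent_mul d f g (X Y : 'M[C]_d) : tangent f X -> tangent g Y ->
  tangent (fun s => f s *m g s) (X + Y).
Proof.
move=> /tangentP[K K0 hK] /tangentP[L L0 hL]; split; last first.
  exists (K * L) => s; have [h1 _ _] := hK s; have [h2 _ _] := hL s.
  exact: le_trans (nmM _ _) (ler_pM (nm_ge0 _) (nm_ge0 _) h1 h2).
exists (K * L + K + K * nm Y) => s; have [h1 h2 h3] := hK s; have [h4 h5 h6] := hL s.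
have -> : f s *m g s - 1%:M - s%:C%C *: (X + Y) =
   f s *m (g s - 1%:M - s%:C%C *: Y) + (f s - 1%:M - s%:C%C *: X) +
   s%:C%C *: ((f s - 1%:M) *m Y).
  rewrite !mulmxBr mulmxBl mulmx1 mul1mx -scalemxAr.
  move: (f s *m g s) (f s *m Y) => p q.
  by apply/matrixP => i j; rewrite !mxE; ring.
rewrite !mulrDl; apply: le_trans (nmD _ _) _; rewrite lerD //.
  apply: le_trans (nmD _ _) _; rewrite lerD //.
  rewrite -mulrA; apply: le_trans (nmM _ _) _.
  exact: ler_pM (nm_ge0 _) (nm_ge0 _) h1 h5.
rewrite nmZ normc_real -(@real_normK _ s) ?num_real //.
apply: le_trans (ler_wpM2l (normr_ge0 s) (nmM _ _)) _.
apply: le_trans (ler_wpM2l (normr_ge0 s) (ler_wpM2r (nm_ge0 Y) h3)) _.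
rewrite le_eqVlt; apply/orP; left; apply/eqP; ring.
Qed.

Lemma tangent_conj d e f (X : 'M[C]_d) (P : 'M[C]_(e, d)) (Q : 'M[C]_(d, e)) :
  P *m Q = 1%:M -> tangent f X ->
  tangent (fun s => P *m f s *m Q) (P *m X *m Q).
Proof.
move=> PQ /tangentP[K K0 hK]; split.
  exists (nm P * K * nm Q) => s; have [_ h _] := hK s.
  have -> : P *m f s *m Q - 1%:M - s%:C%C *: (P *m X *m Q) =
      P *m (f s - 1%:M - s%:C%C *: X) *m Q.
    by rewrite !mulmxBr !mulmxBl mulmx1 PQ -scalemxAr -scalemxAl.
  apply: le_trans (nmM _ _) _; rewrite mulrAC ler_wpM2r ?nm_ge0 //.
  by apply: le_trans (nmM _ _) _; rewrite -mulrA ler_wpM2l ?nm_ge0.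
exists (nm P * K * nm Q) => s; have [h _ _] := hK s.
apply: le_trans (nmM _ _) _; rewrite ler_wpM2r ?nm_ge0 //.
by apply: le_trans (nmM _ _) _; rewrite ler_wpM2l ?nm_ge0.
Qed.

Lemma tangent_scale d f (X : 'M[C]_d) c : tangent f X ->
  tangent (fun s => f (c * s)) (c%:C%C *: X).
Proof.
move=> [[K hK] [D hD]]; split; last by exists D.
exists (K * c ^+ 2) => s; rewrite -mulrA -exprMn scalerA [s%:C%C * _]mulrC -rmorphM.
exact: hK.
Qed.

Lemma tangent_trC d f (X : 'M[C]_d) : tangent f X ->
  tangent (fun s => (f s)^t*) (X^t*).
Proof.
move=> [[K hK] [D hD]]; split; last by exists D => s; rewrite nm_trC.
exists K => s; apply: le_trans (hK s); rewrite -[X in _ <= X]nm_trC !trCB trC1 trCZ.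
by rewrite [(s%:C%C)^*]conjc_real.
Qed.

Lemma tangent_expmx n (A : 'M[C]_n.+1) : su A ->
  tangent (fun s : R => expmx (s%:C%C *: A)) A.
Proof.
move=> /expmx_su[h1 h2 [K hK]]; split; first by exists K.
exists (n.+1 * n.+1)%:R => s; apply: nm_unitary.
by case: (h1 s).
Qed.

(** The derivative of conjugation is the commutator. Stated for abstract curves [f] and [g] so that
    it serves both for the exponential in the group and for its image under [pi]. *)
Lemma conj_expand d f g (Y A : 'M[C]_d) : tangent f Y -> tangent g (- Y) ->
  exists2 K, 0 <= K & forall s,
    nm (f s *m A *m g s - A - s%:C%C *: (Y *m A - A *m Y)) <= K * s ^+ 2.
Proof.
move=> /tangentP[K K0 hK] /tangentP[L L0 hL].
exists (K * nm A * L + nm A * L + nm (Y *m A) * L).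
  by rewrite !addr_ge0 ?mulr_ge0 ?nm_ge0.
move=> s; have [h1 h2 h3] := hK s; have [h4 h5 h6] := hL s.
have -> : f s *m A *m g s - A - s%:C%C *: (Y *m A - A *m Y) =
   (f s - 1%:M - s%:C%C *: Y) *m A *m g s + A *m (g s - 1%:M - s%:C%C *: - Y)
   + s%:C%C *: (Y *m A *m (g s - 1%:M)).
  rewrite !mulmxBl !mulmxBr !mulmx1 !mul1mx -!scalemxAr -!scalemxAl mulmxN.
  move: (f s *m A *m g s) (Y *m A *m g s) (Y *m A) (A *m Y) (A *m g s) => p q r t u.
  by apply/matrixP => i j; rewrite !mxE; ring.
rewrite !mulrDl; apply: le_trans (nmD _ _) _; rewrite lerD //.
  apply: le_trans (nmD _ _) _; rewrite lerD //.
    apply: le_trans (nmM _ _) _.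
    apply: le_trans (ler_pM (nm_ge0 _) (nm_ge0 _) (nmM _ _) h4) _.
    rewrite [X in _ <= X]mulrAC ler_wpM2r // mulrAC ler_wpM2r ?nm_ge0 //.
  by apply: le_trans (nmM _ _) _; rewrite -mulrA ler_wpM2l ?nm_ge0.
rewrite nmZ normc_real -(@real_normK _ s) ?num_real //.
apply: le_trans (ler_wpM2l (normr_ge0 s) (nmM _ _)) _.
apply: le_trans (ler_wpM2l (normr_ge0 s) (ler_wpM2l (nm_ge0 _) h6)) _.
rewrite le_eqVlt; apply/orP; left; apply/eqP; ring.
Qed.

End Tangent.

Section Derivative.
Variable R : realType.
Local Notation C := R[i].
Local Notation normc := (@ComplexField.Normc.normc R).

Lemma SUX n (g : 'M[C]_n.+1) k : SU g -> SU (g ^+ k).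
Proof.
move=> hg; elim: k => [|k ih]; first by rewrite expr0; exact: SU1.
by rewrite exprS -mulmxE; exact: SUM.
Qed.

Lemma nm_SU n (g : 'M[C]_n) : SU g -> nm g <= (n * n)%:R.
Proof. by case=> /nm_unitary. Qed.

Lemma nm_SUX_sub1 n (g : 'M[C]_n.+1) k : SU g ->
  nm (g ^+ k - 1%:M) <= k%:R * ((n.+1 * n.+1)%:R * nm (g - 1%:M)).
Proof.
move=> hg; elim: k => [|k ih]; first by rewrite expr0 subrr nm0 mul0r.
have -> : g ^+ k.+1 - 1%:M = g ^+ k *m (g - 1%:M) + (g ^+ k - 1%:M).
  by rewrite mulmxBr mulmx1 addrA subrK exprSr mulmxE.
apply: le_trans (nmD _ _) _; rewrite -natr1 mulrDl mul1r addrC lerD //.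
apply: le_trans (nmM _ _) _; rewrite ler_wpM2r ?nm_ge0 // nm_SU //; exact: SUX.
Qed.

(* Doubling argument: if [pi (g ^ k)] stays near [1] for all [k <= N], then
   [(pi g - 1) (1 + pi g + ... + pi g ^ (N-1)) = pi (g ^ N) - 1] forces
   [pi g - 1] to be of size at most [1 / N]. *)
Lemma unitary_rep_lipschitz n d (pi : 'M[C]_n.+1 -> 'M[C]_d) :
  unitary_rep (@SU R n.+1) pi ->
  exists2 L : R, 0 <= L & forall g, SU g -> nm (pi g - 1%:M) <= L * nm (g - 1%:M).
Proof.
move=> [pi1 piM piU pic].
have half0 : (0 : R) < 2^-1 by rewrite invr_gt0.
have [del del0 hdel] := within_continuous_nm pic (SU1 R n.+1) half0.
pose c : R := (n.+1 * n.+1)%:R; have c0 : 0 < c by rewrite ltr0n.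
have dd0 : 0 <= (d * d)%:R + d%:R :> R by rewrite addr_ge0.
exists (((d * d)%:R + d%:R + 2) * (2 * c / del)).
  by rewrite mulr_ge0 ?addr_ge0 // divr_ge0 ?mulr_ge0 // ltW.
move=> g hg; set e := nm (g - 1%:M).
have [e0|e0] := leP e 0.
  have /eqP := nm0_eq0 e0; rewrite subr_eq0 => /eqP ->.
  by rewrite pi1 subrr nm0 mulr_ge0 ?nm_ge0 // mulr_ge0 ?addr_ge0 // divr_ge0 ?mulr_ge0 // ltW.
pose x := del / (2 * c * e).
have x0 : 0 <= x by rewrite divr_ge0 ?mulr_ge0 // ltW.
have /andP[Nx xN] := truncn_itv x0; set N := Num.truncn x in Nx xN.
have xE : 2 * c / del * e = x^-1 by rewrite /x; field; rewrite !gt_eqF.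
have x_gt0 : 0 < x by rewrite divr_gt0 ?mulr_gt0.
rewrite -mulrA xE.
(* If not even one power is guaranteed to stay close to 1, then [g] is far from 1 and the trivial
   bound for unitary matrices suffices. *)
case: (posnP N) => N0.
  rewrite N0 in xN; apply: (@le_trans _ _ ((d * d)%:R + d%:R)).
    by apply: le_trans (nmB _ _) _; rewrite nm1 lerD2r nm_unitary // piU.
  apply: (@le_trans _ _ ((d * d)%:R + d%:R + 2)); first by rewrite lerDl.
  by rewrite ler_peMr ?addr_ge0 // invf_ge1 // ltW.
have small k : (k <= N)%N -> nm (pi (g ^+ k) - 1%:M) <= 2^-1.
  move=> kN; apply: ltW; rewrite -nmN opprB -pi1; apply: hdel; first exact: SUX.
  rewrite -nmN opprB; apply: le_lt_trans (nm_SUX_sub1 _ hg) _.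
  apply: (@le_lt_trans _ _ (x * (c * e))).
    rewrite ler_wpM2r ?mulr_ge0 ?(ltW c0) ?(ltW e0) //.
    by apply: le_trans Nx; rewrite ler_nat.
  have -> : x * (c * e) = del / 2 by rewrite /x; field; rewrite !gt_eqF.
  by rewrite ltr_pdivrMr // ltr_pMr // ltr1n.
pose S : 'M[C]_d := \sum_(0 <= k < N) pi (g ^+ k).
have NR0 : 0 < N%:R :> R by rewrite ltr0n.
have SN : nm (N%:R *: 1%:M - S) <= N%:R / 2.
  have -> : N%:R *: 1%:M - S = \sum_(0 <= k < N) (1%:M - pi (g ^+ k)).
    by rewrite sumrB sumr_const_nat subn0 scaler_nat.
  apply: le_trans (nm_sum _ _ _) _.
  have -> : N%:R / 2 = \sum_(0 <= k < N) 2^-1 :> R.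
    by rewrite sumr_const_nat subn0 mulr_natl.
  rewrite big_nat [X in _ <= X]big_nat; apply: ler_sum => k /andP[_ kN].
  by rewrite -nmN opprB small // ltnW.
have tel : (pi g - 1%:M) *m S = pi (g ^+ N) - 1%:M.
  transitivity (\sum_(0 <= k < N) (pi (g ^+ k.+1) - pi (g ^+ k))).
    rewrite /S mulmx_sumr; apply: eq_bigr => k _.
    by rewrite mulmxBl mul1mx exprS -mulmxE piM //; exact: SUX.
  by rewrite (@telescope_sumr _ 0 N (fun k => pi (g ^+ k))) // expr0 pi1.
have : N%:R * nm (pi g - 1%:M) <= 2^-1 + N%:R / 2 * nm (pi g - 1%:M).
  have -> : N%:R * nm (pi g - 1%:M) = nm (N%:R *: (pi g - 1%:M)).
    by rewrite nmZ -(rmorph_nat (real_complex R)) normc_real normr_nat.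
  have -> : N%:R *: (pi g - 1%:M) =
      (pi g - 1%:M) *m S + (pi g - 1%:M) *m (N%:R *: 1%:M - S).
    by rewrite -mulmxDr [S + _]addrC subrK -scalemxAr mulmx1.
  apply: le_trans (nmD _ _) _; rewrite tel lerD ?small //.
  apply: le_trans (nmM _ _) _; rewrite mulrC ler_wpM2r ?nm_ge0 //.
move=> h; have {}h : nm (pi g - 1%:M) <= N%:R^-1.
  rewrite -(ler_pM2l NR0) mulfV ?gt_eqF //; lra.
apply: le_trans h _.
have -> : N%:R^-1 = 2 * (2 * N%:R)^-1 :> R by field; rewrite gt_eqF.
apply: ler_pM => //; first by rewrite lerDr.
have N20 : 0 < 2 * N%:R :> R by rewrite mulr_gt0.
rewrite lef_pV2 ?posrE //.
apply: le_trans (ltW xN) _; rewrite -natr1 mulr2n mulrDl mul1r lerD2l.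
by rewrite ler1n.
Qed.

Section FixRep.
Variables (n d : nat) (pi : 'M[C]_n.+1 -> 'M[C]_d).
Hypothesis hpi : unitary_rep (@SU R n.+1) pi.

Let pi1 : pi 1%:M = 1%:M. Proof. by case: hpi. Qed.
Let piM g h : SU g -> SU h -> pi (g *m h) = pi g *m pi h.
Proof. by case: hpi => _ + _ _; exact. Qed.
Let piU g : SU g -> pi g \is unitarymx. Proof. by case: hpi => _ _ + _; exact. Qed.

Lemma rep_trC g : SU g -> pi (g^t*) = (pi g)^t*.
Proof.
move=> hg; rewrite -[LHS]mulmx1 -(unitarymxP (piU hg)) mulmxA -piM //.
  by rewrite SU_Vmul // pi1 mul1mx.
exact: SUV.
Qed.

Lemma su_expSU (A : 'M[C]_n.+1) (s : R) : su A -> SU (expmx (s%:C%C *: A)).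
Proof. by case/expmx_su. Qed.

Lemma dreal_tangent (A : 'M[C]_n.+1) : su A ->
  tangent (fun s : R => pi (expmx (s%:C%C *: A))) (dreal pi A).
Proof.
move=> hA; have [L L0 hL] := unitary_rep_lipschitz hpi.
have [h1 h2 _] := expmx_su hA.
have [K K0 hK] := tangentP (tangent_expmx hA).
have [| |X [K' hX]] := @one_parameter_differentiable _ _
    (fun s : R => pi (expmx (s%:C%C *: A))) (L * K).
- by move=> s t; rewrite h2 piM.
- move=> s; apply: le_trans (hL _ (h1 s)) _; rewrite -mulrA ler_wpM2l //.
  by have [] := hK s.
have -> : dreal pi A = X by apply: (@dreal_eq _ _ _ _ _ _ K') => s _; exact: hX.
split; first by exists K'.
by exists (d * d)%:R => s; apply: nm_unitary; exact: piU.
Qed.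

(** Any curve in the group with tangent [A] computes [dreal pi A]: it is within $O(s^2)$ of the
    exponential curve, and the Lipschitz bound carries this over to the images. Linearity and
    Ad-equivariance of [dreal] follow by choosing suitable curves. *)
Lemma tangent_rep (gam : R -> 'M[C]_n.+1) A : (forall s, SU (gam s)) -> su A ->
  tangent gam A -> tangent (fun s => pi (gam s)) (dreal pi A).
Proof.
move=> gU hA gA; have [L L0 hL] := unitary_rep_lipschitz hpi.
have [[K hK] _] := dreal_tangent hA.
have [[K1 hK1] _] := gA; have [[K2 hK2] _] := tangent_expmx hA.
split; last by exists (d * d)%:R => s; apply: nm_unitary; exact: piU.
pose c : R := (n.+1 * n.+1)%:R; pose D : R := (d * d)%:R.
exists (D * (L * (c * (K1 + K2))) + K) => s.
set et := expmx (s%:C%C *: A); have eU : SU et by exact: su_expSU.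
have -> : pi (gam s) - 1%:M - s%:C%C *: dreal pi A =
    pi et *m (pi (et^t* *m gam s) - 1%:M) + (pi et - 1%:M - s%:C%C *: dreal pi A).
  rewrite mulmxBr mulmx1 -piM //; last exact: SUM (SUV eU) (gU s).
  by rewrite mulmxA SU_mulV // mul1mx !addrA subrK.
apply: le_trans (nmD _ _) _; rewrite mulrDl lerD ?hK // -mulrA.
apply: le_trans (nmM _ _) _; apply: ler_pM; rewrite ?nm_ge0 //.
  by apply: nm_unitary; exact: piU.
apply: le_trans (hL _ _) _; first exact: SUM (SUV eU) (gU s).
rewrite -mulrA ler_wpM2l //.
have -> : et^t* *m gam s - 1%:M = et^t* *m (gam s - et).
  by rewrite mulmxBr SU_Vmul.
apply: le_trans (nmM _ _) _; rewrite -mulrA; apply: ler_pM; rewrite ?nm_ge0 //.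
  by apply: nm_SU; exact: SUV.
have -> : gam s - et = (gam s - 1%:M - s%:C%C *: A) - (et - 1%:M - s%:C%C *: A).
  by apply/matrixP => i j; rewrite !mxE; ring.
by apply: le_trans (nmB _ _) _; rewrite mulrDl lerD ?hK1 ?hK2.
Qed.

Lemma suD m (A B : 'M[C]_m) : su A -> su B -> su (A + B).
Proof.
move=> [A1 A2] [B1 B2]; split; first by rewrite trCD A1 B1 opprD.
by rewrite mxtraceD A2 B2 addr0.
Qed.

Lemma suZ m c (A : 'M[C]_m) : su A -> su ((c : R)%:C%C *: A).
Proof.
move=> [A1 A2]; split; last by rewrite mxtraceZ A2 mulr0.
by rewrite trCZ A1 [(c%:C%C)^*]conjc_real scalerN.
Qed.

Lemma su_conj m (g A : 'M[C]_m) : SU g -> su A -> su (g *m A *m g^t*).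
Proof.
move=> hg [A1 A2]; split.
  by rewrite !trCM trmxCK A1 mulNmx mulmxN mulmxA.
by rewrite mxtrace_mulC mulmxA SU_Vmul // mul1mx.
Qed.

Lemma su_bracket m (A B : 'M[C]_m) : su A -> su B -> su (B *m A - A *m B).
Proof.
move=> [A1 A2] [B1 B2]; split.
  by rewrite trCB !trCM A1 B1 !mulNmx !mulmxN !opprK opprB.
by rewrite raddfB /= [X in _ - X]mxtrace_mulC subrr.
Qed.

Lemma drealD A B : su A -> su B -> dreal pi (A + B) = dreal pi A + dreal pi B.
Proof.
move=> hA hB; apply: (@tangent_uniq _ _
  (fun s : R => pi (expmx (s%:C%C *: A) *m expmx (s%:C%C *: B)))).
  apply: tangent_rep; [|exact: suD|].
    by move=> s; exact: SUM (su_expSU s hA) (su_expSU s hB).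
  exact: tangent_mul (tangent_expmx hA) (tangent_expmx hB).
have [[K hK] [D hD]] := tangent_mul (dreal_tangent hA) (dreal_tangent hB).
split; [exists K|exists D] => s; rewrite piM //; exact: su_expSU.
Qed.

Lemma drealZ (c : R) A : su A -> dreal pi (c%:C%C *: A) = c%:C%C *: dreal pi A.
Proof.
move=> hA; apply: (@tangent_uniq _ _
  (fun s : R => pi (expmx ((c * s)%:C%C *: A)))).
  apply: tangent_rep; [|exact: suZ|].
    by move=> s; exact: su_expSU.
  exact: (tangent_scale c (tangent_expmx hA)).
exact: (tangent_scale c (dreal_tangent hA)).
Qed.

Lemma dreal_Ad g A : SU g -> su A ->
  dreal pi (g *m A *m g^t*) = pi g *m dreal pi A *m (pi g)^t*.
Proof.
move=> hg hA; apply: (@tangent_uniq _ _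
  (fun s : R => pi (g *m expmx (s%:C%C *: A) *m g^t*))).
  apply: tangent_rep; [|exact: su_conj|].
    by move=> s; exact: SUM (SUM hg (su_expSU s hA)) (SUV hg).
  by apply: tangent_conj (tangent_expmx hA); exact: SU_mulV.
have [[K hK] [D hD]] := tangent_conj (unitarymxP (piU hg)) (dreal_tangent hA).
have E s : pi (g *m expmx (s%:C%C *: A) *m g^t*) =
    pi g *m pi (expmx (s%:C%C *: A)) *m (pi g)^t*.
  have eU := su_expSU s hA.
  by rewrite (piM (SUM hg eU) (SUV hg)) (piM hg eU) rep_trC.
by split; [exists K|exists D] => s; rewrite E.
Qed.

Lemma expmxN (A : 'M[C]_n.+1) (s : R) : su A ->
  (expmx (s%:C%C *: A))^t* = expmx ((-1 * s)%:C%C *: A).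
Proof.
move=> hA; have [h1 h2 _] := expmx_su hA.
rewrite -[LHS]mulmx1.
have <- : expmx (s%:C%C *: A) *m expmx ((-1 * s)%:C%C *: A) = 1%:M.
  rewrite -h2 mulN1r subrr; have := h2 0 0; rewrite addr0 => e.
  have := SU_mulV (h1 0); rewrite {1}e -mulmxA SU_mulV // mulmx1.
  by [].
by rewrite mulmxA SU_Vmul // mul1mx.
Qed.

Lemma dreal_trC A : su A -> (dreal pi A)^t* = - dreal pi A.
Proof.
move=> hA; apply: (@tangent_uniq _ _ (fun s : R => (pi (expmx (s%:C%C *: A)))^t*)).
  exact: tangent_trC (dreal_tangent hA).
have := tangent_scale (-1) (dreal_tangent hA).
rewrite rmorphN rmorph1 scaleN1r => -[[K hK] [D hD]].
by split; [exists K|exists D] => s; rewrite -rep_trC ?expmxN //; exact: su_expSU.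
Qed.

(** Needed to see that [dreal pi] maps a second-order remainder in the Lie algebra to a second-order
    remainder. *)
Lemma dreal_bounded : exists2 L : R, 0 <= L &
  forall A, su A -> nm (dreal pi A) <= L * nm A.
Proof.
have [L L0 hL] := unitary_rep_lipschitz hpi; exists L => // A hA.
have [[K hK] _] := dreal_tangent hA; have [[K1 hK1] _] := tangent_expmx hA.
apply: (@le_lim_archi _ _ _ (K + L * K1)) => k.
set s : R := k.+1%:R^-1; have s0 : 0 < s by rewrite invr_gt0.
have -> : L * nm A + (K + L * K1) / k.+1%:R =
    (L * (nm A * s + K1 * s ^+ 2) + K * s ^+ 2) / s.
  by rewrite -/s; field; rewrite gt_eqF.
rewrite ler_pdivlMr // mulrC -{1}(ger0_norm (ltW s0)) -normc_real -nmZ.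
have h (B : 'M[C]_d) X : nm X <= nm B + nm (B - X).
  by rewrite -[X in nm X](subKr B); exact: nmB.
apply: le_trans (h (pi (expmx (s%:C%C *: A)) - 1%:M) _) _; rewrite lerD //.
apply: le_trans (hL _ (su_expSU _ hA)) _; rewrite ler_wpM2l //.
rewrite -[expmx _ - _](subrK (s%:C%C *: A)); apply: le_trans (nmD _ _) _.
by rewrite nmZ normc_real (ger0_norm (ltW s0)) addrC mulrC lerD.
Qed.

(** Both sides are the coefficient of [s] in $d\pi(gAg^{-1})=\pi(g)\,d\pi(A)\,\pi(g)^{-1}$ for
    $g=\exp(sB)$. *)
Lemma dreal_bracket A B : su A -> su B ->
  dreal pi (B *m A - A *m B) =
  dreal pi B *m dreal pi A - dreal pi A *m dreal pi B.
Proof.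
move=> hA hB; have [L L0 hL] := dreal_bounded.
have gV : tangent (fun s : R => (expmx (s%:C%C *: B))^t*) (- B).
  have := tangent_trC (tangent_expmx hB); suff -> : B^t* = - B by [].
  by case: hB.
have pV : tangent (fun s : R => (pi (expmx (s%:C%C *: B)))^t*) (- dreal pi B).
  by rewrite -dreal_trC //; exact: tangent_trC (dreal_tangent hB).
have [K K0 hK] := conj_expand A (tangent_expmx hB) gV.
have [K' K'0 hK'] := conj_expand (dreal pi A) (dreal_tangent hB) pV.
apply/eqP; rewrite -subr_eq0; apply/eqP; apply: (@quadratic_eq0 _ _ _ _ (L * K + K')) => s.
have := hK s; have := hK' s; set g := expmx _.
have hg : SU g by exact: su_expSU.
rewrite -dreal_Ad //; set T := g *m A *m g^t* - A - _ => h1 h2.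
have hBA := su_bracket hA hB.
have suN (E : 'M[C]_n.+1) : su E -> su (- E).
  by move=> hE; rewrite -scaleN1r -(rmorph1 (real_complex R)) -rmorphN; exact: suZ.
have hsBA := suZ s hBA; have hgA := su_conj hg hA.
have hT : su T by exact: suD (suD hgA (suN _ hA)) (suN _ hsBA).
have ET : dreal pi (g *m A *m g^t*) =
    dreal pi A + s%:C%C *: dreal pi (B *m A - A *m B) + dreal pi T.
  rewrite -(drealZ s hBA) -(drealD hA hsBA) -(drealD (suD hA hsBA) hT).
  congr (dreal pi _); rewrite /T; apply/matrixP => i j; rewrite !mxE; ring.
have -> : s%:C%C *: (dreal pi (B *m A - A *m B) -
     (dreal pi B *m dreal pi A - dreal pi A *m dreal pi B)) =
   (dreal pi (g *m A *m g^t*) - dreal pi A -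
     s%:C%C *: (dreal pi B *m dreal pi A - dreal pi A *m dreal pi B)) - dreal pi T.
  rewrite ET; move: (dreal pi B *m dreal pi A - dreal pi A *m dreal pi B) => q.
  move: (dreal pi (B *m A - A *m B)) (dreal pi A) (dreal pi T) => p r t.
  by apply/matrixP => i j; rewrite !mxE; ring.
apply: le_trans (nmB _ _) _; rewrite mulrDl addrC lerD //.
by apply: le_trans (hL _ hT) _; rewrite -mulrA ler_wpM2l.
Qed.

End FixRep.
End Derivative.

(** * The complexified derivative *)

Section Complexification.
Variable R : realType.
Local Notation C := R[i].
Local Notation normc := (@ComplexField.Normc.normc R).

(** With [im_su], the skew-Hermitian parts of $X=A+iB$, which are the arguments of [dreal] inside
    [dcplx]. *)
Definition re_su m (X : 'M[C]_m) : 'M[C]_m := 2^-1 *: (X - X^t*).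
Definition im_su m (X : 'M[C]_m) : 'M[C]_m := (2 * 'i%C)^-1 *: (X + X^t*).

Lemma iN0 : ('i%C : C) != 0.
Proof. by rewrite eq_complex /= oner_eq0 andbF. Qed.

Lemma mul_ii : ('i%C : C) * 'i%C = -1.
Proof. by rewrite -expr2 sqr_i. Qed.

Lemma inv_2i : (2 * 'i%C)^-1 = - ('i%C / 2) :> C.
Proof.
have i0 := iN0; apply: (mulfI (mulf_neq0 (_ : (2 : C) != 0) i0)); rewrite ?pnatr_eq0 //.
rewrite mulfV ?mulf_neq0 ?pnatr_eq0 // mulrN [2 * _]mulrC mulrACA mul_ii.
by rewrite mulfV ?pnatr_eq0 // mulr1 opprK.
Qed.

Lemma conjcE (c : C) : c^* = (complex.Re c)%:C%C - 'i%C * (complex.Im c)%:C%C.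
Proof.
case: c => x y; apply/eqP; rewrite /Num.conj /= eq_complex /=.
by apply/andP; split; apply/eqP; ring.
Qed.

Lemma conj_half : (2^-1 : C)^* = 2^-1.
Proof. by rewrite fmorphV rmorph_nat. Qed.

Lemma conj_i : ('i%C : C)^* = - 'i%C.
Proof. by rewrite conjcE /= sub0r mulr1. Qed.

Lemma conj_ihalf : ((2 * 'i%C)^-1 : C)^* = - (2 * 'i%C)^-1.
Proof.
rewrite inv_2i opprK; transitivity (- (('i%C : C)^* * (2^-1 : C)^*)).
  by rewrite rmorphN rmorphM.
by rewrite conj_i conj_half mulNr opprK.
Qed.

Lemma trace0_trC m (X : 'M[C]_m) : \tr X = 0 -> \tr (X^t*) = 0.
Proof. by rewrite trace_trC => ->; rewrite conjC0. Qed.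

Lemma re_su_su m (X : 'M[C]_m) : \tr X = 0 -> su (re_su X).
Proof.
move=> X0; split; last by rewrite mxtraceZ raddfB /= X0 trace0_trC // subr0 mulr0.
by rewrite trCZ trCB trmxCK conj_half -scalerN opprB.
Qed.

Lemma im_su_su m (X : 'M[C]_m) : \tr X = 0 -> su (im_su X).
Proof.
move=> X0; split; last by rewrite mxtraceZ mxtraceD X0 trace0_trC // addr0 mulr0.
by rewrite trCZ trCD trmxCK conj_ihalf scaleNr addrC.
Qed.

Lemma re_im_su m (X : 'M[C]_m) : re_su X + 'i%C *: im_su X = X.
Proof.
rewrite /re_su /im_su inv_2i scalerA mulrN mulrA mul_ii mulN1r opprK.
by apply/matrixP => i j; rewrite !mxE; field.
Qed.

Lemma re_suD m (X Y : 'M[C]_m) : re_su (X + Y) = re_su X + re_su Y.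
Proof. by rewrite /re_su trCD -scalerDr opprD addrACA. Qed.

Lemma im_suD m (X Y : 'M[C]_m) : im_su (X + Y) = im_su X + im_su Y.
Proof. by rewrite /im_su trCD -scalerDr addrACA. Qed.

Lemma real_complexN (x : R) : (- x)%:C%C = - x%:C%C :> C.
Proof. exact: rmorphN. Qed.

Lemma re_suZ (c : C) m (X : 'M[C]_m) : re_su (c *: X) =
  (complex.Re c)%:C%C *: re_su X + (- complex.Im c)%:C%C *: im_su X.
Proof.
rewrite /re_su /im_su trCZ conjcE inv_2i {1}[c]complexE real_complexN.
move: (X^t*) (complex.Re c)%:C%C (complex.Im c)%:C%C (2^-1 : C) => Y x y h.
by apply/matrixP => i j; rewrite !mxE; ring.
Qed.

Lemma im_suZ (c : C) m (X : 'M[C]_m) : im_su (c *: X) =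
  (complex.Re c)%:C%C *: im_su X + (complex.Im c)%:C%C *: re_su X.
Proof.
rewrite /re_su /im_su trCZ conjcE inv_2i {1}[c]complexE.
move: (X^t*) (complex.Re c)%:C%C (complex.Im c)%:C%C (2^-1 : C) => Y x y h.
apply/matrixP => i j; rewrite !mxE; move: (X i j) (Y i j) => p q.
rewrite [LHS](_ : _ = - 'i%C * h * x * (p + q) - ('i%C * 'i%C) * h * y * (p - q)); last by ring.
by rewrite mul_ii; ring.
Qed.

Lemma bracketDr m (A P Q : 'M[C]_m) c :
  A *m (Q + c *: P) - (Q + c *: P) *m A =
  c *: (A *m P - P *m A) + (A *m Q - Q *m A).
Proof.
rewrite mulmxDr mulmxDl -scalemxAr -scalemxAl.
move: (A *m P) (P *m A) (A *m Q) (Q *m A) => x y z w.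
by apply/matrixP => i j; rewrite !mxE; ring.
Qed.

Lemma bracketDl m (A P Q : 'M[C]_m) c :
  (Q + c *: P) *m A - A *m (Q + c *: P) =
  c *: (P *m A - A *m P) + (Q *m A - A *m Q).
Proof. by rewrite -[LHS]opprB bracketDr opprD -scalerN !opprB. Qed.

Lemma re_su_id m (A : 'M[C]_m) : su A -> re_su A = A.
Proof.
by case=> AE _; rewrite /re_su AE opprK; apply/matrixP => i j; rewrite !mxE; field.
Qed.

Lemma im_su_id m (A : 'M[C]_m) : su A -> im_su A = 0.
Proof. by case=> AE _; rewrite /im_su AE subrr scaler0. Qed.

Lemma re_su_conj m (g X : 'M[C]_m) : re_su (g *m X *m g^t*) = g *m re_su X *m g^t*.
Proof.
by rewrite /re_su !trCM trmxCK mulmxA -mulmxBl -mulmxBr -scalemxAr -scalemxAl.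
Qed.

Lemma im_su_conj m (g X : 'M[C]_m) : im_su (g *m X *m g^t*) = g *m im_su X *m g^t*.
Proof.
by rewrite /im_su !trCM trmxCK mulmxA -mulmxDl -mulmxDr -scalemxAr -scalemxAl.
Qed.

Lemma re_su_trC m (X : 'M[C]_m) : re_su (X^t*) = - re_su X.
Proof. by rewrite /re_su trmxCK -scalerN opprB. Qed.

Lemma im_su_trC m (X : 'M[C]_m) : im_su (X^t*) = im_su X.
Proof. by rewrite /im_su trmxCK addrC. Qed.

Section FixRep.
Variables (n d : nat) (pi : 'M[C]_n.+1 -> 'M[C]_d).
Hypothesis hpi : unitary_rep (@SU R n.+1) pi.

Lemma dcplxE X : dcplx pi X = dreal pi (re_su X) + 'i%C *: dreal pi (im_su X).
Proof. by []. Qed.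

Lemma dreal_comb x y A B D : su A -> su B -> su D ->
  dreal pi (x%:C%C *: A + y%:C%C *: B + D) =
  x%:C%C *: dreal pi A + y%:C%C *: dreal pi B + dreal pi D.
Proof.
move=> hA hB hD; have xA := suZ x hA; have yB := suZ y hB.
by rewrite (drealD hpi (suD xA yB) hD) (drealD hpi xA yB) (drealZ hpi x hA) (drealZ hpi y hB).
Qed.

Lemma dcplx_linear c X Y : \tr X = 0 -> \tr Y = 0 ->
  dcplx pi (c *: X + Y) = c *: dcplx pi X + dcplx pi Y.
Proof.
move=> X0 Y0; rewrite !dcplxE re_suD im_suD re_suZ im_suZ.
have rX := re_su_su X0; have iX := im_su_su X0.
have rY := re_su_su Y0; have iY := im_su_su Y0.
have e1 := dreal_comb (complex.Re c) (- complex.Im c) rX iX rY.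
have e2 := dreal_comb (complex.Re c) (complex.Im c) iX rX iY.
apply: (etrans (congr2 (fun a b : 'M[C]_d => a + 'i%C *: b) e1 e2)).
rewrite real_complexN; move: {e1 e2} (dreal pi (re_su X)) (dreal pi (re_su Y))
  (dreal pi (im_su X)) (dreal pi (im_su Y)) => p q r t.
rewrite [c in RHS]complexE; move: (complex.Re c)%:C%C (complex.Im c)%:C%C => x y.
apply/matrixP => i j; rewrite !mxE.
move: (p i j) (q i j) (r i j) (t i j) => {}p {}q {}r {}t.
rewrite [RHS](_ : _ = x * p + 'i%C * y * p + 'i%C * x * r + ('i%C * 'i%C) * y * r
  + q + 'i%C * t); last by ring.
by rewrite mul_ii; ring.
Qed.

Lemma dreal0 : dreal pi 0 = 0.
Proof.
have h0 : su (0 : 'M[C]_n.+1) by split; rewrite ?mxtrace0 // oppr0 trmx0 map_mx0.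
by have := drealZ hpi 0 h0; rewrite scaler0 rmorph0 scale0r.
Qed.

Lemma dcplx_su A : su A -> dcplx pi A = dreal pi A.
Proof. by move=> hA; rewrite dcplxE re_su_id // im_su_id // dreal0 scaler0 addr0. Qed.

Lemma dcplx_Ad g X : SU g -> \tr X = 0 ->
  dcplx pi (g *m X *m g^t*) = pi g *m dcplx pi X *m (pi g)^t*.
Proof.
move=> hg X0; rewrite !dcplxE re_su_conj im_su_conj.
have e1 := dreal_Ad hpi hg (re_su_su X0); have e2 := dreal_Ad hpi hg (im_su_su X0).
apply: (etrans (congr2 (fun a b : 'M[C]_d => a + 'i%C *: b) e1 e2)).
by rewrite mulmxDr mulmxDl -scalemxAr -scalemxAl.
Qed.

Lemma dcplx_trC X : \tr X = 0 -> dcplx pi (X^t*) = (dcplx pi X)^t*.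
Proof.
move=> X0; have rX := re_su_su X0; have iX := im_su_su X0.
rewrite !dcplxE re_su_trC im_su_trC trCD trCZ conj_i.
have e1 := dreal_trC hpi rX; have e2 := dreal_trC hpi iX.
apply: (etrans _ (congr2 (fun a b : 'M[C]_d => a + - 'i%C *: b) (esym e1) (esym e2))).
rewrite scaleNr scalerN opprK; congr (_ + _).
have := drealZ hpi (- 1) rX; rewrite real_complexN rmorph1.
by rewrite !scaleN1r.
Qed.

Lemma dcplx0 : dcplx pi 0 = 0.
Proof.
have h0 : su (0 : 'M[C]_n.+1) by split; rewrite ?mxtrace0 // oppr0 trmx0 map_mx0.
by rewrite dcplx_su // dreal0.
Qed.

Lemma dcplxZ c X : \tr X = 0 -> dcplx pi (c *: X) = c *: dcplx pi X.
Proof.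
by move=> X0; have := dcplx_linear c X0 (mxtrace0 _ _); rewrite dcplx0 !addr0.
Qed.

Lemma trace_bracket m (X Y : 'M[C]_m) : \tr (X *m Y - Y *m X) = 0.
Proof. by rewrite raddfB /= [X in _ - X]mxtrace_mulC subrr. Qed.

Lemma dcplx_bracket_su A Z : su A -> \tr Z = 0 ->
  dcplx pi (A *m Z - Z *m A) =
  dcplx pi A *m dcplx pi Z - dcplx pi Z *m dcplx pi A.
Proof.
move=> hA Z0; have rZ := re_su_su Z0; have iZ := im_su_su Z0.
have e1 := dreal_bracket hpi rZ hA; have e2 := dreal_bracket hpi iZ hA.
rewrite -(dcplx_su (su_bracket rZ hA)) in e1.
rewrite -(dcplx_su (su_bracket iZ hA)) in e2.
have E : A *m Z - Z *m A = 'i%C *: (A *m im_su Z - im_su Z *m A) +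
      (A *m re_su Z - re_su Z *m A).
  by rewrite -bracketDr re_im_su.
rewrite (dcplx_su hA) (dcplxE Z) bracketDr.
apply: (etrans _ (congr2 (fun a b : 'M[C]_d => 'i%C *: a + b) e2 e1)).
by rewrite E; apply: dcplx_linear; exact: trace_bracket.
Qed.

(** Bilinear extension in two stages: [dcplx_bracket_su] frees one argument from being
    skew-Hermitian, this lemma frees the other. *)
Lemma dcplx_bracket X Y : \tr X = 0 -> \tr Y = 0 ->
  dcplx pi (X *m Y - Y *m X) =
  dcplx pi X *m dcplx pi Y - dcplx pi Y *m dcplx pi X.
Proof.
move=> X0 Y0; have rX := re_su_su X0; have iX := im_su_su X0.
have e1 := dcplx_bracket_su rX Y0; have e2 := dcplx_bracket_su iX Y0.
have E : X *m Y - Y *m X = 'i%C *: (im_su X *m Y - Y *m im_su X) +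
    (re_su X *m Y - Y *m re_su X).
  by rewrite -bracketDl re_im_su.
have E' : dcplx pi X = dcplx pi (re_su X) + 'i%C *: dcplx pi (im_su X).
  by rewrite (dcplx_su rX) (dcplx_su iX).
rewrite E' bracketDl.
apply: (etrans _ (congr2 (fun a b : 'M[C]_d => 'i%C *: a + b) e2 e1)).
by rewrite E; apply: dcplx_linear; exact: trace_bracket.
Qed.

End FixRep.

(* [drho] is the complexified derivative of the representation [rho] of SU(n+1);
   it is only controlled on traceless matrices. *)
Record drep n d (rho : 'M[C]_n.+1 -> 'M[C]_d) (drho : 'M[C]_n.+1 -> 'M[C]_d) :
    Prop := Drep {
  drepM : forall g h, SU g -> SU h -> rho (g *m h) = rho g *m rho h;
  drep_tangent : forall A, su A ->
    tangent (fun s : R => rho (expmx (s%:C%C *: A))) (drho A);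
  drep_linear : forall c X Y, \tr X = 0 -> \tr Y = 0 ->
    drho (c *: X + Y) = c *: drho X + drho Y;
  drep_bracket : forall X Y, \tr X = 0 -> \tr Y = 0 ->
    drho (X *m Y - Y *m X) = drho X *m drho Y - drho Y *m drho X;
  drep_Ad : forall g X, SU g -> \tr X = 0 ->
    rho g *m drho X = drho (g *m X *m g^t*) *m rho g }.

Lemma unitary_rep_drep n d (pi : 'M[C]_n.+1 -> 'M[C]_d) :
  unitary_rep (@SU R n.+1) pi -> drep pi (dcplx pi).
Proof.
move=> hpi; have [_ piM piU _] := hpi; split => //.
- by move=> A hA; rewrite dcplx_su //; exact: dreal_tangent.
- by move=> *; exact: dcplx_linear.
- by move=> *; exact: dcplx_bracket.
move=> g X hg X0; rewrite dcplx_Ad //.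
by rewrite (unitary_mulVK _ (piU _ hg)).
Qed.

End Complexification.

(** * Uniqueness of matrix coefficients *)

Section Words.
Variable R : realType.
Local Notation C := R[i].
Local Notation normc := (@ComplexField.Normc.normc R).
Local Notation traceless := (all (fun X => \tr X == 0)).

Lemma nm_iter_euler d (X : 'M[C]_d) (x : 'cV[C]_d) (N k : nat) : (0 < N)%N ->
  (k <= N)%N ->
  nm (iter k (fun y => y + N%:R^-1 *: (X *m y)) x) <= expR (nm X) * nm x.
Proof.
move=> N0 kN; have N0' : 0 < N%:R :> R by rewrite ltr0n.
apply: (@le_trans _ _ ((1 + nm X / N%:R) ^+ k * nm x)).
  elim: k {kN} => [|k ih]; first by rewrite mul1r.
  rewrite iterS; set y := iter k _ _ in ih *.
  apply: le_trans (nmD _ _) _; rewrite nmZ.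
  have -> : normc (N%:R^-1) = N%:R^-1.
    rewrite ComplexField.Normc.normcV -(rmorph_nat (real_complex R)) normc_real.
    by rewrite normr_nat.
  apply: (@le_trans _ _ ((1 + nm X / N%:R) * nm y)).
    rewrite mulrDl mul1r lerD2l [nm X / _]mulrC -mulrA ler_wpM2l ?invr_ge0 //.
    exact: nmM.
  rewrite exprS -mulrA ler_wpM2l // addr_ge0 // divr_ge0 ?nm_ge0 //.
rewrite ler_wpM2r ?nm_ge0 //.
have h1 : 1 <= 1 + nm X / N%:R by rewrite lerDl divr_ge0 ?nm_ge0.
apply: (@le_trans _ _ ((1 + nm X / N%:R) ^+ N)); first exact: ler_weXn2l.
apply: (@le_trans _ _ (expR (nm X / N%:R) ^+ N)).
  by rewrite lerXn2r ?nnegrE ?expR_ge0 ?expR_ge1Dx // (le_trans _ h1).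
by rewrite -expRM_natl mulrCA mulfV ?mulr1 // gt_eqF.
Qed.

(** Hybrid argument: the exact steps of length $1/N$ are replaced one by one by Euler steps. Each
    replacement costs $O(1/N^2)$, as the iterates stay bounded by [nm_iter_euler]. *)
Lemma one_parameter_euler d (f : R -> 'M[C]_d) (X : 'M[C]_d) (K : R) (x : 'cV[C]_d) N :
  (forall s t, f (s + t) = f s *m f t) ->
  (forall s, [/\ nm (f s) <= K, nm (f s - 1%:M - s%:C%C *: X) <= K * s ^+ 2
    & nm (f s - 1%:M) <= K * `|s|]) -> (0 < N)%N ->
  nm (f 1 *m x - iter N (fun y => y + N%:R^-1 *: (X *m y)) x) <=
    K * K * (expR (nm X) * nm x) / N%:R.
Proof.
move=> fD hK Npos; have N0 : 0 < N%:R :> R by rewrite ltr0n.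
set T := fun y => _.
have f0 y : f 0 *m y = y.
  have h : nm (f 0 - 1%:M) <= 0.
    by have [_ _] := hK 0; rewrite normr0 mulr0.
  by have /eqP := nm0_eq0 h; rewrite subr_eq0 => /eqP ->; rewrite mul1mx.
have main k : (k <= N)%N ->
   nm (f 1 *m x - f ((N - k)%:R / N%:R) *m iter k T x) <=
   k%:R * (K * (K / N%:R ^+ 2 * (expR (nm X) * nm x))).
  elim: k => [_|k ih kN].
    have -> : f ((N - 0)%:R / N%:R) = f 1.
      by congr (f _); rewrite subn0 mulfV // gt_eqF.
    by rewrite mul0r /= addrN nm0.
  rewrite -natr1 mulrDl mul1r iterS.
  have -> : f 1 *m x - f ((N - k.+1)%:R / N%:R) *m T (iter k T x) =
     (f 1 *m x - f ((N - k)%:R / N%:R) *m iter k T x) +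
     f ((N - k.+1)%:R / N%:R) *m
     ((f N%:R^-1 - 1%:M - (N%:R^-1)%:C%C *: X) *m iter k T x).
    have -> : (N - k)%:R / N%:R = (N - k.+1)%:R / N%:R + N%:R^-1 :> R.
      have -> : (N - k)%N = (N - k.+1).+1 by rewrite -subSn // subSS.
      by rewrite -natr1 mulrDl mul1r.
    rewrite fD /T; set y := iter k _ x; set a := f (_ / _).
    rewrite !mulmxBl mul1mx -scalemxAl !mulmxBr mulmxDr mulmxA.
    rewrite fmorphV rmorph_nat.
    move: (f 1 *m x) (a *m f _ *m y) (a *m y) (a *m (_ *: _)) => p q r t.
    by apply/matrixP => i j; rewrite !mxE; ring.
  apply: le_trans (nmD _ _) _; rewrite lerD ?ih // 1?ltnW //.
  apply: le_trans (nmM _ _) _.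
  apply: ler_pM; rewrite ?nm_ge0 //; first by have [] := hK ((N - k.+1)%:R / N%:R).
  apply: le_trans (nmM _ _) _.
  apply: ler_pM; rewrite ?nm_ge0 //; last by apply: nm_iter_euler => //; exact: ltnW.
  by have [_ + _] := hK N%:R^-1; rewrite exprVn.
have := main N (leqnn N); rewrite subnn mul0r f0 => /le_trans; apply.
rewrite le_eqVlt; apply/orP; left; apply/eqP.
by field; rewrite gt_eqF.
Qed.

(** Reaches the group element through powers of [drho A] alone, without forming an exponential of
    [drho A]. *)
Lemma drep_euler n d (rho : 'M[C]_n.+1 -> 'M[C]_d) drho A (x : 'cV[C]_d) :
  drep rho drho -> su A ->
  exists K : R, forall N : nat,
    nm (rho (expmx A) *m x -
        iter N.+1 (fun y => y + N.+1%:R^-1 *: (drho A *m y)) x) <= K / N.+1%:R.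
Proof.
move=> hr hA; have [K K0 hK] := tangentP (drep_tangent hr hA).
have [eU eD _] := expmx_su hA.
exists (K * K * (expR (nm (drho A)) * nm x)) => N.
have := @one_parameter_euler d (fun s => rho (expmx (s%:C%C *: A))) (drho A) K x N.+1.
rewrite rmorph1 scale1r; apply=> // s t.
by rewrite eD (drepM hr).
Qed.

(* Any word can be straightened: a letter is split along [BL + BR]; the [BL]
   part is absorbed on the left, the [BR] part is commuted to the right end at
   the price of shorter words. *)
Lemma words_vanish n (BL BR : 'M[C]_n -> Prop) (chiL chiR : 'M[C]_n -> C)
    (L : seq 'M[C]_n -> 'M[C]_1) :
  (forall Y, \tr Y = 0 -> exists X Z,
     [/\ Y = X + Z, \tr X = 0, \tr Z = 0, BL X & BR Z]) ->
  L [::] = 0 ->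
  (forall X Z ws, traceless (X :: Z :: ws) -> L (X + Z :: ws) = L (X :: ws) + L (Z :: ws)) ->
  (forall X ws, traceless (X :: ws) -> BL X -> L (X :: ws) = chiL X *: L ws) ->
  (forall Z ws, traceless (Z :: ws) -> BR Z -> L (rcons ws Z) = chiR Z *: L ws) ->
  (forall ws1 Z Y ws2, traceless (ws1 ++ Z :: Y :: ws2) ->
    L (ws1 ++ Z :: Y :: ws2) =
    L (ws1 ++ Y :: Z :: ws2) + L (ws1 ++ (Z *m Y - Y *m Z) :: ws2)) ->
  forall ws, traceless ws -> L ws = 0.
Proof.
move=> dec L0 LD LL LR LC ws; have [k] := ubnP (size ws).
elim: k ws => // k IH ws /ltnSE sk tws.
case: ws sk tws => // Y ws /= sk /andP[/eqP trY tws].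
have [X [Z [-> trX trZ bX bZ]]] := dec Y trY.
rewrite LD; last by rewrite /= trX trZ eqxx.
rewrite LL //; last by rewrite /= trX eqxx.
rewrite IH // scaler0 add0r.
suff main ws2 ws1 : traceless (ws1 ++ ws2) -> (size (ws1 ++ ws2) < k)%N ->
    L (ws1 ++ Z :: ws2) = 0 by exact: (main ws [::]).
elim: ws2 ws1 => [|Y' ws2 ih] ws1.
  rewrite cats0 cats1 => t1 s1; rewrite LR ?IH ?scaler0 //.
  by rewrite /= trZ eqxx.
move=> t1 s1.
have [t2 t3'] : traceless ws1 /\ (\tr Y' == 0) && traceless ws2.
  by move: t1; rewrite all_cat => /andP[].
have /andP[/eqP tY' t3] := t3'.
rewrite LC; last by rewrite all_cat t2 /= trZ t3' eqxx.
rewrite -cat_rcons ih ?cat_rcons // add0r IH //; first by move: s1; rewrite !size_cat.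
by rewrite all_cat t2 /= t3 trace_bracket eqxx.
Qed.

(** The action on [x] of a monomial of the enveloping algebra; the last letter acts first. *)
Definition word n d (drho : 'M[C]_n -> 'M[C]_d) (x : 'cV[C]_d) ws : 'cV[C]_d :=
  foldr (fun Y y => drho Y *m y) x ws.

Section Pair.
Variables (n d : nat) (rho : 'M[C]_n.+1 -> 'M[C]_d) (drho : 'M[C]_n.+1 -> 'M[C]_d).
Hypothesis hr : drep rho drho.

Lemma word_cat x ws1 ws2 :
  word drho x (ws1 ++ ws2) = word drho (word drho x ws2) ws1.
Proof. by rewrite /word foldr_cat. Qed.

Lemma word_linear ws c x y : word drho (c *: x + y) ws = c *: word drho x ws + word drho y ws.
Proof. by elim: ws => //= Y ws ->; rewrite mulmxDr -scalemxAr. Qed.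

Lemma word_commute ws1 Z Y ws2 x : traceless (ws1 ++ Z :: Y :: ws2) ->
  word drho x (ws1 ++ Z :: Y :: ws2) =
  word drho x (ws1 ++ Y :: Z :: ws2) + word drho x (ws1 ++ (Z *m Y - Y *m Z) :: ws2).
Proof.
rewrite all_cat => /andP[_ /= /andP[/eqP tZ /andP[/eqP tY _]]].
rewrite !word_cat -[word _ _ ws1 + _]addrC /= (drep_bracket hr tZ tY).
set y := word drho x ws2.
rewrite -[word drho ((_ - _) *m y) ws1]scale1r.
have -> : drho Z *m (drho Y *m y) =
   1 *: ((drho Z *m drho Y - drho Y *m drho Z) *m y) + drho Y *m (drho Z *m y).
  by rewrite scale1r mulmxBl !mulmxA subrK.
by rewrite word_linear.
Qed.

Lemma word_nseq x X k : word drho x (nseq k X) = iter k (mulmx (drho X)) x.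
Proof. by elim: k => //= k ->. Qed.

End Pair.

Section TwoReps.
Variables (n d1 d2 : nat).
Variables (rho1 : 'M[C]_n.+1 -> 'M[C]_d1) (drho1 : 'M[C]_n.+1 -> 'M[C]_d1).
Variables (rho2 : 'M[C]_n.+1 -> 'M[C]_d2) (drho2 : 'M[C]_n.+1 -> 'M[C]_d2).
Hypothesis hr1 : drep rho1 drho1.
Hypothesis hr2 : drep rho2 drho2.
Variables (L1 : 'rV[C]_d1) (x1 : 'cV[C]_d1) (L2 : 'rV[C]_d2) (x2 : 'cV[C]_d2).

(** Every element of the group is an exponential. Equality on powers of the derivative passes to
    Euler iterates, by induction on the number of steps with extra powers in front, and then to the
    limit. *)
Lemma drep_matrix_coef_eq (c1 c2 : C) :
  (forall A k, su A -> c2 *: (L1 *m iter k (mulmx (drho1 A)) x1) =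
     c1 *: (L2 *m iter k (mulmx (drho2 A)) x2)) ->
  forall g, SU g -> c2 *: (L1 *m rho1 g *m x1) = c1 *: (L2 *m rho2 g *m x2).
Proof.
move=> h g /expmx_surj[A hA ->].
have [K1 hK1] := drep_euler x1 hr1 hA; have [K2 hK2] := drep_euler x2 hr2 hA.
set T1 := fun N : nat => (fun y : 'cV[C]_d1 => y + N.+1%:R^-1 *: (drho1 A *m y)).
set T2 := fun N : nat => (fun y : 'cV[C]_d2 => y + N.+1%:R^-1 *: (drho2 A *m y)).
have good N k l : c2 *: (L1 *m iter k (mulmx (drho1 A)) (iter l (T1 N) x1)) =
     c1 *: (L2 *m iter k (mulmx (drho2 A)) (iter l (T2 N) x2)).
  elim: l k => [|l ih] k; first exact: h.
  have E d (X : 'M[C]_d) (c : C) (y : 'cV[C]_d) : iter k (mulmx X) (y + c *: (X *m y)) =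
     iter k (mulmx X) y + c *: iter k.+1 (mulmx X) y.
    elim: k => //= k' ->; rewrite mulmxDr -scalemxAr; congr (_ + _ *: _).
  rewrite !iterS /T1 /T2 !E !mulmxDr !scalerDr -!scalemxAr ih.
  by rewrite ![_ *: (N.+1%:R^-1 *: _)]scalerA ![_ * N.+1%:R^-1]mulrC -!scalerA ih.
apply/eqP; rewrite -subr_eq0; apply/eqP; apply: nm0_eq0.
apply: (@le0_archi _ _ (normc c2 * (nm L1 * K1) + normc c1 * (nm L2 * K2))) => N.
have -> : c2 *: (L1 *m rho1 (expmx A) *m x1) - c1 *: (L2 *m rho2 (expmx A) *m x2) =
   c2 *: (L1 *m (rho1 (expmx A) *m x1 - iter N.+1 (T1 N) x1)) -
   c1 *: (L2 *m (rho2 (expmx A) *m x2 - iter N.+1 (T2 N) x2)).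
  rewrite !mulmxBr !mulmxA !scalerBr (good N 0%N N.+1 : _ = _).
  by rewrite [- (_ - _) in RHS]opprB addrA subrK.
rewrite mulrDl; apply: le_trans (nmB _ _) _; rewrite !nmZ -!mulrA lerD //.
  rewrite ler_wpM2l ?normc_ge0 //; apply: le_trans (nmM _ _) _.
  by rewrite ler_wpM2l ?nm_ge0 ?hK1.
rewrite ler_wpM2l ?normc_ge0 //; apply: le_trans (nmM _ _) _.
by rewrite ler_wpM2l ?nm_ge0 ?hK2.
Qed.

(** The two coefficients are multiplied crosswise by their values at 1. Their difference then
    vanishes on the empty word, without any division, and [words_vanish] propagates this to all
    words. *)
Lemma matrix_coef_unique (BL BR : 'M[C]_n.+1 -> Prop) (chiL chiR : 'M[C]_n.+1 -> C) :
  (forall Y, \tr Y = 0 -> exists X Z,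
     [/\ Y = X + Z, \tr X = 0, \tr Z = 0, BL X & BR Z]) ->
  (forall X, \tr X = 0 -> BL X ->
     L1 *m drho1 X = chiL X *: L1 /\ L2 *m drho2 X = chiL X *: L2) ->
  (forall Z, \tr Z = 0 -> BR Z ->
     drho1 Z *m x1 = chiR Z *: x1 /\ drho2 Z *m x2 = chiR Z *: x2) ->
  forall g, SU g ->
    (L2 *m x2) 0 0 * (L1 *m rho1 g *m x1) 0 0 =
    (L1 *m x1) 0 0 * (L2 *m rho2 g *m x2) 0 0.
Proof.
move=> dec hL hR g hg; set c1 := (L1 *m x1) 0 0; set c2 := (L2 *m x2) 0 0.
pose L ws := c2 *: (L1 *m word drho1 x1 ws) - c1 *: (L2 *m word drho2 x2 ws).
have L0 ws : traceless ws -> L ws = 0.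
  apply: (@words_vanish _ BL BR chiL chiR L dec).
  - rewrite /L /=; apply/matrixP => i j; rewrite !ord1 !mxE -/c1 -/c2.
    have -> : \sum_j L1 0 j * x1 j 0 = c1 by rewrite /c1 mxE.
    have -> : \sum_j L2 0 j * x2 j 0 = c2 by rewrite /c2 mxE.
    by rewrite mulrC subrr.
  - move=> X Z ws' /= /andP[/eqP tX /andP[/eqP tZ _]].
    have e1 := drep_linear hr1 1 tX tZ; have e2 := drep_linear hr2 1 tX tZ.
    rewrite scale1r in e1; rewrite scale1r in e2.
    rewrite /L /= e1 e2 !scale1r !mulmxDl !mulmxDr !scalerDr.
    by rewrite opprD addrACA.
  - move=> X ws' /= /andP[/eqP tX _] bX; have [e1 e2] := hL X tX bX.
    rewrite /L /= !mulmxA e1 e2 -!scalemxAl !scalerA ![_ * chiL X]mulrC -!scalerA.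
    by rewrite -scalerBr.
  - move=> Z ws' /= /andP[/eqP tZ _] bZ; have [e1 e2] := hR Z tZ bZ.
    rewrite /L -cats1 !word_cat /= e1 e2 -[chiR Z *: x1]addr0 -[chiR Z *: x2]addr0.
    rewrite !word_linear.
    have w0 d (f : 'M[C]_n.+1 -> 'M[C]_d) : word f 0 ws' = 0.
      by elim: ws' => //= Y w ->; rewrite mulmx0.
    rewrite !w0 !addr0 -!scalemxAr !scalerA ![_ * chiR Z]mulrC -!scalerA.
    by rewrite -scalerBr.
  move=> ws1 Z Y ws2 t; rewrite /L (word_commute hr1) // (word_commute hr2) //.
  by rewrite !mulmxDr !scalerDr opprD addrACA.
have := @drep_matrix_coef_eq c1 c2 _ g hg.
have h A k : su A -> c2 *: (L1 *m iter k (mulmx (drho1 A)) x1) =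
     c1 *: (L2 *m iter k (mulmx (drho2 A)) x2).
  move=> hA; have := L0 (nseq k A); rewrite /L !word_nseq => e.
  apply/eqP; rewrite -subr_eq0 e // all_nseq; case: hA => _ ->.
  by rewrite eqxx orbT.
move=> /(_ h)/matrixP/(_ 0 0).
have sE (c : C) (M : 'M[C]_1) : (c *: M) 0 0 = c * M 0 0 by rewrite mxE.
by rewrite !sE.
Qed.

End TwoReps.
End Words.

(** * Tensor products and explicit eigenfunctions *)

Section Tensor.
Variable R : realType.
Local Notation C := R[i].
Local Notation normc := (@ComplexField.Normc.normc R).

Lemma tensDl m n p q (A B : 'M[C]_(m, n)) (D : 'M[C]_(p, q)) :
  (A + B) *t D = A *t D + B *t D.
Proof. by apply/matrixP => i j; rewrite !mxE mulrDl. Qed.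

Lemma tensDr m n p q (A : 'M[C]_(m, n)) (B D : 'M[C]_(p, q)) :
  A *t (B + D) = A *t B + A *t D.
Proof. by apply/matrixP => i j; rewrite !mxE mulrDr. Qed.

Lemma tensZl m n p q c (A : 'M[C]_(m, n)) (D : 'M[C]_(p, q)) :
  (c *: A) *t D = c *: (A *t D).
Proof. by apply/matrixP => i j; rewrite !mxE mulrA. Qed.

Lemma tensZr m n p q c (A : 'M[C]_(m, n)) (D : 'M[C]_(p, q)) :
  A *t (c *: D) = c *: (A *t D).
Proof. by apply/matrixP => i j; rewrite !mxE mulrCA. Qed.

Lemma tensBl m n p q (A B : 'M[C]_(m, n)) (D : 'M[C]_(p, q)) :
  (A - B) *t D = A *t D - B *t D.
Proof. by apply/matrixP => i j; rewrite !mxE mulrBl. Qed.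

Lemma tensBr m n p q (A : 'M[C]_(m, n)) (B D : 'M[C]_(p, q)) :
  A *t (B - D) = A *t B - A *t D.
Proof. by apply/matrixP => i j; rewrite !mxE mulrBr. Qed.

Lemma tens11 m n : (1%:M : 'M[C]_m) *t (1%:M : 'M[C]_n) = 1%:M.
Proof.
apply/matrixP => i j; rewrite !mxE -natrM mulnb; congr (nat_of_bool _)%:R.
rewrite -(can_eq (@mxtens_unindexK m n)).
by case: (mxtens_unindex i) (mxtens_unindex j) => [? ?] [? ?].
Qed.

Lemma tangent_tens d e f g (X : 'M[C]_d) (Y : 'M[C]_e) :
  tangent f X -> tangent g Y ->
  tangent (fun s => f s *t g s) (X *t 1%:M + 1%:M *t Y).
Proof.
move=> /tangentP[K K0 hK] /tangentP[L L0 hL]; split; last first.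
  exists (K * L) => s; have [h1 _ _] := hK s; have [h2 _ _] := hL s.
  by rewrite nm_tens; exact: (ler_pM (nm_ge0 _) (nm_ge0 _) h1 h2).
exists (K * L + K * e%:R + K * nm Y) => s.
have [h1 h2 h3] := hK s; have [h4 h5 h6] := hL s.
have -> : f s *t g s - 1%:M - s%:C%C *: (X *t 1%:M + 1%:M *t Y) =
   f s *t (g s - 1%:M - s%:C%C *: Y) + (f s - 1%:M - s%:C%C *: X) *t 1%:M +
   s%:C%C *: ((f s - 1%:M) *t Y).
  rewrite !tensBr !tensBl tensZr tensZl tens11.
  move: (f s *t g s) (f s *t Y) (f s *t 1%:M) (X *t 1%:M) (1%:M *t Y) => p q t u v.
  by apply/matrixP => i j; rewrite !mxE; ring.
rewrite !mulrDl; apply: le_trans (nmD _ _) _; rewrite lerD //.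
  apply: le_trans (nmD _ _) _; rewrite lerD // nm_tens.
    by rewrite -mulrA; exact: ler_pM (nm_ge0 _) (nm_ge0 _) h1 h5.
  by rewrite nm1 mulrAC ler_wpM2r.
rewrite nmZ normc_real -(@real_normK _ s) ?num_real // nm_tens.
apply: le_trans (ler_wpM2l (normr_ge0 s) (ler_wpM2r (nm_ge0 Y) h3)) _.
rewrite le_eqVlt; apply/orP; left; apply/eqP; ring.
Qed.

Lemma drep_tens n d e (rho : 'M[C]_n.+1 -> 'M[C]_d) drho (rho' : 'M[C]_n.+1 -> 'M[C]_e) drho' :
  drep rho drho -> drep rho' drho' ->
  drep (fun g => rho g *t rho' g) (fun X => drho X *t 1%:M + 1%:M *t drho' X).
Proof.
move=> h h'; split.
- by move=> g k hg hk; rewrite (drepM h hg hk) (drepM h' hg hk) tensmx_mul.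
- by move=> A hA; exact: tangent_tens (drep_tangent h hA) (drep_tangent h' hA).
- move=> c X Y tX tY; rewrite (drep_linear h c tX tY) (drep_linear h' c tX tY).
  by rewrite tensDl tensDr tensZl tensZr scalerDr addrACA.
- move=> X Y tX tY; rewrite (drep_bracket h tX tY) (drep_bracket h' tX tY).
  rewrite !mulmxDl !mulmxDr !tensmx_mul !mul1mx !mulmx1 !tensBl !tensBr.
  move: (drho X *m drho Y *t _) (drho X *t drho' Y) (drho Y *t drho' X) (_ *t (drho' X *m _))
    (drho Y *m drho X *t _) (_ *t (drho' Y *m _)) => p q r t u v.
  by apply/matrixP => i j; rewrite !mxE; ring.
move=> g X hg tX; rewrite mulmxDr mulmxDl !tensmx_mul !mul1mx !mulmx1.
by rewrite (drep_Ad h hg tX) (drep_Ad h' hg tX).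
Qed.

Lemma drep_std n : drep (fun g : 'M[C]_n.+1 => g) (fun X => X).
Proof.
split=> //; first by move=> A hA; exact: tangent_expmx.
by move=> g X hg _; rewrite -mulmxA SU_Vmul // mulmx1.
Qed.

Lemma drep_triv n : drep (fun g : 'M[C]_n.+1 => 1%:M : 'M[C]_1) (fun=> 0).
Proof.
split=> //.
- by move=> *; rewrite mulmx1.
- move=> A hA; split; last by exists 1 => s; rewrite nm1.
  by exists 0 => s; rewrite subrr scaler0 subrr nm0 mul0r.
- by move=> *; rewrite scaler0 addr0.
- by move=> *; rewrite mulmx0 subrr.
by move=> *; rewrite mulmx0 mul0mx.
Qed.

Lemma nm_conj m n (M : 'M[C]_(m, n)) : nm (map_mx Num.conj M) = nm M.
Proof.
by apply: eq_bigr => i _; apply: eq_bigr => j _; rewrite mxE normc_conj.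
Qed.

Lemma tangent_conjC d f (X : 'M[C]_d) : tangent f X ->
  tangent (fun s => map_mx Num.conj (f s)) (map_mx Num.conj X).
Proof.
move=> [[K hK] [D hD]]; split; last by exists D => s; rewrite nm_conj.
exists K => s; apply: le_trans (hK s); rewrite -[X in _ <= X]nm_conj.
have -> : map_mx Num.conj (f s - 1%:M - s%:C%C *: X) =
    map_mx Num.conj (f s) - 1%:M - s%:C%C *: map_mx Num.conj X; last by [].
apply/matrixP => i j; rewrite !mxE !rmorphB rmorphM rmorph_nat.
by rewrite [X in X * _](conjc_real s : (s%:C%C : C)^* = _).
Qed.

(** On [su], entrywise conjugation agrees with $A\mapsto-A^T$, and the latter is its complex linear
    extension. *)
Lemma drep_conj n : drep (fun g : 'M[C]_n.+1 => map_mx Num.conj g) (fun X => - X^T).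
Proof.
split.
- by move=> g h _ _; rewrite map_mxM.
- move=> A hA; have -> : - A^T = map_mx Num.conj A.
    by case: hA => e _; rewrite -[in LHS](opprK A) -e; apply/matrixP => i j; rewrite !mxE opprK.
  exact: tangent_conjC (tangent_expmx hA).
- by move=> c X Y _ _; apply/matrixP => i j; rewrite !mxE; ring.
- move=> X Y _ _; rewrite raddfB /= !trmx_mul mulNmx mulmxN opprK mulNmx mulmxN opprK.
  by rewrite opprB.
move=> g X hg _; rewrite !trmx_mul mulmxN mulNmx.
have -> : (g^t*)^T = map_mx Num.conj g by apply/matrixP => i j; rewrite !mxE.
have gg : g^T *m (map_mx Num.conj g) = 1%:M.
  have := congr1 (fun M => M^T) (SU_Vmul hg); rewrite trmx_mul trmx1 => <-.
  by congr (_ *m _); apply/matrixP => i j; rewrite !mxE.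
by rewrite -!mulmxA gg mulmx1.
Qed.

(* Row and column vectors get their own tensor products: [tensmx] would
   produce matrices with [1 * 1] rows or columns. *)
Definition tensr d e (L : 'rV[C]_d) (L' : 'rV[C]_e) : 'rV[C]_(d * e) := L *t L'.
Definition tensc d e (x : 'cV[C]_d) (x' : 'cV[C]_e) : 'cV[C]_(d * e) := x *t x'.

Lemma tensr_mul d e d' e' (L : 'rV[C]_d) (L' : 'rV[C]_e) (A : 'M[C]_(d, d'))
    (B : 'M[C]_(e, e')) : tensr L L' *m (A *t B) = tensr (L *m A) (L' *m B).
Proof. exact: (@tensmx_mul _ 1 d 1 e d' e' L L' A B). Qed.

Lemma tensc_mul d e d' e' (x : 'cV[C]_d) (x' : 'cV[C]_e) (A : 'M[C]_(d', d))
    (B : 'M[C]_(e', e)) : (A *t B) *m tensc x x' = tensc (A *m x) (B *m x').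
Proof. exact: (@tensmx_mul _ d' d e' e 1 1 A B x x'). Qed.

Lemma tensrc_mul d e (L : 'rV[C]_d) (L' : 'rV[C]_e) (x : 'cV[C]_d) (x' : 'cV[C]_e) :
  (tensr L L' *m tensc x x') 0 0 = (L *m x) 0 0 * (L' *m x') 0 0.
Proof.
have -> : tensr L L' *m tensc x x' = (L *m x) *t (L' *m x').
  exact: (@tensmx_mul _ 1 d 1 e 1 1 L L' x x').
move: (L *m x) (L' *m x') => M N; rewrite [LHS]mxE.
set i := (mxtens_unindex _).1; set k := (mxtens_unindex _).2.
by rewrite (ord1 i) (ord1 k).
Qed.

Lemma tensrDl d e (A B : 'rV[C]_d) (D : 'rV[C]_e) : tensr (A + B) D = tensr A D + tensr B D.
Proof. exact: (@tensDl 1 d 1 e A B D). Qed.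
Lemma tensrDr d e (A : 'rV[C]_d) (B D : 'rV[C]_e) : tensr A (B + D) = tensr A B + tensr A D.
Proof. exact: (@tensDr 1 d 1 e A B D). Qed.
Lemma tensrZl d e c (A : 'rV[C]_d) (D : 'rV[C]_e) : tensr (c *: A) D = c *: tensr A D.
Proof. exact: (@tensZl 1 d 1 e c A D). Qed.
Lemma tensrZr d e c (A : 'rV[C]_d) (D : 'rV[C]_e) : tensr A (c *: D) = c *: tensr A D.
Proof. exact: (@tensZr 1 d 1 e c A D). Qed.
Lemma tenscDl d e (A B : 'cV[C]_d) (D : 'cV[C]_e) : tensc (A + B) D = tensc A D + tensc B D.
Proof. exact: (@tensDl d 1 e 1 A B D). Qed.
Lemma tenscDr d e (A : 'cV[C]_d) (B D : 'cV[C]_e) : tensc A (B + D) = tensc A B + tensc A D.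
Proof. exact: (@tensDr d 1 e 1 A B D). Qed.
Lemma tenscZl d e c (A : 'cV[C]_d) (D : 'cV[C]_e) : tensc (c *: A) D = c *: tensc A D.
Proof. exact: (@tensZl d 1 e 1 c A D). Qed.
Lemma tenscZr d e c (A : 'cV[C]_d) (D : 'cV[C]_e) : tensc A (c *: D) = c *: tensc A D.
Proof. exact: (@tensZr d 1 e 1 c A D). Qed.

(** An eigenfunction on both sides, realised as a matrix coefficient so that [matrix_coef_unique]
    can be applied. Tensor products multiply such functions and add their characters. *)
Definition coef_fun n (BL BR : 'M[C]_n.+1 -> Prop) (f : 'M[C]_n.+1 -> C)
    (chiL chiR : 'M[C]_n.+1 -> C) : Prop :=
  exists d (rho : 'M[C]_n.+1 -> 'M[C]_d) drho (L : 'rV[C]_d) (x : 'cV[C]_d),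
    [/\ drep rho drho, forall g, f g = (L *m rho g *m x) 0 0,
        forall X, BL X -> L *m drho X = chiL X *: L
      & forall Z, BR Z -> drho Z *m x = chiR Z *: x].

Lemma coef_fun1 n BL BR :
  coef_fun BL BR (fun _ : 'M[C]_n.+1 => 1) (fun=> 0) (fun=> 0).
Proof.
exists 1, (fun=> 1%:M), (fun=> 0), 1%:M, 1%:M; split.
- exact: drep_triv.
- by move=> g; rewrite !mulmx1 mxE.
- by move=> *; rewrite mulmx0 scale0r.
by move=> *; rewrite mul0mx scale0r.
Qed.

Lemma coef_funM n BL BR (f f' : 'M[C]_n.+1 -> C) cL cR cL' cR' :
  coef_fun BL BR f cL cR -> coef_fun BL BR f' cL' cR' ->
  coef_fun BL BR (fun g => f g * f' g) (fun X => cL X + cL' X) (fun X => cR X + cR' X).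
Proof.
move=> [d [rho [drho [L [x [h hf hL hR]]]]]] [d' [rho' [drho' [L' [x' [h' hf' hL' hR']]]]]].
exists (d * d')%N, (fun g => rho g *t rho' g), (fun X => drho X *t 1%:M + 1%:M *t drho' X), (tensr L L'), (tensc x x'); split.
- exact: drep_tens h h'.
- by move=> g; rewrite hf hf' tensr_mul tensrc_mul.
- move=> X bX; rewrite mulmxDr !tensr_mul !mulmx1 hL // hL' //.
  by rewrite tensrZl tensrZr scalerDl.
move=> X bX; rewrite mulmxDl !tensc_mul !mul1mx hR // hR' //.
by rewrite tenscZl tenscZr scalerDl.
Qed.

Lemma coef_funX n BL BR (f : 'M[C]_n.+1 -> C) cL cR k :
  coef_fun BL BR f cL cR ->
  coef_fun BL BR (fun g => f g ^+ k) (fun X => cL X *+ k) (fun X => cR X *+ k).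
Proof.
move=> h; elim: k => [|k ih].
  have := coef_fun1 BL BR; congr (coef_fun _ _ _ _ _).
have := coef_funM h ih; congr (coef_fun _ _ _ _ _).
- by rewrite funeqE => g; rewrite exprS.
- by rewrite funeqE => g; rewrite mulrS.
by rewrite funeqE => g; rewrite mulrS.
Qed.

Variable m : nat.
Notation n := m.+2.
Local Notation o0 := (0 : 'I_n).
Local Notation o1 := (1 : 'I_n).
Local Notation ol := (ord_max : 'I_n).

(* The complexified Lie algebra of S(B x U(m)), where B consists of the lower
   triangular matrices of U(2). *)
Definition lower_block (X : 'M[C]_n) : Prop :=
  forall k l : 'I_n, ((k < 2)%N != (l < 2)%N) || ((k == o0) && (l == o1)) -> X k l = 0.

(* The stabilizer of the flag (span e_1, span (e_1, e_2), span (e_1, ..., e_{m+1})). *)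
Definition flag_stab (Z : 'M[C]_n) : Prop :=
  [/\ forall k : 'I_n, k != o0 -> Z k o0 = 0,
      forall k : 'I_n, (1 < k)%N -> Z k o1 = 0
    & forall k : 'I_n, k != ol -> Z ol k = 0].

Lemma rV_delta_mul k (X : 'M[C]_n) : delta_mx 0 k *m X = row k X.
Proof. by rewrite rowE. Qed.

Lemma cV_delta_mul k (X : 'M[C]_n) : X *m delta_mx k 0 = col k X.
Proof. by rewrite colE. Qed.

Lemma delta_coef k l (g : 'M[C]_n) :
  (((delta_mx 0 k : 'rV_n) *m g *m (delta_mx l 0 : 'cV_n)) 0 0) = g k l.
Proof. by rewrite -rowE -colE !mxE. Qed.

Lemma coef_fun_corner : coef_fun lower_block flag_stab (fun g => g o0 o0)
  (fun X => X o0 o0) (fun Z => Z o0 o0).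
Proof.
exists n, (fun g => g), (fun X => X), (delta_mx 0 o0), (delta_mx o0 0); split.
- exact: drep_std.
- by move=> g; rewrite delta_coef.
- move=> X bX; rewrite rV_delta_mul; apply/rowP => l; rewrite !mxE eqxx /=.
  have [->|l0] := eqVneq l o0; first by rewrite mulr1.
  rewrite mulr0 bX //=.
  have [l2|l2] := ltnP l 2; last by [].
  by move: l l0 l2 => [[|[|l]] hl].
move=> Z [h _ _]; rewrite cV_delta_mul; apply/colP => l; rewrite !mxE eqxx andbT.
by have [->|l0] := eqVneq l o0; rewrite ?mulr1 // mulr0 h.
Qed.

(** In the conjugate representation the derivative is $-X^T$, so the condition of [flag_stab] on the
    last row becomes the statement that a column vector is an eigenvector. *)
Lemma coef_fun_conj : coef_fun lower_block flag_stab (fun g => (g o1 ol)^*)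
  (fun X => - X o1 o1) (fun Z => - Z ol ol).
Proof.
exists n, (fun g => map_mx Num.conj g), (fun X => - X^T), (delta_mx 0 o1), (delta_mx ol 0); split.
- exact: drep_conj.
- by move=> g; rewrite delta_coef !mxE.
- move=> X bX; rewrite rV_delta_mul; apply/rowP => l; rewrite !mxE eqxx /=.
  have [->|l1] := eqVneq l o1; first by rewrite mulr1.
  rewrite mulr0 bX ?oppr0 //=.
  have [l2|l2] := ltnP l 2; last by [].
  by move: l l1 l2 => [[|[|l]] hl].
move=> Z [_ _ h]; rewrite cV_delta_mul; apply/colP => l; rewrite !mxE eqxx andbT.
by have [->|l0] := eqVneq l ol; rewrite ?mulr1 // mulr0 h // oppr0.
Qed.

Definition minor2 (g : 'M[C]_n) : C := g o0 o0 * g o1 o1 - g o0 o1 * g o1 o0.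

(** The minor is a coefficient of the exterior square, seen as antisymmetric vectors in the tensor
    square. The factor 1/2 compensates for each antisymmetric pairing giving the minor twice. *)
Lemma coef_fun_minor : coef_fun lower_block flag_stab minor2
  (fun X => X o0 o0 + X o1 o1) (fun Z => Z o0 o0 + Z o1 o1).
Proof.
pose L : 'rV[C]_(n * n) := (2^-1 : C) *: (tensr (delta_mx 0 o0) (delta_mx 0 o1)
   - tensr (delta_mx 0 o1) (delta_mx 0 o0)).
pose x : 'cV[C]_(n * n) := tensc (delta_mx o0 0) (delta_mx o1 0)
   - tensc (delta_mx o1 0) (delta_mx o0 0).
exists (n * n)%N, (fun g => g *t g), (fun X => X *t 1%:M + 1%:M *t X), L, x; split.
- exact: drep_tens (drep_std _) (drep_std _).
- move=> g; rewrite /L /x -!scalemxAl !mulmxBl !mulmxBr.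
  have E (a b c d : 'I_n) : (tensr (delta_mx 0 a) (delta_mx 0 b) *m (g *t g) *m
      tensc (delta_mx c 0) (delta_mx d 0)) 0 0 = g a c * g b d.
    by rewrite tensr_mul tensrc_mul !delta_coef.
  have := E o0 o1 o0 o1; have := E o0 o1 o1 o0; have := E o1 o0 o0 o1; have := E o1 o0 o1 o0.
  move: (_ *m tensc _ _) (_ *m tensc _ _) => p q.
  move: (_ *m tensc _ _) (_ *m tensc _ _) => r t.
  rewrite !mxE => -> -> -> ->; rewrite /minor2.
  by field.
- move=> X bX.
  have r0 : (delta_mx 0 o0 : 'rV[C]_n) *m X = X o0 o0 *: delta_mx 0 o0.
    rewrite rV_delta_mul; apply/rowP => l; rewrite !mxE eqxx /=.
    have [->|l0] := eqVneq l o0; first by rewrite mulr1.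
    rewrite mulr0 bX //=.
    have [l2|l2] := ltnP l 2; last by [].
    by move: l l0 l2 => [[|[|l]] hl].
  have r1 : (delta_mx 0 o1 : 'rV[C]_n) *m X = X o1 o0 *: delta_mx 0 o0 + X o1 o1 *: delta_mx 0 o1.
    rewrite rV_delta_mul; apply/rowP => l; rewrite !mxE eqxx /=.
    have [->|l0] := eqVneq l o0; first by rewrite mulr1 mulr0 addr0.
    have [->|l1] := eqVneq l o1; first by rewrite mulr1 mulr0 add0r.
    rewrite !mulr0 addr0 bX //=.
    have [l2|l2] := ltnP l 2; last by [].
    by move: l l0 l1 l2 => [[|[|l]] hl].
  rewrite /L -!scalemxAl mulmxDr !mulmxBl !tensr_mul !mulmx1 r0 r1.
  rewrite !(tensrDl, tensrDr, tensrZl, tensrZr).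
  set p := tensr _ _; set q := tensr _ _; set r := tensr _ _.
  clearbody p q r; by apply/matrixP => i j; rewrite !mxE; ring.
move=> Z [h0 h1 _].
have r0 : Z *m (delta_mx o0 0 : 'cV[C]_n) = Z o0 o0 *: delta_mx o0 0.
  rewrite cV_delta_mul; apply/colP => l; rewrite !mxE eqxx andbT.
  by have [->|l0] := eqVneq l o0; rewrite ?mulr1 // mulr0 h0.
have r1 : Z *m (delta_mx o1 0 : 'cV[C]_n) = Z o0 o1 *: delta_mx o0 0 + Z o1 o1 *: delta_mx o1 0.
  rewrite cV_delta_mul; apply/colP => l; rewrite !mxE eqxx !andbT.
  have [->|l0] := eqVneq l o0; first by rewrite mulr1 mulr0 addr0.
  have [->|l1] := eqVneq l o1; first by rewrite mulr1 mulr0 add0r.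
  rewrite !mulr0 addr0 h1 //.
  by move: l l0 l1 => [[|[|l]] hl].
rewrite /x mulmxBr !mulmxDl !tensc_mul !mul1mx r0 r1.
rewrite !(tenscDl, tenscDr, tenscZl, tenscZr).
set p := tensc _ _; set q := tensc _ _; set r := tensc _ _.
clearbody p q r; by apply/matrixP => i j; rewrite !mxE; ring.
Qed.

(** One factor for each of the fundamental weights $\omega_1$, $\omega_2$, $\omega_{m+1}$, the last
    one through the dual of the standard representation. *)
Definition hw_fun p q r (g : 'M[C]_n) : C :=
  g o0 o0 ^+ p * minor2 g ^+ q * (g o1 ol)^* ^+ r.

Lemma coef_fun_hw p q r : coef_fun lower_block flag_stab (hw_fun p q r)
  (fun X => X o0 o0 *+ p + (X o0 o0 + X o1 o1) *+ q + (- X o1 o1) *+ r)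
  (fun Z => Z o0 o0 *+ p + (Z o0 o0 + Z o1 o1) *+ q + (- Z ol ol) *+ r).
Proof.
exact: coef_funM (coef_funM (coef_funX p coef_fun_corner) (coef_funX q coef_fun_minor))
  (coef_funX r coef_fun_conj).
Qed.

End Tensor.

(** * Highest weight vectors *)

Section Weights.
Variable R : realType.
Local Notation C := R[i].
Local Notation normc := (@ComplexField.Normc.normc R).

Lemma drep_sum n d (rho : 'M[C]_n.+1 -> 'M[C]_d) drho : drep rho drho ->
  forall I (s : seq I) (P : pred I) (c : I -> C) (F : I -> 'M[C]_n.+1),
  (forall i, P i -> \tr (F i) = 0) ->
  drho (\sum_(i <- s | P i) c i *: F i) = \sum_(i <- s | P i) c i *: drho (F i)
  /\ \tr (\sum_(i <- s | P i) c i *: F i) = 0.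
Proof.
move=> h I s P c F hF.
have d0 : drho 0 = 0.
  have := drep_linear h (-1) (mxtrace0 _ _) (mxtrace0 _ _).
  by rewrite scaler0 addr0 scaleN1r addNr.
elim: s => [|i s [ih1 ih2]]; first by rewrite !big_nil d0 mxtrace0.
rewrite !big_cons; case: ifP => // Pi.
by rewrite (drep_linear h (c i) (hF i Pi) ih2) ih1 mxtraceD mxtraceZ hF // mulr0 ih2 addr0.
Qed.

Lemma mx_diag_offdiag n (X : 'M[C]_n.+1) :
  X = diag_mx (\row_i X i i) + \sum_(p | p.1 != p.2) X p.1 p.2 *: delta_mx p.1 p.2.
Proof.
rewrite [LHS]matrix_sum_delta pair_big /= (bigID (fun p => p.1 == p.2)) /=.
congr (_ + _).
apply/matrixP => i j; rewrite summxE !mxE.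
have [<-|ij] := eqVneq i j.
  rewrite mulr1n (bigD1 (i, i)) //= big1 ?addr0; last first.
    move=> [k l] /= /andP[/eqP <-]; rewrite xpair_eqE andbb => ki; rewrite !mxE.
    by rewrite eq_sym (negPf ki) mulr0.
  by rewrite !mxE !eqxx mulr1.
rewrite mulr0n big1 // => -[k l] /= /eqP <-; rewrite !mxE.
have [ik|] := eqVneq i k; last by rewrite mulr0.
by rewrite -ik eq_sym (negPf ij) mulr0.
Qed.

Lemma trace_delta0 n (k l : 'I_n.+1) : k != l -> \tr (delta_mx k l : 'M[C]_n.+1) = 0.
Proof.
move=> kl; rewrite /mxtrace big1 // => i _; rewrite mxE.
by case: eqVneq => //= ->; rewrite (negPf kl).
Qed.

Lemma drep_eigen n d (rho : 'M[C]_n.+1 -> 'M[C]_d) drho (x : 'cV[C]_d)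
    (w : 'rV[C]_n.+1 -> C) (N : 'I_n.+1 -> 'I_n.+1 -> bool) (X : 'M[C]_n.+1) :
  drep rho drho ->
  (forall z : 'rV[C]_n.+1, \sum_i z 0 i = 0 -> drho (diag_mx z) *m x = w z *: x) ->
  (forall k l, k != l -> N k l -> drho (delta_mx k l) *m x = 0) ->
  (forall k l, k != l -> ~~ N k l -> X k l = 0) -> \tr X = 0 ->
  drho X *m x = w (\row_i X i i) *: x.
Proof.
move=> h hw hN hX tX.
have tD : \sum_i (\row_i X i i) 0 i = 0 by rewrite -[RHS]tX; apply: eq_bigr => i _; rewrite mxE.
have [e1 e2] := @drep_sum _ _ _ _ h _ (index_enum _) (fun p : 'I_n.+1 * 'I_n.+1 => p.1 != p.2)
  (fun p => X p.1 p.2) (fun p => delta_mx p.1 p.2) (fun p hp => trace_delta0 hp).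
have tDiag : \tr (diag_mx (\row_i X i i)) = 0 by rewrite mxtrace_diag.
rewrite [in LHS](mx_diag_offdiag X) -[diag_mx _]scale1r (drep_linear h 1 tDiag e2).
rewrite scale1r e1 mulmxDl hw // mulmx_suml big1 ?addr0 // => -[k l] /= kl.
rewrite -scalemxAl; have [Nkl|Nkl] := boolP (N k l); first by rewrite hN ?scaler0.
by rewrite hX // scale0r.
Qed.

Lemma trC_mul_eq0 m (y : 'cV[C]_m) : y^t* *m y = 0 -> y = 0.
Proof.
move/matrixP/(_ 0 0); rewrite !mxE => h.
have {}h : \sum_i `|y i 0| ^+ 2 = 0.
  by rewrite -[RHS]h; apply: eq_bigr => i _; rewrite !mxE mulrC normCK.
apply/colP => i; rewrite mxE.
have := psumr_eq0P (fun i _ => exprn_ge0 2 (normr_ge0 (y i 0))) h => /(_ i isT)/eqP.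
by rewrite sqrf_eq0 normr_eq0 => /eqP.
Qed.

Lemma mul_comm_eq0 d (E F H : 'M[C]_d) (x : 'cV[C]_d) :
  E *m F = F *m E + H -> E *m x = 0 -> H *m x = 0 -> E *m (F *m x) = 0.
Proof. by move=> e Ex Hx; rewrite mulmxA e mulmxDl -mulmxA Ex Hx mulmx0 addr0. Qed.

Section UnitaryRep.
Variables (m d : nat).
Local Notation n := m.+2.
Variable pi : 'M[C]_n -> 'M[C]_d.
Hypothesis hpi : unitary_rep (@SU R n) pi.
Local Notation D := (dcplx pi).

(** Conjugation is inversion on the torus, so no negative exponents are needed. Here [p] is the full
    exponent of the first coordinate; for $p\omega_1+q\omega_2+r\omega_{m+1}$ the arguments are
    [(p + q) q r]. *)
Definition wt_char (p q r : nat) (t : 'rV[C]_n) : C :=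
  t 0 0 ^+ p * t 0 1 ^+ q * (t 0 ord_max)^* ^+ r.

Definition wt (p q r : nat) (z : 'rV[C]_n) : C :=
  z 0 0 *+ p + z 0 1 *+ q - z 0 ord_max *+ r.

Definition weight_vector (p q r : nat) (x : 'cV[C]_d) : Prop :=
  forall t, SU (diag_mx t) -> pi (diag_mx t) *m x = wt_char p q r t *: x.

Lemma imdiag_su (th : 'rV[R]_n) : \sum_i th 0 i = 0 -> su (imdiag th).
Proof.
move=> h; split; first exact: imdiag_trC.
rewrite mxtrace_diag; under eq_bigr do rewrite mxE.
by rewrite -mulr_sumr -rmorph_sum h rmorph0 mulr0.
Qed.

Lemma expmx_imdiag (th : 'rV[R]_n) : expmx (imdiag th) = diag_mx (map_mx (@expi R) th).
Proof.
have := expmx_spectral th (unitary1 R n).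
by rewrite trC1 mul1mx mulmx1 mul1mx mulmx1.
Qed.

Lemma dreal_weight p q r x (th : 'rV[R]_n) : weight_vector p q r x ->
  \sum_i th 0 i = 0 ->
  dreal pi (imdiag th) *m x =
  ('i%C * (th 0 0 *+ p + th 0 1 *+ q - th 0 ord_max *+ r)%:C%C) *: x.
Proof.
move=> hx th0; have hs := imdiag_su th0.
set w : R := _ - _; set X := dreal _ _.
have [[K hK] _] := dreal_tangent hpi hs.
apply/eqP; rewrite -subr_eq0; apply/eqP.
apply: (@quadratic_eq0 _ _ _ _ ((2 * w ^+ 2) * nm x + K * nm x)) => s.
have := hK s; rewrite -/X imdiagZ expmx_imdiag => hKs.
set t := map_mx (@expi R) (s *: th) in hKs.
have tSU : SU (diag_mx t).
  by rewrite /t -expmx_imdiag -imdiagZ; exact: su_expSU.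
have E : pi (diag_mx t) *m x = expi (s * w) *: x.
  rewrite hx //; congr (_ *: _); rewrite /wt_char !mxE conj_expi -!expiMn -!expiD.
  by congr expi; rewrite /w mulrBr mulrDr !mulrnAr mulNrn.
have -> : s%:C%C *: (X *m x - ('i%C * w%:C%C) *: x) =
  (expi (s * w) - 1 - 'i%C * (s * w)%:C%C) *: x -
  (pi (diag_mx t) - 1%:M - s%:C%C *: X) *m x.
  rewrite !mulmxBl E mul1mx -scalemxAl rmorphM.
  move: (X *m x) => y; apply/matrixP => i j; rewrite !mxE; ring.
rewrite mulrDl; apply: le_trans (nmB _ _) _; rewrite lerD //.
  rewrite nmZ mulrAC ler_wpM2r ?nm_ge0 //; apply: le_trans (expi_approx _) _.
  by rewrite exprMn -[X in _ <= X]mulrA [w ^+ 2 * _]mulrC.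
by rewrite mulrAC; apply: le_trans (nmM _ _) _; rewrite ler_wpM2r ?nm_ge0.
Qed.

Lemma dcplx_mul X (x : 'cV[C]_d) : D X *m x =
  dreal pi (re_su X) *m x + 'i%C *: (dreal pi (im_su X) *m x).
Proof.
by rewrite dcplxE; move: (dreal pi _) (dreal pi _) => u v; rewrite mulmxDl scalemxAl.
Qed.

Lemma dcplx_weight p q r x (z : 'rV[C]_n) : weight_vector p q r x ->
  \sum_i z 0 i = 0 -> D (diag_mx z) *m x = wt p q r z *: x.
Proof.
move=> hx z0.
pose a := map_mx (@complex.Im R) z; pose b := map_mx (fun c => - @complex.Re R c) z.
have Re_sum (f : C -> R) (fD : {morph f : u v / u + v}) (f0 : f 0 = 0) :
    \sum_i f (z 0 i) = 0.
  by rewrite -[RHS]f0 -z0 (big_morph f fD f0).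
have ha : \sum_i a 0 i = 0.
  under eq_bigr do rewrite mxE.
  by apply: Re_sum => // -[? ?] [? ?].
have hb : \sum_i b 0 i = 0.
  under eq_bigr do rewrite mxE.
  by rewrite sumrN Re_sum ?oppr0 // => -[? ?] [? ?].
have ea : re_su (diag_mx z) = imdiag a.
  apply/matrixP => i j; rewrite !mxE [j == i]eq_sym.
  case: eqVneq => [->|_]; last by rewrite !mulr0n [X in _ * (_ - X)]conjC0 subr0 mulr0.
  rewrite !mulr1n; case: (z 0 j) => u v; rewrite conjcE /=.
  have -> : (u +i* v)%C = u%:C%C + 'i%C * v%:C%C by exact: complexE.
  by field.
have eb : im_su (diag_mx z) = imdiag b.
  apply/matrixP => i j; rewrite !mxE [j == i]eq_sym.
  case: eqVneq => [->|_]; last by rewrite !mulr0n [X in _ * (_ + X)]conjC0 addr0 mulr0.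
  rewrite !mulr1n; case: (z 0 j) => u v; rewrite conjcE /= inv_2i real_complexN.
  have -> : (u +i* v)%C = u%:C%C + 'i%C * v%:C%C by exact: complexE.
  by field.
have e1 := dreal_weight hx ha; rewrite -ea in e1.
have e2 := dreal_weight hx hb; rewrite -eb in e2.
rewrite dcplx_mul; apply: (etrans (congr2 (fun u v : 'cV[C]_d => u + 'i%C *: v) e1 e2)).
rewrite scalerA -scalerDl; congr (_ *: _); rewrite /wt !mxE.
move: (z 0 0) (z 0 1) (z 0 ord_max) => [u0 v0] [u1 v1] [u2 v2] /=.
have cE (u v : R) : (u +i* v)%C = u%:C%C + 'i%C * v%:C%C by exact: complexE.
have rc (u v t : R) : (u *+ p + v *+ q - t *+ r)%:C%C =
    u%:C%C * p%:R + v%:C%C * q%:R - t%:C%C * r%:R :> C.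
  by rewrite !mulr_natr rmorphB rmorphD !rmorphMn.
have cM (u v : R) k : (u +i* v)%C *+ k = (u%:C%C + 'i%C * v%:C%C) * k%:R.
  by rewrite -cE mulr_natr.
rewrite mulrA mul_ii mulN1r !rc !real_complexN (cM u0 v0 p) (cM u1 v1 q) (cM u2 v2 r).
by move: (u0%:C%C) (v0%:C%C) (u1%:C%C) (v1%:C%C) (u2%:C%C) (v2%:C%C) => *; ring.
Qed.

Lemma dcplx_delta_trC k l : k != l -> (D (delta_mx k l))^t* = D (delta_mx l k).
Proof.
move=> kl; rewrite -(dcplx_trC hpi (trace_delta0 kl)); congr (dcplx pi _).
apply/matrixP => i j; rewrite !mxE andbC.
by case: (_ && _); rewrite ?conjC1 ?conjC0.
Qed.

Lemma bracket_delta k l : k != l ->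
  (delta_mx k l : 'M[C]_n) *m delta_mx l k - delta_mx l k *m delta_mx k l =
  diag_mx (\row_i ((i == k)%:R - (i == l)%:R)).
Proof.
move=> kl; rewrite !mul_delta_mx; apply/matrixP => i j; rewrite !mxE.
have [<-|ij] := eqVneq i j; first by rewrite mulr1n !andbb.
rewrite mulr0n; have [ik|ik] := eqVneq i k.
  rewrite -ik eq_sym (negPf ij) /= sub0r; have [il|il] := eqVneq i l.
    by rewrite -il eq_sym (negPf ij) oppr0.
  by rewrite oppr0.
have [il|il] := eqVneq i l; last by rewrite subr0.
by rewrite -il [j == i]eq_sym (negPf ij) subr0.
Qed.

Lemma dcplx_bracket_delta k l : k != l ->
  D (delta_mx k l) *m D (delta_mx l k) =
  D (delta_mx l k) *m D (delta_mx k l) +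
  D (diag_mx (\row_i ((i == k)%:R - (i == l)%:R))).
Proof.
move=> kl; have lk : l != k by rewrite eq_sym.
rewrite -(bracket_delta kl) (dcplx_bracket hpi (trace_delta0 kl) (trace_delta0 lk)).
by rewrite addrC subrK.
Qed.

Lemma sum_root k l : \sum_i (\row_i ((i == k)%:R - (i == l)%:R) : 'rV[C]_n) 0 i = 0.
Proof.
have s1 (j : 'I_n) : \sum_i (i == j)%:R = 1 :> C.
  by rewrite (bigD1 j) //= eqxx big1 ?addr0 // => i /negPf ->.
by under eq_bigr do rewrite mxE; rewrite sumrB !s1 subrr.
Qed.

(** By unitarity $F=E^*$, so $|Fx|^2=\langle EFx,x\rangle=\langle Hx,x\rangle=0$ when $Ex=0$ and the
    weight of [x] is 0 on the coroot [H]. *)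
Lemma lowering_vanish p q r x k l : weight_vector p q r x -> k != l ->
  wt p q r (\row_i ((i == k)%:R - (i == l)%:R)) = 0 ->
  D (delta_mx k l) *m x = 0 -> D (delta_mx l k) *m x = 0.
Proof.
move=> hx kl w0 h0; have lk : l != k by rewrite eq_sym.
have hH := dcplx_weight hx (sum_root k l); rewrite w0 scale0r in hH.
have h1 := mul_comm_eq0 (dcplx_bracket_delta kl) h0 hH.
by apply: trC_mul_eq0; rewrite trCM (dcplx_delta_trC lk) -mulmxA h1 mulmx0.
Qed.

End UnitaryRep.
End Weights.

(** * Orthonormal frames and flags in general position *)

Section Frames.
Variable R : realType.
Local Notation C := R[i].

Lemma unitary_complete k p (V : 'M[C]_(k, k + p)) : V \is unitarymx ->
  exists W : 'M[C]_(p, k + p), col_mx V W \is unitarymx.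
Proof.
move=> VU.
have [W [WU WV]] : exists W : 'M[C]_(p, k + p), W \is unitarymx /\ W *m V^t* = 0.
  have : \rank (kermx (V^t*)) = p.
    by rewrite mxrank_ker mxrank_map mxrank_tr mxrank_unitary // addKn.
  have : row_base (kermx (V^t*)) *m V^t* = 0.
    by apply/sub_kermxP; rewrite eq_row_base.
  move: (row_base _) (row_base_free (kermx (V^t*))).
  move: (\rank _) => q B fB BV qp; rewrite {}qp in B fB BV.
  exists (schmidt B); split; first by apply: schmidt_unitarymx; rewrite leq_addl.
  have /submxP[E ->] : (schmidt B <= B)%MS by rewrite eqmx_schmidt_free.
  by rewrite -mulmxA BV mulmx0.
exists W; apply/unitarymxP; rewrite tr_col_mx map_row_mx mul_col_row.
rewrite (unitarymxP VU) (unitarymxP WU) WV.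
have -> : V *m W^t* = 0.
  by rewrite -[LHS]trmxCK trCM trmxCK WV trmx0 map_mx0.
by rewrite -scalar_mx_block.
Qed.

(** In dimension at least 4 one column remains free, and its phase adjusts the determinant to 1. *)
Lemma frame_complete p (z y ze : 'cV[C]_p.+4) :
  z^t* *m z = 1%:M -> y^t* *m y = 1%:M -> ze^t* *m ze = 1%:M ->
  y^t* *m z = 0 -> ze^t* *m z = 0 -> ze^t* *m y = 0 ->
  exists2 g : 'M[C]_p.+4, SU g &
    [/\ col 0 g = z, col 1 g = y & col ord_max g = ze].
Proof.
move=> zz yy ee yz ez ey.
have dot (u v : 'cV[C]_p.+4) : \sum_i u i 0 * (v i 0)^* = (v^t* *m u) 0 0.
  by rewrite mxE; apply: eq_bigr => i _; rewrite !mxE mulrC.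
have dotC (u v : 'cV[C]_p.+4) : u^t* *m v = 0 -> v^t* *m u = 0.
  by move=> h; rewrite -[LHS]trmxCK trCM trmxCK h trmx0 map_mx0.
have zy := dotC _ _ yz; have ze' := dotC _ _ ez; have ye := dotC _ _ ey.
pose f (i : 'I_3) := if i == 0 :> nat then z else if i == 1 :> nat then y else ze.
pose V : 'M[C]_(3, 3 + p.+1) := \matrix_(i, j) f i j 0.
have VU : V \is unitarymx.
  apply/unitarymxP/matrixP => i j; rewrite !mxE.
  transitivity (\sum_k f i k 0 * (f j k 0)^*).
    by apply: eq_bigr => k _; rewrite !mxE.
  rewrite dot /f.
  by case: i j => [[|[|[|i]]] hi] [[|[|[|j]]] hj] //=;
    rewrite ?zz ?yy ?ee ?yz ?ez ?ey ?zy ?ze' ?ye !mxE.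
have [W U] := unitary_complete VU; set U0 := col_mx V W in U.
have U0E (i : 'I_3) j : U0 (lshift p.+1 i) j = f i j 0 by rewrite col_mxEu mxE.
pose i2 : 'I_p.+4 := lshift p.+1 (2 : 'I_3).
(* The transposition moves the third prescribed row to the last place, so that row [i2] becomes a
   free one. *)
pose U1 : 'M[C]_p.+4 := \matrix_(i, j) U0 (tperm i2 ord_max i) j.
have U1U : U1 *m U1^t* = 1%:M.
  apply/matrixP => i j; rewrite !mxE.
  have := congr1 (fun M : 'M[C]_p.+4 => M (tperm i2 ord_max i) (tperm i2 ord_max j)) (unitarymxP U).
  rewrite !mxE (inj_eq perm_inj) => <-.
  by apply: eq_bigr => k _; rewrite !mxE.
pose dd := \det U1.
have dd1 : dd * dd^* = 1.
  have := congr1 determinant U1U; rewrite det_mulmx det1 => <-.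
  by rewrite det_map_mx det_tr.
pose s : 'rV[C]_p.+4 := \row_i (if i == i2 then dd^* else 1).
pose g : 'M[C]_p.+4 := (diag_mx s *m U1)^T.
have gE i j : g i j = s 0 j * U1 j i by rewrite mxE mul_diag_mx mxE.
have i20 : (0 : 'I_p.+4) != i2 by [].
have i21 : (1 : 'I_p.+4) != i2 by [].
have i2m : (ord_max : 'I_p.+4) != i2 by [].
exists g; split.
- rewrite trmx_unitary; apply: unitaryM; last by apply/unitarymxP.
  have sU i : s 0 i * (s 0 i)^* = 1.
    by rewrite mxE; case: ifP => _; rewrite ?conjC1 ?mulr1 // conjCK mulrC.
  by have := unitary_conj_diag (unitary1 R p.+4) sU; rewrite trC1 mul1mx mulmx1.
- rewrite det_tr det_mulmx det_diag -/dd (bigD1 i2) //= big1 => [|k /negPf ki].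
    by rewrite mulr1 mxE eqxx mulrC.
  by rewrite mxE ki.
- have t0 : tperm i2 ord_max 0 = lshift p.+1 (0 : 'I_3).
    by rewrite tpermD //; apply/val_inj.
  by apply/colP => k; rewrite mxE gE [s 0 0]mxE (negPf i20) mul1r [U1 _ _]mxE t0 U0E.
- have t1 : tperm i2 ord_max 1 = lshift p.+1 (1 : 'I_3).
    by rewrite tpermD //; apply/val_inj.
  by apply/colP => k; rewrite mxE gE [s 0 1]mxE (negPf i21) mul1r [U1 _ _]mxE t1 U0E.
by apply/colP => k; rewrite mxE gE [s 0 ord_max]mxE (negPf i2m) mul1r [U1 _ _]mxE tpermR U0E.
Qed.

Section FlagDecomposition.
Variable m : nat.
Hypothesis hm : (1 < m)%N.
Local Notation n := m.+2.
Local Notation o0 := (0 : 'I_n).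
Local Notation o1 := (1 : 'I_n).
Let h2 : (2 < m.+2)%N. Proof. by rewrite !ltnS ltnW. Qed.
Let o2 : 'I_n := Ordinal h2.
Let h3 : (3 < m.+2)%N. Proof. by rewrite !ltnS. Qed.
Let o3 : 'I_n := Ordinal h3.

Lemma sum4 (F : 'I_n -> C) :
  (forall k : 'I_n, (3 < k)%N -> F k = 0) ->
  \sum_k F k = F o0 + F o1 + F o2 + F o3.
Proof.
move=> h; rewrite (bigD1 o0) //= (bigD1 o1) //= (bigD1 o2) //= (bigD1 o3) //=.
rewrite big1 ?addr0 ?addrA // => k /andP[/andP[/andP[k0 k1] k2] k3]; apply: h.
by move: k k0 k1 k2 k3 => [[|[|[|[|k]]]] hk].
Qed.

(** With entries $\pm1$ these are columns of a Hadamard matrix on the first four coordinates: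
    orthogonal to one another, yet in general position for the block decomposition. *)
Definition hada (a b c e : C) : 'cV[C]_n :=
  \col_k (if k == 0 :> nat then a else if k == 1 :> nat then b else
          if k == 2 :> nat then c else if k == 3 :> nat then e else 0).

Lemma mul_hada (Y : 'M[C]_n) a b c e k :
  (Y *m hada a b c e) k 0 = Y k o0 * a + Y k o1 * b + Y k o2 * c + Y k o3 * e.
Proof.
rewrite mxE sum4; first by rewrite !mxE.
by move=> l l3; rewrite mxE; move: l l3 => [[|[|[|[|l]]]] hl] //= _; rewrite mulr0.
Qed.

Lemma hada_mul (Y : 'M[C]_n) a b c e k :
  ((hada a b c e)^T *m Y) 0 k = a * Y o0 k + b * Y o1 k + c * Y o2 k + e * Y o3 k.
Proof.
rewrite mxE sum4; first by rewrite !mxE.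
by move=> l l3; rewrite !mxE; move: l l3 => [[|[|[|[|l]]]] hl] //= _; rewrite mul0r.
Qed.

(** [P], [Q] and [V] record the action of [Y] on the two columns and the row of the flag. Scalars
    belong to both subalgebras, so the first eigenvalue is normalised to 0. The conditions on the
    first two coordinates determine [l11], [l21], [l22], [be], [ga] and [de]; the lower block is
    then fitted to the remaining ones. *)
Lemma flag_decomposition0 (Y : 'M[C]_n) : exists X : 'M[C]_n,
  lower_block X /\
  exists al be ga de,
  [/\ (Y - X) *m hada 1 1 1 1 = al *: hada 1 1 1 1,
      (Y - X) *m hada 1 (-1) 1 (-1) = be *: hada 1 (-1) 1 (-1) + ga *: hada 1 1 1 1
    & (hada 1 1 (-1) (-1))^T *m (Y - X) = de *: (hada 1 1 (-1) (-1))^T].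
Proof.
pose P (k : 'I_n) := Y k o0 + Y k o1 + Y k o2 + Y k o3.
pose Q (k : 'I_n) := Y k o0 - Y k o1 + Y k o2 - Y k o3.
pose V (k : 'I_n) := Y o0 k + Y o1 k - Y o2 k - Y o3 k.
pose l11 := P o0.
pose l22 := (P o1 + V o1 - V o0 + P o0) / 2.
pose l21 := (P o1 - V o1 + V o0 - P o0) / 2.
pose de := (V o1 + V o0 - P o0 - P o1) / 2.
pose ga := (Q o0 + Q o1 + V o1 - V o0) / 2.
pose be := Q o0 - P o0 - ga.
(* The values that [Y - X] must take on the second column of the flag, beyond its first two
   coordinates. *)
pose T (k : nat) := if k == 2 then be + ga else if k == 3 then ga - be else 0.
pose X : 'M[C]_n := \matrix_(k, l)
  (if k == 0 :> nat then (if l == 0 :> nat then l11 else 0) else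
   if k == 1 :> nat then (if l == 0 :> nat then l21 else if l == 1 :> nat then l22 else 0) else
   if (l < 2)%N then 0 else
   if l == 2 :> nat then (P k + Q k - T k) / 2 else
   if l == 3 :> nat then (P k - Q k + T k) / 2 else
   if k == 2 :> nat then - V l else 0).
exists X; split.
  move=> [[|[|k]] hk] [[|[|l]] hl] //=; rewrite mxE //=.
exists 0, be, ga, de; split.
- apply/colP => k; rewrite mul_hada !mxE /=.
  move: k => [[|[|[|[|k]]]] hk] /=; rewrite /T /=.
  + rewrite (_ : Ordinal hk = o0); last exact: val_inj.
    by rewrite /l11 /P; ring.
  + rewrite (_ : Ordinal hk = o1); last exact: val_inj.
    by rewrite /l21 /l22; rewrite /P; field.
  + by rewrite /P; field.
  + by rewrite /P; field.
  by rewrite /P; field.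
- apply/colP => k; rewrite mul_hada !mxE /=.
  move: k => [[|[|[|[|k]]]] hk] /=; rewrite /T /=.
  + rewrite (_ : Ordinal hk = o0); last exact: val_inj.
    by rewrite /be /l11 /P /Q; ring.
  + rewrite (_ : Ordinal hk = o1); last exact: val_inj.
    by rewrite /l21 /l22 /be /ga; rewrite /P /Q; field.
  + by rewrite /P /Q; field.
  + by rewrite /P /Q; field.
  by rewrite /P /Q; field.
apply/rowP => k; rewrite hada_mul !mxE /=.
move: k => [[|[|[|[|k]]]] hk] /=; rewrite /T /=.
+ rewrite (_ : Ordinal hk = o0); last exact: val_inj.
  by rewrite /l11 /l21 /de /V; field.
+ rewrite (_ : Ordinal hk = o1); last exact: val_inj.
  by rewrite /l22 /de /V; field.
+ rewrite (_ : Ordinal hk = o2); last exact: val_inj.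
  by rewrite /de /be /ga /V /P /Q; field.
+ rewrite (_ : Ordinal hk = o3); last exact: val_inj.
  by rewrite /de /be /ga /V /P /Q; field.
by rewrite /V; ring.
Qed.

End FlagDecomposition.

End Frames.

Section Subspaces.
Variable F : fieldType.

(** Irreducibility is stated for row spaces; a subspace given by a predicate is the row space of a
    matrix of maximal rank inside it. *)
Lemma subspace_matrix d (P : 'rV[F]_d -> Prop) :
  P 0 -> (forall c x y, P x -> P y -> P (c *: x + y)) ->
  exists W : 'M[F]_d, forall x, P x <-> (x <= W)%MS.
Proof.
move=> P0 Plin.
pose S (W : 'M[F]_d) := forall x, (x <= W)%MS -> P x.
have S0 : S 0 by move=> x; rewrite submx0 => /eqP ->.
pose rk k := `[< exists2 W, S W & \rank W = k >].
have rk0 : exists k, rk k by exists 0%N; apply/asboolP; exists 0; rewrite ?mxrank0.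
have rkd k : rk k -> (k <= d)%N by move=> /asboolP[W _ <-]; exact: rank_leq_col.
case: (ex_maxnP rk0 rkd) => k /asboolP[W SW Wk] kmax.
exists W => x; split; last exact: SW.
move=> Px; have SxW : S (x + W)%MS.
  move=> y /sub_addsmxP[[a b] ->] /=; rewrite [a]mx11_scalar mul_scalar_mx.
  by apply: Plin => //; apply: SW; exact: submxMl.
have := kmax (\rank (x + W)%MS) (introT (asboolP _) (ex_intro2 _ _ _ SxW erefl)).
rewrite -Wk => le; have /andP[_ h] : (W == x + W)%MS.
  by rewrite -(geq_leqif (mxrank_leqif_eq (addsmxSr x W))).
exact: submx_trans (addsmxSl x W) h.
Qed.

End Subspaces.

Section HighestWeights.
Variable R : realType.
Local Notation C := R[i].

(** The vectors [x] with $L\pi(g)x=0$ for all [g] form an invariant subspace; it contains [w], so it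
    is everything. *)
Lemma irreducible_separate n d (H : set 'M[C]_n) (pi : 'M[C]_n -> 'M[C]_d)
    (w : 'cV[C]_d) (L : 'rV[C]_d) :
  H 1%:M -> (forall g h, H g -> H h -> H (g *m h)) ->
  pi 1%:M = 1%:M -> (forall g h, H g -> H h -> pi (g *m h) = pi g *m pi h) ->
  irreducible_rep H pi -> w != 0 -> (forall g, H g -> L *m pi g *m w = 0) -> L = 0.
Proof.
move=> H1 HM pi1 piM [_ irr] w0 hL.
pose P (x : 'rV[C]_d) := forall g, H g -> L *m pi g *m x^T = 0.
have [||W hW] := @subspace_matrix _ _ P.
- by move=> g _; rewrite trmx0 mulmx0.
- move=> c x y hx hy g hg.
  by rewrite linearP /= mulmxDr -scalemxAr hx // hy // scaler0 addr0.
have Wst g : H g -> stablemx W (pi g)^T.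
  move=> hg; apply/row_subP => i; rewrite row_mul; apply/hW => h hh.
  have /hW/(_ _ (HM _ _ hh hg)) : (row i W <= W)%MS by exact: row_sub.
  by rewrite piM // trmx_mul trmxK !mulmxA.
have Pw : (w^T <= W)%MS by apply/hW => g hg; rewrite trmxK hL.
case: (irr W Wst) => [W0|full].
  by move: Pw; rewrite W0 submx0 -trmx0 (inj_eq trmx_inj) (negPf w0).
apply/rowP => i; have /hW/(_ _ H1) : ((delta_mx i 0 : 'cV[C]_d)^T <= W)%MS.
  exact: submx_full.
by rewrite trmxK pi1 mulmx1 => /matrixP/(_ 0 0); rewrite -colE !mxE.
Qed.

Section Frame.
Variable m : nat.
Hypothesis hm : (1 < m)%N.
Local Notation n := m.+2.
Local Notation hada := (@hada R m).

Lemma hada_dot a b c e a' b' c' e' :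
  (hada a b c e)^t* *m hada a' b' c' e' =
  (a^* * a' + b^* * b' + c^* * c' + e^* * e')%:M.
Proof.
apply/matrixP => i j; rewrite !ord1 mxE (sum4 hm).
  by rewrite !mxE /= mulr1n.
by move=> [[|[|[|[|k]]]] hk] //= _; rewrite !mxE /= mulr0.
Qed.

Lemma hada_frame : exists2 g : 'M[C]_n, SU g &
  [/\ col 0 g = 2^-1 *: hada 1 1 1 1, col 1 g = 2^-1 *: hada 1 (-1) 1 (-1)
    & col ord_max g = 2^-1 *: hada 1 1 (-1) (-1)].
Proof.
have D a b c e a' b' c' e' : (2^-1 *: hada a b c e)^t* *m (2^-1 *: hada a' b' c' e') =
  (2^-1 * 2^-1 * (a^* * a' + b^* * b' + c^* * c' + e^* * e'))%:M.
  rewrite trCZ conj_half -scalemxAl -scalemxAr hada_dot scalerA.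
  by rewrite scale_scalar_mx.
have cN1 : (-1 : C)^* = -1 by rewrite rmorphN rmorph1.
have c1 : (1 : C)^* = 1 by rewrite rmorph1.
have := D; clear D; move: hm; case: m => [|[|p]] // _ D; apply: frame_complete;
  rewrite D ?cN1 ?c1.
1-3: by congr _%:M; field.
all: by rewrite (_ : _ * _ = 0) ?raddf0 //; ring.
Qed.

Lemma frame_flag_stab (g Z : 'M[C]_n) al be ga de : SU g ->
  Z *m col 0 g = al *: col 0 g -> Z *m col 1 g = be *: col 1 g + ga *: col 0 g ->
  (col ord_max g)^t* *m Z = de *: (col ord_max g)^t* ->
  flag_stab (g^t* *m Z *m g).
Proof.
move=> hg h0 h1 hl; have gg := SU_Vmul hg.
have E k l : (g^t* *m Z *m g) k l = ((col k g)^t* *m (Z *m col l g)) 0 0.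
  rewrite -mulmxA !mxE; apply: eq_bigr => i _; rewrite !mxE; congr (_ * _).
  by apply: eq_bigr => s _; rewrite !mxE.
have O k l : ((col k g)^t* *m col l g) 0 0 = (k == l)%:R.
  transitivity ((g^t* *m g) k l); last by rewrite gg mxE.
  by rewrite !mxE; apply: eq_bigr => i _; rewrite !mxE.
have sE (c : C) (M : 'M[C]_1) : (c *: M) 0 0 = c * M 0 0 by rewrite mxE.
have aE (M N : 'M[C]_1) : (M + N) 0 0 = M 0 0 + N 0 0 by rewrite mxE.
split=> k hk; rewrite E.
- by rewrite h0 -scalemxAr sE O (negPf hk) mulr0.
- rewrite h1 mulmxDr -!scalemxAr aE !sE !O.
  by rewrite -!val_eqE /=; case: (k : nat) hk => [|[|?]] //= _; rewrite !mulr0 addr0.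
by rewrite mulmxA hl -scalemxAl sE O eq_sym (negPf hk) mulr0.
Qed.

(* The flag given by the columns of g0 is in general position with respect to
   the complexification of S(B x U(m)): its orbit is open. *)
Lemma flag_decomposition : exists g0 : 'M[C]_n,
  [/\ SU g0, hw_fun 1 0 0 g0 != 0, hw_fun 0 1 0 g0 != 0, hw_fun 0 0 1 g0 != 0
    & forall Y, \tr Y = 0 -> exists X Z,
     [/\ Y = X + Z, \tr X = 0, \tr Z = 0, lower_block X & flag_stab (g0^t* *m Z *m g0)]].
Proof.
have [g hg [c0 c1 cl]] := hada_frame.
have gE k : [/\ g k 0 = 2^-1 * hada 1 1 1 1 k 0, g k 1 = 2^-1 * hada 1 (-1) 1 (-1) k 0
    & g k ord_max = 2^-1 * hada 1 1 (-1) (-1) k 0].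
  have cE (i : 'I_n) (a : C) (u : 'cV[C]_n) : col i g = a *: u -> g k i = a * u k 0.
    by move=> e; transitivity (col i g k 0); [rewrite [RHS]mxE | rewrite e [LHS]mxE].
  by split; apply: cE.
have two0 : (2 : C) != 0 by rewrite pnatr_eq0.
have [g00 g01 g0l] := gE 0; have [g10 g11 g1l] := gE 1.
exists g; split=> //.
- by rewrite /hw_fun expr1 !expr0 !mulr1 g00 mxE mulr1 invr_eq0.
- rewrite /hw_fun expr1 !expr0 mulr1 mul1r /minor2 g00 g01 g10 g11 !mxE /=.
  rewrite (_ : _ - _ = - 2^-1); last by field.
  by rewrite oppr_eq0 invr_eq0.
- by rewrite /hw_fun expr1 !expr0 !mul1r g1l mxE /= mulr1 conj_half invr_eq0.
move=> Y Y0; have [X [bX [al [be [ga [de [h0 h1 hl]]]]]]] := flag_decomposition0 hm Y.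
(* The trace of [X] is removed by a scalar matrix, which lies in both subalgebras and merely shifts
   the eigenvalues by [c]. *)
pose c := \tr X / n%:R.
have n0 : n%:R != 0 :> C by rewrite pnatr_eq0.
have tc : \tr (X - c%:M) = 0.
  by rewrite raddfB /= mxtrace_scalar -mulr_natr mulfVK // subrr.
exists (X - c%:M), (Y - X + c%:M); split=> //.
- by rewrite addrACA [X + _]addrC subrK addNr addr0.
- have -> : Y - X + c%:M = Y - (X - c%:M) by rewrite opprB addrCA [c%:M + _]addrC.
  by rewrite raddfB /= Y0 tc subr0.
- move=> k l kl; rewrite mxE (bX _ _ kl) add0r !mxE.
  have -> : (k == l) = false by apply/negP => /eqP kle; move: kl; rewrite kle eqxx /=;
    case: eqP => // ->.
  by rewrite oppr0.
move: h0 h1 hl; move: (Y - X) => D h0 h1 hl.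
apply: (@frame_flag_stab g _ (al + c) (be + c) ga (de + c)) => //.
- by rewrite c0 mulmxDl mul_scalar_mx -scalemxAr h0 scalerA [2^-1 * _]mulrC -scalerA -scalerDl.
- rewrite c0 c1 mulmxDl mul_scalar_mx -scalemxAr h1.
  move: (hada _ _ _ _) (hada _ _ _ _) => u v.
  by apply/colP => i; rewrite !mxE; ring.
have -> : (col ord_max g)^t* = 2^-1 *: (hada 1 1 (-1) (-1))^T.
  rewrite cl trCZ conj_half; congr (_ *: _).
  apply/rowP => k; rewrite !mxE.
  do ![case: ifP => _]; by rewrite ?rmorphN ?rmorph1 ?rmorph0.
rewrite mulmxDr mul_mx_scalar -scalemxAl hl.
by move: (hada _ _ _ _)^T => u; apply/rowP => i; rewrite !mxE; ring.
Qed.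

End Frame.

End HighestWeights.

(** * Multiplicity one *)

Section MultiplicityOne.
Variable R : realType.
Local Notation C := R[i].
Variables (m d : nat).
Hypothesis hm : (1 < m)%N.
Local Notation n := m.+2.
Variable pi : 'M[C]_n -> 'M[C]_d.
Hypothesis hpi : unitary_rep (@SU R n) pi.
Local Notation D := (dcplx pi).

(* [w] is a highest weight vector for SU(m+2) of weight
   p omega_1 + q omega_2 + r omega_(m+1). *)
Definition hw_vector (p q r : nat) (w : 'cV[C]_d) : Prop :=
  weight_vector pi (p + q) q r w /\
  forall k l : 'I_n, (k < l)%N -> D (delta_mx k l) *m w = 0.

(* [y] is zero or a highest weight vector for S(U(2) x U(m)) of weight
   p omega_1 + q omega_2. *)
Definition khw_vector (p q : nat) (y : 'cV[C]_d) : Prop :=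
  weight_vector pi (p + q) q 0 y /\
  forall k l : 'I_n, k != l -> (k == 0) && (l == 1) || (1 < k)%N && (1 < l)%N ->
    D (delta_mx k l) *m y = 0.

(** The root vectors of [flag_stab] below the diagonal have both indices strictly between 1 and m+1,
    counted from 0. The highest weight is trivial there, so [lowering_vanish] kills them on [w]. *)
Lemma hw_vector_flag p q r w Z : hw_vector p q r w -> \tr Z = 0 -> flag_stab Z ->
  D Z *m w = (Z 0 0 *+ p + (Z 0 0 + Z 1 1) *+ q + (- Z ord_max ord_max) *+ r) *: w.
Proof.
move=> [h1 h2] Z0 [z0 z1 zl].
pose N (k l : 'I_n) := (k < l)%N || [&& (1 < l)%N, (l < k)%N & (k < m.+1)%N].
have := @drep_eigen _ m.+1 d pi D w (wt (p + q) q r) N Z (unitary_rep_drep hpi).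
rewrite /wt !mxE => -> //.
- by congr (_ *: _); rewrite mulrnDl mulrnDr mulNrn; ring.
- by move=> z hz; exact: dcplx_weight.
- move=> k l kl /orP[|/and3P[l1 lk km]]; first exact: h2.
  apply: (lowering_vanish hpi h1); rewrite 1?eq_sym //; last exact: h2.
  have E (s : 'I_n) : (s < 2)%N || (s == m.+1 :> nat) -> (s == k) = false /\ (s == l) = false.
    by move=> h; split; apply/negP => /eqP e; move: h; rewrite e => /orP[h|/eqP h];
      move: l1 lk km; rewrite -?h ?ltnn //; lia.
  have [a1 a2] := E 0 isT; have [b1 b2] := E 1 isT.
  have [c1 c2] : (ord_max == k :> 'I_n) = false /\ (ord_max == l :> 'I_n) = false.
    by apply: E; rewrite /= eqxx orbT.
  by rewrite /wt !mxE a1 a2 b1 b2 c1 c2 !subr0 !mul0rn !addr0 subrr.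
move=> k l kl; rewrite /N negb_or -leqNgt leq_eqVlt eq_sym val_eqE (negPf kl) /= => /andP[lk].
rewrite lk /= negb_and -!leqNgt; case/orP => [l1|km].
  have [l0|l0] := posnP l.
    have -> : l = 0 by exact: val_inj.
    by apply: z0; apply: contraTneq lk => ->.
  have -> : l = 1 by case: (l) l1 l0 => [[|[|s]] hs] //= _ _; exact: val_inj.
  by apply: z1; lia.
have -> : k = ord_max by apply: val_inj => /=; have := ltn_ord k; lia.
by apply: zl; apply: contraTneq lk => ->; rewrite -leqNgt leq_ord.
Qed.

(** [X] passes to the other factor as its adjoint, which is a combination of diagonal matrices and
    of root vectors that kill [y]. *)
Lemma khw_vector_lower p q y X : khw_vector p q y -> \tr X = 0 -> lower_block X ->
  y^t* *m D X = (X 0 0 *+ (p + q) + X 1 1 *+ q) *: y^t*.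
Proof.
move=> [h1 h2] X0 bX.
have -> : y^t* *m D X = (D (X^t*) *m y)^t* by rewrite trCM (dcplx_trC hpi X0) trmxCK.
pose N (k l : 'I_n) := (k == 0) && (l == 1) || (1 < k)%N && (1 < l)%N.
have := @drep_eigen _ m.+1 d pi D y (wt (p + q) q 0) N (X^t*) (unitary_rep_drep hpi).
rewrite /wt !mxE => -> //.
- by rewrite trCZ subr0 rmorphD !rmorphMn /= !conjCK.
- by move=> z hz; exact: dcplx_weight.
- move=> k l kl; rewrite /N negb_or => /andP[h01 h22]; rewrite !mxE bX ?conjC0 //.
  move: kl h01 h22; rewrite -!val_eqE /=.
  by case: k l => [[|[|k]] hk] [[|[|l]] hl].
by rewrite trace_trC X0 conjC0.
Qed.

Section Coef.
Variables (p q r : nat) (hrq : (r <= q)%N) (w : 'cV[C]_d).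
Hypothesis hw : hw_vector p q r w.

(** The coefficient and [hw_fun] have the same characters on both sides. Translating the right-hand
    vectors by [g0] puts the two subalgebras into general position, and [hw_fun] does not vanish at
    [g0], so the ratio of the values there is the constant. *)
Lemma khw_coef y : khw_vector (p + r) (q - r) y ->
  exists c, forall g, SU g -> (y^t* *m pi g *m w) 0 0 = c * hw_fun p q r g.
Proof.
move=> hy; have [g0 [hg0 n1 n2 n3 dec]] := flag_decomposition R hm.
have h0 : hw_fun p q r g0 != 0.
  move: n1 n2 n3; rewrite /hw_fun !expr0 !expr1 !mulr1 !mul1r => n1 n2 n3.
  by rewrite !mulf_neq0 ?expf_neq0.
have [e [rho [drho [L [x [hr hf hL hR]]]]]] := @coef_fun_hw R m p q r.
have hpi' := unitary_rep_drep hpi; have [pi1 piM _ _] := hpi.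
have hgV := SUV hg0.
exists ((y^t* *m pi g0 *m w) 0 0 / hw_fun p q r g0) => g hg.
have := @matrix_coef_unique _ m.+1 d e pi D rho drho hpi' hr (y^t*) (pi g0 *m w) L (rho g0 *m x)
  (@lower_block R m) (fun Z => flag_stab (g0^t* *m Z *m g0)) _
  (fun Z => (fun Z => Z 0 0 *+ p + (Z 0 0 + Z 1 1) *+ q + (- Z ord_max ord_max) *+ r)
     (g0^t* *m Z *m g0)) dec _ _ _ (SUM hg hgV).
have trZ Z : \tr Z = 0 -> \tr (g0^t* *m Z *m g0) = 0.
  by move=> Z0; rewrite mxtrace_mulC mulmxA (SU_mulV hg0) mul1mx.
have ZE Z : Z = g0 *m (g0^t* *m Z *m g0) *m g0^t*.
  by rewrite !mulmxA (SU_mulV hg0) mul1mx -mulmxA (SU_mulV hg0) mulmx1.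
have key d' (rh : 'M[C]_n -> 'M[C]_d') drh (z : 'cV[C]_d') c Z : drep rh drh ->
    \tr Z = 0 -> drh (g0^t* *m Z *m g0) *m z = c *: z ->
    drh Z *m (rh g0 *m z) = c *: (rh g0 *m z).
  move=> hh Z0 hz; have := drep_Ad hh hg0 (trZ Z Z0); rewrite -ZE => e1.
  by rewrite mulmxA -e1 -mulmxA hz -scalemxAr.
move=> /(_ (fun X => X 0 0 *+ p + (X 0 0 + X 1 1) *+ q + (- X 1 1) *+ r)) H.
have {}H := H _ _; move: H.
rewrite -[y^t* *m _ *m (pi g0 *m w)]mulmxA [pi _ *m (pi g0 *m w)]mulmxA.
rewrite -[L *m _ *m (rho g0 *m x)]mulmxA [rho _ *m (rho g0 *m x)]mulmxA.
have gE : g *m g0^t* *m g0 = g by rewrite -mulmxA (SU_Vmul hg0) mulmx1.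
have e1 := piM _ _ (SUM hg hgV) hg0; have e2 := drepM hr (SUM hg hgV) hg0.
rewrite gE in e1; rewrite gE in e2; rewrite -{}e1 -{}e2 !mulmxA -!hf => H.
apply: (mulfI h0); rewrite H.
- by rewrite [RHS]mulrA [hw_fun p q r g0 * (_ / _)]mulrC mulfVK.
- move=> X X0 bX; split; last exact: hL.
  rewrite (khw_vector_lower hy X0 bX); congr (_ *: _).
  rewrite -addnA subnKC // mulrnBr // mulrnDl mulrnDr mulNrn; ring.
by move=> Z Z0 fZ; split; apply: key => //; [exact: hw_vector_flag (trZ _ Z0) fZ | exact: hR].
Qed.

Hypothesis irr : irreducible_rep (@SU R n) pi.
Hypothesis w0 : w != 0.

Lemma hw_separate (L : 'rV[C]_d) : (forall g, SU g -> (L *m pi g *m w) 0 0 = 0) -> L = 0.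
Proof.
have [pi1 piM _ _] := hpi; move=> h.
apply: (irreducible_separate (@SU1 R n) (@SUM R n) pi1 piM irr w0) => g hg.
by apply/matrixP => i j; rewrite !ord1 h // mxE.
Qed.

(** Both vectors have multiples of one function as coefficients against the orbit of [w]; a
    combination of them has coefficient 0 and is therefore 0. *)
Lemma khw_vector_unique y z : khw_vector (p + r) (q - r) y -> khw_vector (p + r) (q - r) z ->
  y != 0 -> exists c, z = c *: y.
Proof.
move=> hy hz y0; have [c1 h1] := khw_coef hy; have [c2 h2] := khw_coef hz.
have sE (c : C) (M : 'M[C]_1) : (c *: M) 0 0 = c * M 0 0 by rewrite mxE.
have bE (M N : 'M[C]_1) : (M - N) 0 0 = M 0 0 - N 0 0 by rewrite !mxE.
have t0 (u : 'cV[C]_d) : u^t* = 0 -> u = 0.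
  by move=> e; rewrite -[u]trmxCK e trmx0 map_mx0.
have c10 : c1 != 0.
  apply: contra_neq y0 => e; apply/t0/hw_separate => g hg.
  by rewrite h1 // e mul0r.
exists ((c2 / c1)^*); apply/eqP; rewrite -subr_eq0; apply/eqP/t0/hw_separate => g hg.
rewrite trCB trCZ conjCK !mulmxBl -!scalemxAl bE sE h1 // h2 //.
by rewrite mulrA mulfVK // subrr.
Qed.

End Coef.
End MultiplicityOne.

(** * Binomial and Pochhammer identities *)

Section Combinatorics.
Variable F : numFieldType.

Lemma pochD (x : F) n k : poch x (n + k) = poch x n * poch (x + n%:R) k.
Proof.
rewrite /poch big_split_ord /=; congr (_ * _); apply: eq_bigr => l _.
by rewrite natrD addrA.
Qed.

Lemma poch_natN (x n : nat) : (n <= x)%N ->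
  poch (- x%:R : F) n = (-1) ^+ n * (x ^_ n)%:R.
Proof.
elim: n => [|n ih] nx; first by rewrite /poch big_ord0 mulr1.
rewrite /poch big_ord_recr /= -/(poch _ n) (ih (ltnW nx)) ffactnSr natrM natrB ?(ltnW nx) //.
by rewrite exprS; ring.
Qed.

Lemma poch_nat_fact (M l : nat) : poch (M.+1%:R : F) l * M`!%:R = (M + l)`!%:R.
Proof.
elim: l => [|l ih]; first by rewrite /poch big_ord0 mul1r addn0.
rewrite /poch big_ord_recr /= -/(poch _ l) addnS factS natrM -ih.
by rewrite mulrAC mulrC -natrD addSn.
Qed.

Lemma poch_nat_neq0 (M l : nat) : poch (M.+1%:R : F) l != 0.
Proof. by apply/prodf_neq0 => i _; rewrite -natrD pnatr_eq0. Qed.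

Lemma fact_neq0 n : n`!%:R != 0 :> F.
Proof. by rewrite pnatr_eq0 -lt0n fact_gt0. Qed.

Lemma ffact_add n k l : (n ^_ (k + l) = n ^_ k * (n - k) ^_ l)%N.
Proof.
by elim: l => [|l ih]; rewrite ?addn0 ?muln1 // addnS !ffactnSr ih mulnA subnDA.
Qed.

Lemma bin_mul_bin n k l : ('C(n, k + l) * 'C(k + l, k) = 'C(n, k) * 'C(n - k, l))%N.
Proof.
apply/eqP; rewrite -(eqn_pmul2r (fact_gt0 k)) -(eqn_pmul2r (fact_gt0 l)); apply/eqP.
have h := bin_fact (leq_addr l k); rewrite addKn in h.
transitivity ('C(n, k + l) * ('C(k + l, k) * (k`! * l`!)))%N; first by rewrite !mulnA.
rewrite h bin_ffact ffact_add -!bin_ffact; lia.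
Qed.

(* Vandermonde's identity, as poch (M + 1 + t) (N - t) is the falling factorial
   of M + N with N - t factors. *)
Lemma poch_vandermonde (M Q N : nat) :
  \sum_(t < N.+1) 'C(N, t)%:R * (Q ^_ t)%:R * poch (M.+1%:R + t%:R) (N - t) =
  poch (M.+1%:R + Q%:R) N :> F.
Proof.
have E t : (t <= N)%N -> poch (M.+1%:R + t%:R : F) (N - t) =
    ('C(M + N, N - t) * (N - t)`!)%:R.
  move=> tN; rewrite -natrD addSn; apply: (mulIf (fact_neq0 (M + t))).
  rewrite poch_nat_fact -natrM bin_ffact; congr (_%:R).
  rewrite -addnA subnKC // -(ffact_fact (_ : N - t <= M + N)%N); last by lia.
  by congr (_ * _`!)%N; lia.
have -> : poch (M.+1%:R + Q%:R : F) N = ('C(Q + (M + N), N) * N`!)%:R.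
  rewrite -natrD addSn; apply: (mulIf (fact_neq0 (M + Q))).
  rewrite poch_nat_fact -natrM bin_ffact; congr (_%:R).
  have <- : (Q + (M + N) = M + Q + N)%N by lia.
  rewrite -(ffact_fact (_ : N <= Q + (M + N))%N); last by lia.
  by rewrite (_ : Q + (M + N) - N = M + Q)%N //; lia.
rewrite -binomial.Vandermonde mulnC natrM natr_sum mulr_sumr; apply: eq_bigr => t _.
have tN : (t <= N)%N by rewrite -ltnS.
rewrite E // -!natrM; congr (_%:R); rewrite -bin_ffact -(bin_fact tN); lia.
Qed.

(** Only $s=d+t$ contributes. After the factors depending on [d] alone are pulled out, the sum over
    [t] is [poch_vandermonde] with [M + d], [q - d] and [i - d]. *)
Lemma coupling_sum (M q i d : nat) : (d <= i)%N -> (i <= q)%N ->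
  \sum_(s < i.+1) 'C(q, s)%:R * 'C(i, s)%:R * 'C(s, d)%:R * (s`!%:R / poch (M.+1%:R) s) =
  'C(i, d)%:R * (q ^_ d)%:R * poch (M.+1%:R + q%:R) (i - d) / poch (M.+1%:R) i :> F.
Proof.
move=> di iq.
have -> : M.+1%:R + q%:R = (M + d).+1%:R + (q - d)%N%:R :> F.
  by rewrite -!natrD; congr (_%:R); lia.
rewrite -poch_vandermonde mulr_sumr mulr_suml.
have -> : i.+1 = (d + (i - d).+1)%N by lia.
rewrite big_split_ord /= big1 ?add0r => [|s _]; last by rewrite (bin_small (ltn_ord s)) mulr0 mul0r.
apply: eq_bigr => t _; have td : (t <= i - d)%N by rewrite -ltnS.
have -> : poch (M.+1%:R : F) i = poch (M.+1%:R) (d + t) * poch (M.+1%:R + (d + t)%N%:R) (i - d - t).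
  by rewrite -pochD; congr (poch _ _); lia.
have -> : (M + d).+1%:R + t%:R = M.+1%:R + (d + t)%N%:R :> F.
  by rewrite -!natrD; congr (_%:R); lia.
have e1 : ('C(q, d + t) * (d + t)`! = q ^_ d * (q - d) ^_ t)%N.
  by rewrite bin_ffact ffact_add.
have e2 := bin_mul_bin i d t.
move/(congr1 (fun n => n%:R : F)): e1; move/(congr1 (fun n => n%:R : F)): e2.
rewrite !natrM => e2 e1.
have p1 := poch_nat_neq0 M (d + t).
have p2 : poch (M.+1%:R + (d + t)%N%:R : F) (i - d - t) != 0 by rewrite -natrD addSn poch_nat_neq0.
rewrite [LHS](_ : _ = ('C(q, d + t)%:R * (d + t)`!%:R) * ('C(i, d + t)%:R * 'C(d + t, d)%:R) /
  poch M.+1%:R (d + t)); last by ring.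
rewrite e1 e2; move: (poch _ _) (poch _ _) p1 p2 => x y p1 p2.
by field; rewrite p1 p2.
Qed.

Lemma coef_binomial (u v : F) N j :
  ((u%:P + v *: 'X) ^+ N)`_j = 'C(N, j)%:R * (u ^+ (N - j) * v ^+ j).
Proof.
rewrite exprDn coef_sum.
under eq_bigr do rewrite exprZn -polyC_exp coefMn mul_polyC scalerA coefZ coefXn.
have [jN|Nj] := leqP j N; last first.
  rewrite bin_small // mul0r big1 // => i _.
  have -> : (j == i) = false by apply/negP => /eqP e; move: (ltn_ord i); rewrite -e ltnS leqNgt Nj.
  by rewrite mulr0 mul0rn.
rewrite (bigD1 (Ordinal (jN : (j < N.+1)%N))) //= eqxx mulr1 big1 ?addr0 ?mulr_natl //.
by move=> i; rewrite -val_eqE /= eq_sym => /negPf ->; rewrite mulr0 mul0rn.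
Qed.

Lemma coef_binomials (x y x' y' : F) n n' k :
  ((x%:P + y *: 'X) ^+ n * (x'%:P + y' *: 'X) ^+ n')`_k =
  \sum_(i < k.+1) 'C(n, i)%:R * 'C(n', k - i)%:R *
    (x ^+ (n - i) * y ^+ i * (x' ^+ (n' - (k - i)) * y' ^+ (k - i))).
Proof.
rewrite coefM; apply: eq_bigr => i _; rewrite !coef_binomial; ring.
Qed.

(** Homogeneity of the coefficient, proved term by term so that [x] and [y] may vanish. *)
Lemma coef_binomials_scale (x y a b a' b' : F) n n' k : (k <= n + n')%N ->
  (((x * a)%:P + (y * b) *: 'X) ^+ n * ((x * a')%:P + (y * b') *: 'X) ^+ n')`_k =
  x ^+ (n + n' - k) * y ^+ k * ((a%:P + b *: 'X) ^+ n * (a'%:P + b' *: 'X) ^+ n')`_k.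
Proof.
move=> kn; rewrite !coef_binomials mulr_sumr; apply: eq_bigr => i _.
have ik : (i <= k)%N by rewrite -ltnS.
have [/bin_small ->|iN] := ltnP n i; first by rewrite !mul0r mulr0.
have [/bin_small ->|iN'] := ltnP n' (k - i); first by rewrite !(mulr0, mul0r).
have -> : (n + n' - k = (n - i) + (n' - (k - i)))%N by lia.
have -> : y ^+ k = y ^+ i * y ^+ (k - i) by rewrite -exprD subnKC.
by rewrite !exprMn exprD; ring.
Qed.

Lemma size_binomials (x y x' y' : F) n n' :
  (size ((x%:P + y *: 'X) ^+ n * (x'%:P + y' *: 'X) ^+ n')%R <= (n + n').+1)%N.
Proof.
have S1 (u v : F) : (size (u%:P + v *: 'X)%R <= 2)%N.
  rewrite (leq_trans (size_polyD _ _)) // geq_max (leq_trans (size_polyC_leq1 _)) //.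
  by rewrite (leq_trans (size_scale_leq _ _)) // size_polyX.
have S (u v : F) N : (size ((u%:P + v *: 'X) ^+ N)%R <= N.+1)%N.
  rewrite (leq_trans (size_poly_exp_leq _ _)) // ltnS -[leqRHS]mul1n leq_mul2r.
  by apply/orP; right; have := S1 u v; case: (size _).
rewrite (leq_trans (size_polyMleq _ _)) //.
by have := S x y n; have := S x' y' n'; lia.
Qed.

(** With $P=c_1+c_2X$ one has $c_1(c_2+c_1X)=c_2P-(c_2^2-c_1^2)X$. Lending $c_1^r$ to the second
    factor and expanding its power gives a sum over [p] of the shape of [q_]. *)
Lemma coef_cross (c1 c2 : F) (a b r k : nat) : (r <= a)%N -> (k <= a)%N ->
  (c1 * c2) ^+ (b + r) * ((c1%:P + c2 *: 'X) ^+ (a - r) * (c2%:P + c1 *: 'X) ^+ r)`_k =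
  c1 ^+ (a + b - k) * \sum_(p < (minn r k).+1) (-1) ^+ p * 'C(r, p)%:R * 'C(a - p, k - p)%:R *
    (c2 ^+ 2 - c1 ^+ 2) ^+ p * c2 ^+ (b + 2 * r + k - 2 * p).
Proof.
move=> ra ka; set P := c1%:P + c2 *: 'X.
have key : c1 *: (c2%:P + c1 *: 'X) = c2 *: P - (c2 ^+ 2 - c1 ^+ 2) *: 'X.
  rewrite /P !scalerDr !scalerA scalerBl -!expr2 opprB addrACA.
  by rewrite -!mul_polyC -!polyCM mulrC; ring.
have -> : (c1 * c2) ^+ (b + r) * (P ^+ (a - r) * (c2%:P + c1 *: 'X) ^+ r)`_k =
    c1 ^+ b * c2 ^+ (b + r) * (P ^+ (a - r) * (c1 *: (c2%:P + c1 *: 'X)) ^+ r)`_k.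
  move: (c2%:P + c1 *: 'X) => S.
  by rewrite -(mul_polyC c1 S) [(_ * S) ^+ r]exprMn -polyC_exp mulrCA coefCM exprMn !exprD; ring.
rewrite key; set e := c2 ^+ 2 - c1 ^+ 2.
have -> : (c2 *: P - e *: 'X) ^+ r =
    \sum_(p < r.+1) ((-1) ^+ p * 'C(r, p)%:R * c2 ^+ (r - p) * e ^+ p)%:P * (P ^+ (r - p) * 'X^p).
  rewrite -scaleNr exprDn; apply: eq_bigr => p _.
  rewrite -mulr_natl -!mul_polyC !exprMn -!polyC_exp [(- e) ^+ p]exprNn !polyCM.
  by rewrite [(_%:R)%:P]rmorph_nat; ring.
rewrite [in LHS]mulr_sumr coef_sum [LHS]mulr_sumr.
rewrite (@big_ord_widen _ _ _ (minn r k).+1 r.+1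
  (fun p => (-1) ^+ p * 'C(r, p)%:R * 'C(a - p, k - p)%:R *
    e ^+ p * c2 ^+ (b + 2 * r + k - 2 * p))); last by rewrite ltnS geq_minl.
rewrite mulr_sumr [RHS]big_mkcond; apply: eq_bigr => p _.
have pr : (p <= r)%N by rewrite -ltnS.
rewrite [P ^+ (a - r) * _]mulrCA coefCM [P ^+ (a - r) * _]mulrA -exprD coefMXn.
rewrite ltnS leq_min pr /= ltnNge.
case: leqP => pk; last by rewrite !mulr0.
rewrite (_ : a - r + (r - p) = a - p)%N; last by lia.
rewrite coef_binomial (_ : a - p - (k - p) = a - k)%N; last by lia.
rewrite (_ : a + b - k = b + (a - k))%N; last by lia.
rewrite (_ : b + 2 * r + k - 2 * p = (b + r) + (r - p) + (k - p))%N; last by lia.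
by rewrite /= !exprD; ring.
Qed.

(** Translates the hypergeometric coefficients of [q_] into those of [coef_cross]; the two differ by
    the factor $\binom ak$. *)
Lemma poch_ratio (a r k p : nat) : (r <= a)%N -> (k <= a)%N -> (p <= minn r k)%N ->
  poch (- r%:R) p * poch (- k%:R) p / (p`!%:R * poch (- a%:R) p) * 'C(a, k)%:R =
  (-1) ^+ p * 'C(r, p)%:R * 'C(a - p, k - p)%:R :> F.
Proof.
rewrite leq_min => ra ka /andP[pr pk].
rewrite (poch_natN pr) (poch_natN pk) (poch_natN (leq_trans pr ra)).
have f0 := fact_neq0 p; have a0 : (a ^_ p)%:R != 0 :> F.
  by rewrite pnatr_eq0 -lt0n ffact_gt0 (leq_trans pr).
have h := bin_mul_bin a p (k - p); rewrite subnKC // in h.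
have s0 : (-1) ^+ p != 0 :> F by rewrite signr_eq0.
have h1 : (k ^_ p)%:R * 'C(a, k)%:R = (a ^_ p)%:R * 'C(a - p, k - p)%:R :> F.
  rewrite -!natrM; congr (_%:R); rewrite -!bin_ffact.
  transitivity ('C(a, k) * 'C(k, p) * p`!)%N; first by lia.
  by rewrite h; lia.
have h2 : (r ^_ p)%:R = 'C(r, p)%:R * p`!%:R :> F by rewrite -natrM bin_ffact.
transitivity ((-1) ^+ p * 'C(r, p)%:R * ((k ^_ p)%:R * 'C(a, k)%:R) / (a ^_ p)%:R : F).
  by rewrite h2; move: f0 a0 s0; move: (_ ^+ p) (p`!%:R) (a ^_ p)%:R => x y z *; field;
    apply/and3P.
by rewrite h1; move: a0; move: (a ^_ p)%:R => z *; field.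
Qed.

(** At nonpositive integers the Pochhammer symbols are signed falling factorials, and the last [d]
    factors of $(m+b+i)_i$ cancel against $(1-m-2i-b)_d$. *)
Lemma coef_ratio (m b i d : nat) : (0 < m)%N -> (d <= i)%N ->
  poch (m + b + i)%:R i / poch m%:R i *
   (poch (- i%:R) d * poch (- i%:R - b%:R) d /
     (d`!%:R * poch (1 - m%:R - (2 * i)%:R - b%:R) d)) =
  (-1) ^+ d * ('C(i, d)%:R * ((b + i) ^_ d)%:R * poch (m%:R + (b + i)%:R) (i - d) / poch m%:R i) :> F.
Proof.
case: m => // m _ di; have -> : - i%:R - b%:R = - (b + i)%:R :> F by rewrite natrD; ring.
have -> : 1 - m.+1%:R - (2 * i)%:R - b%:R = - (m + b + i + i)%:R :> F.
  by rewrite mul2n -addnn -natr1 !natrD; ring.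
rewrite !poch_natN; try lia.
have s0 : (-1) ^+ d != 0 :> F by rewrite signr_eq0.
have f0 := fact_neq0 d; have p0 := poch_nat_neq0 m i.
have -> : (m.+1 + b + i)%:R = m.+1%:R + (b + i)%:R :> F by rewrite -natrD addnA.
have e1 : poch (m.+1%:R + (b + i)%:R : F) i =
    poch (m.+1%:R + (b + i)%:R) (i - d) * ((m + b + i + i) ^_ d)%:R.
  have -> : poch (m.+1%:R + (b + i)%:R : F) i = poch (m.+1%:R + (b + i)%:R) (i - d + d).
    by rewrite subnK.
  rewrite pochD; congr (_ * _); rewrite -!natrD.
  have -> : (m.+1 + (b + i) + (i - d) = (m + (b + i) + (i - d)).+1)%N by lia.
  apply: (mulIf (fact_neq0 (m + (b + i) + (i - d)))); rewrite poch_nat_fact -natrM.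
  have h := @ffact_fact (m + b + i + i) d _; rewrite (_ : m + (b + i) + (i - d) = m + b + i + i - d)%N.
    by rewrite h; [congr (_`!%:R); lia | lia].
  lia.
have g0 : ((m + b + i + i) ^_ d)%:R != 0 :> F by rewrite pnatr_eq0 -lt0n ffact_gt0; lia.
have -> : (i ^_ d)%:R = 'C(i, d)%:R * d`!%:R :> F by rewrite -natrM bin_ffact.
rewrite e1; move: s0 f0 p0 g0; move: (_ ^+ d) (d`!%:R) (poch _ i) ((_ ^_ d)%:R : F).
by move=> x y z w *; field; apply/and4P.
Qed.

(** The coefficient of $Q_r$ in the theorem, for $d=i-r$. *)
Definition coupling (m b i d : nat) : F :=
  poch (m + b + i)%:R i / poch m%:R i *
   (poch (- i%:R) d * poch (- i%:R - b%:R) d /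
     (d`!%:R * poch (1 - m%:R - (2 * i)%:R - b%:R) d)).

(** Expanding $(x-Dy)^s$ and collecting the power $x^d$ leaves a sum over [s] given by
    [coupling_sum] with $q=b+i$; then $r=i-d$. It is applied with $x=g_{11}$, $y=\overline{g_{22}}$
    and $D=\Delta$. *)
Lemma coupling_expand (m b i P : nat) (x y D : F) : (0 < m)%N ->
  x ^+ P * \sum_(s < i.+1) 'C(b + i, s)%:R * 'C(i, s)%:R *
    (s`!%:R / poch m%:R s * (x - D * y) ^+ s) * (D ^+ (b + i - s) * (- y) ^+ (i - s)) =
  (-1) ^+ i * \sum_(r < i.+1) coupling m b i (i - r) *
    (x ^+ (P + (i - r)) * D ^+ (b + r) * y ^+ r).
Proof.
move=> m0; have mE : m = m.-1.+1 by rewrite prednK.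
transitivity (\sum_(d < i.+1) \sum_(s < i.+1)
    'C(b + i, s)%:R * 'C(i, s)%:R * 'C(s, d)%:R * (s`!%:R / poch m%:R s) *
    (x ^+ (P + d) * D ^+ (b + i - d) * (- y) ^+ (i - d)) : F).
  rewrite exchange_big mulr_sumr; apply: eq_bigr => s _ /=.
  have si : (s <= i)%N by rewrite -ltnS.
  have -> : (x - D * y) ^+ s = \sum_(d < i.+1) 'C(s, d)%:R * (x ^+ d * (- (D * y)) ^+ (s - d)).
    rewrite addrC exprDn (big_ord_widen _ (fun d => (- (D * y)) ^+ (s - d) * x ^+ d *+ 'C(s, d)) (si : (s < i.+1)%N)).
    rewrite big_mkcond; apply: eq_bigr => d _; rewrite ltnS.
    by case: leqP => [ds|sd]; [rewrite -mulr_natl mulrA [_ * x ^+ d]mulrC; ring | rewrite bin_small ?mul0r].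
  rewrite !(mulr_sumr, mulr_suml); apply: eq_bigr => d _.
  have [ds|sd] := leqP d s; last by rewrite (bin_small sd); ring.
  rewrite (_ : b + i - d = (s - d) + (b + i - s))%N; last by lia.
  rewrite (_ : i - d = (s - d) + (i - s))%N; last by lia.
  by rewrite -mulrN exprMn !exprD; ring.
under eq_bigr => d _.
  rewrite -mulr_suml {1}mE; rewrite (@coupling_sum m.-1 (b + i) i d) ?leq_addl // -?mE; last by rewrite -ltnS.
over.
rewrite (reindex_inj rev_ord_inj) mulr_sumr; apply: eq_bigr => r _ /=.
rewrite subSS; have ri : (r <= i)%N by rewrite -ltnS.
rewrite /coupling coef_ratio ?leq_subr //.
rewrite (_ : b + i - (i - r) = b + r)%N; last by lia.
have -> : (- y) ^+ (i - (i - r)) = (-1) ^+ i * (-1) ^+ (i - r) * y ^+ r.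
  rewrite subKn // [(- y) ^+ r]exprNn; congr (_ * _).
  have -> : (-1) ^+ i = (-1) ^+ r * (-1) ^+ (i - r) :> F by rewrite -exprD subnKC.
  by rewrite -mulrA -expr2 sqrr_sign mulr1.
ring.
Qed.

End Combinatorics.

(** * Cubature *)

Section Moments.
Variable R : realType.
Local Notation C := R[i].

(** Distinct nodes have an invertible Vandermonde matrix. Only the moments matter, so the weights
    need not be positive. *)
Lemma vandermonde_moments (F : fieldType) N (x : 'I_N -> F) (c : nat -> F) :
  injective x -> exists w : 'I_N -> F,
  forall k, (k < N)%N -> \sum_j w j * x j ^+ k = c k.
Proof.
move=> xinj; pose V := Vandermonde N (\row_j x j).
have Vu : V \in unitmx.
  rewrite unitmxE det_Vandermonde unitfE; apply/prodf_neq0 => i _.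
  apply/prodf_neq0 => k ik; rewrite !mxE subr_eq0 (inj_eq xinj).
  by apply: contraTneq ik => ->; rewrite ltnn.
pose w := invmx V *m \col_k c k.
exists (fun j => w j 0) => k kN.
have := congr1 (fun M : 'cV[F]_N => M (Ordinal kN) 0) (mulKVmx Vu (\col_k c k)).
rewrite -/w [in RHS]mxE /= => <-; rewrite mxE; apply: eq_bigr => j _.
by rewrite !mxE mulrC.
Qed.

(* A finite substitute for averaging over the unit circle. *)
Lemma phase_cubature (L : nat) : exists (I : finType) (w eta : I -> C),
  (forall j, eta j * (eta j)^* = 1) /\
  forall s s', (s <= L)%N -> (s' <= L)%N ->
    \sum_j w j * (eta j ^+ s * (eta j)^* ^+ s') = (s == s')%:R.
Proof.
(* Cayley transforms of integers: distinct points of the unit circle, obtained without angles. *)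
pose den (j : 'I_(L + L).+1) : C := 1 - 'i%C * j%:R.
pose eta j : C := (den j)^* / den j.
have denC j : (den j)^* = 1 + 'i%C * j%:R.
  by rewrite /den rmorphB rmorph1 rmorphM rmorph_nat /= conj_i mulNr opprK.
have den0 j : den j != 0.
  rewrite /den; apply: contra_neq (oner_neq0 C) => e.
  have := congr1 (fun z : C => (z + z^*) / 2) e.
  rewrite -/(den j) denC /den conjC0 addr0 mul0r => <-.
  by field.
have etaU j : eta j * (eta j)^* = 1.
  have c0 : (den j)^* != 0 by rewrite conjC_eq0.
  by rewrite /eta rmorphM fmorphV /= conjCK; field; rewrite den0 c0.
have eta_inj : injective eta.
  move=> j k; rewrite /eta => /eqP; rewrite eqr_div // !denC /den => /eqP e.
  have : 2 * 'i%C * (j%:R - k%:R) = 0 :> C.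
    by rewrite -(subrr ((1 + 'i%C * j%:R) * (1 - 'i%C * k%:R))) {2}e; ring.
  move/eqP; rewrite !mulf_eq0 pnatr_eq0 (negPf (iN0 R)) /= subr_eq0 eqr_nat => /eqP.
  exact: val_inj.
have [w hw] := vandermonde_moments (fun k => (k == L)%:R) eta_inj.
(* The factor [eta j ^+ L] moves the exponents $s-s'$, which range over $[-L,L]$, into the range
   $[0,2L]$ of the prescribed moments. *)
exists 'I_(L + L).+1, (fun j => w j * eta j ^+ L), eta; split=> // s s' sL s'L.
have -> : (s == s')%:R = (s + (L - s') == L)%N%:R :> C by congr (_%:R); lia.
rewrite -hw; last by lia.
apply: eq_bigr => j _; rewrite -mulrA; congr (_ * _).
rewrite exprD mulrCA; congr (_ * _); rewrite -[in eta j ^+ L](subnK s'L) exprD -mulrA.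
by rewrite -exprMn etaU expr1n mulr1.
Qed.

(* The weights integrate polynomials in tau = x^2 of degree at most L against
   the density (M + 1) (1 - tau)^M on [0, 1]. *)
Lemma beta_cubature (M L : nat) : exists (I : finType) (w : I -> C) (x y : I -> R),
  (forall j, x j ^+ 2 + y j ^+ 2 = 1) /\
  forall s q, (s + q <= L)%N ->
    \sum_j w j * ((x j)%:C%C ^+ (s + s) * (y j)%:C%C ^+ (q + q)) =
    (M.+1 * s`! * (M + q)`!)%:R / (M + q + s).+1`!%:R.
Proof.
pose tau (j : 'I_L.+1) : R := j%:R / L.+1%:R.
have L0 : L.+1%:R != 0 :> R by rewrite pnatr_eq0.
have tau0 j : 0 <= tau j by rewrite divr_ge0.
have tau1 j : tau j <= 1.
  by rewrite ler_pdivrMr ?ltr0n // mul1r ler_nat ltnW.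
have tau_inj : injective (fun j => (tau j)%:C%C : C).
  move=> j k /(@complexI R)/(congr1 (fun z => z * L.+1%:R)); rewrite !mulfVK //.
  by move/eqP; rewrite eqr_nat => /eqP/val_inj.
have [w hw] := vandermonde_moments (fun s => (M.+1 * s`! * M`!)%:R / (M + s).+1`!%:R : C) tau_inj.
exists 'I_L.+1, w, (fun j => Num.sqrt (tau j)), (fun j => Num.sqrt (1 - tau j)).
split=> [j|s q]; first by rewrite !sqr_sqrtr ?subr_ge0 // addrC subrK.
have E s' q' : \sum_j w j * ((Num.sqrt (tau j))%:C%C ^+ (s' + s') *
    (Num.sqrt (1 - tau j))%:C%C ^+ (q' + q')) =
    \sum_j w j * ((tau j)%:C%C ^+ s' * (1 - (tau j)%:C%C) ^+ q').
  have sq (x : R) : 0 <= x -> (Num.sqrt x)%:C%C ^+ 2 = x%:C%C.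
    by move=> x0; rewrite -rmorphXn /= sqr_sqrtr.
  have sub0 j : 0 <= 1 - tau j by rewrite subr_ge0.
  apply: eq_bigr => j _; rewrite !addnn -!mul2n !exprM (sq _ (tau0 j)) (sq _ (sub0 j)).
  by rewrite rmorphB.
(* The factor $1-\tau$ is removed by $(1-\tau)^{q+1}=(1-\tau)^q-\tau(1-\tau)^q$. *)
rewrite E; elim: q s => [|q ih] s sq.
  rewrite !addn0 in sq *; rewrite -hw //.
  by apply: eq_bigr => j _; rewrite expr0 mulr1.
have -> : \sum_j w j * ((tau j)%:C%C ^+ s * (1 - (tau j)%:C%C) ^+ q.+1) =
    \sum_j w j * ((tau j)%:C%C ^+ s * (1 - (tau j)%:C%C) ^+ q) -
    \sum_j w j * ((tau j)%:C%C ^+ s.+1 * (1 - (tau j)%:C%C) ^+ q).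
  rewrite -sumrB; apply: eq_bigr => j _; rewrite !exprS.
  by move: (_ ^+ s) (_ ^+ q) => u v; ring.
rewrite !ih; try lia.
rewrite !addnS !addSn !factS !natrM.
have f0 k : k`!%:R != 0 :> C by rewrite pnatr_eq0 -lt0n fact_gt0.
have n0 k : k.+1%:R != 0 :> C by rewrite pnatr_eq0.
move: (f0 (M + q + s)%N) (n0 (M + q + s)%N) (n0 (M + q + s).+1).
move: (_`!%:R) => f; rewrite -!natr1 !natrD => h0 h1 h2.
move: (M%:R : C) (q%:R : C) (s%:R : C) ((M + q)`!%:R : C) (s`!%:R : C) h0 h1 h2 => x y z u v h0 h1 h2.
by field; rewrite h0 h1 h2.
Qed.

(** Averaging over the phase keeps only equal powers of [eta] and its conjugate in the product of
    the two binomial expansions. *)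
Lemma phase_binomial (L : nat) : exists (I : finType) (w eta : I -> C),
  (forall j, eta j * (eta j)^* = 1) /\
  forall q r (x y x' y' : C), (r <= q)%N -> (q <= L)%N ->
    \sum_j w j * ((x * eta j + y) ^+ q * (x' * (eta j)^* + y') ^+ r) =
    \sum_(s < r.+1) 'C(q, s)%:R * 'C(r, s)%:R * ((x * x') ^+ s * (y ^+ (q - s) * y' ^+ (r - s))).
Proof.
have [I [w [eta [etaU hw]]]] := phase_cubature L; exists I, w, eta; split=> //.
move=> q r x y x' y' rq qL.
pose K (i i' : nat) : C := 'C(q, i)%:R * 'C(r, i')%:R *
  (x ^+ i * x' ^+ i' * (y ^+ (q - i) * y' ^+ (r - i'))).
have -> : \sum_j w j * ((x * eta j + y) ^+ q * (x' * (eta j)^* + y') ^+ r) =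
    \sum_(i' < r.+1) \sum_(i < q.+1) K i i' * \sum_j w j * (eta j ^+ i * (eta j)^* ^+ i').
  under [RHS]eq_bigr do under eq_bigr do rewrite mulr_sumr.
  under [RHS]eq_bigr do rewrite exchange_big.
  rewrite [RHS]exchange_big; apply: eq_bigr => j _ /=.
  rewrite [x * _ + y]addrC [x' * _ + y']addrC !exprDn big_distrlr /= [X in _ * X]exchange_big mulr_sumr.
  apply: eq_bigr => i' _; rewrite /= mulr_sumr; apply: eq_bigr => i _.
  rewrite /K -[_ *+ 'C(q, i)]mulr_natl -[_ *+ 'C(r, i')]mulr_natl !exprMn.
  by move: (_ ^+ i) (_ ^+ i) (_ ^+ i') => *; ring.
apply: eq_bigr => s _; have sr : (s <= r)%N by rewrite -ltnS.
have sq := leq_trans sr rq; have sL := leq_trans sq qL.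
rewrite (bigD1 (Ordinal (sq : (s < q.+1)%N))) //= (hw _ _ sL sL) eqxx mulr1 big1 ?addr0.
  by rewrite /K exprMn.
move=> i /negPf; rewrite -val_eqE /= => is0; have iq : (i <= q)%N by rewrite -ltnS.
by rewrite (hw _ _ (leq_trans iq qL) sL) is0 mulr0.
Qed.

Lemma sphere_suspend M (x y : R) (e : C) (v : 'cV[C]_M) :
  e * e^* = 1 -> v^t* *m v = 1%:M -> x ^+ 2 + y ^+ 2 = 1 ->
  let u : 'cV[C]_(1 + M) := col_mx (x%:C%C * e)%:M (y%:C%C *: v) in u^t* *m u = 1%:M.
Proof.
move=> eU vU xy u; rewrite /u tr_col_mx map_row_mx mul_row_col trCZ -scalemxAl -scalemxAr vU.
rewrite tr_scalar_mx map_scalar_mx -scalar_mxM [(y%:C%C)^*]conjc_real scalerA scalemx1.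
rewrite -raddfD /=; congr _%:M.
have -> : (x%:C%C * e)^* = x%:C%C * e^* :> C.
  by transitivity ((x%:C%C)^* * e^*); rewrite ?rmorphM // [(x%:C%C)^*]conjc_real.
rewrite [X in X + _](_ : _ = x%:C%C ^+ 2 * (e * e^*)); last by ring.
by rewrite eU mulr1 -expr2 -!rmorphXn -rmorphD /= xy.
Qed.

Lemma dot_hsplit M (al be : 'rV[C]_(1 + M)) :
  (al *m be^t*) 0 0 =
  lsubmx al 0 0 * (lsubmx be 0 0)^* + (rsubmx al *m (rsubmx be)^t*) 0 0.
Proof.
rewrite -[in LHS](hsubmxK al) -[in LHS](hsubmxK be).
rewrite tr_row_mx map_col_mx mul_row_col mxE; congr (_ + _).
by rewrite mxE big_ord1 !mxE.
Qed.

(* A finite substitute for averaging over the unit sphere: a unit vector of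
   C^(M+2) is (x eta, y xi) with eta a phase, xi a unit vector of C^(M+1) and
   x^2 + y^2 = 1. *)
Lemma sphere_cubature (M L : nat) : exists (I : finType) (c : I -> C) (xi : I -> 'cV[C]_M.+1),
  (forall j, (xi j)^t* *m xi j = 1%:M) /\
  forall l (al be : 'rV[C]_M.+1), (l <= L)%N ->
    \sum_j c j * (((al *m xi j) 0 0) ^+ l * (((be *m xi j) 0 0)^*) ^+ l) =
    l`!%:R / poch (M.+1%:R) l * ((al *m be^t*) 0 0) ^+ l.
Proof.
elim: M => [|M [I1 [c1 [xi1 [xiU hxi]]]]].
  exists 'I_1, (fun=> 1), (fun=> 1%:M); split=> [j|l al be _]; first by rewrite mulmx1 trC1.
  rewrite big_ord1 mul1r !mulmx1 -exprMn.
  have -> : poch (1%:R : C) l = l`!%:R by have := poch_nat_fact C 0 l; rewrite mulr1 add0n.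
  rewrite mulfV ?pnatr_eq0 -?lt0n ?fact_gt0 // mul1r; congr (_ ^+ _).
  by rewrite mxE big_ord1 !mxE.
have [I2 [w2 [eta [etaU hw2]]]] := phase_binomial L.
have [I3 [w3 [x [y [xyU hw3]]]]] := beta_cubature M L.
exists (I1 * (I3 * I2))%type, (fun j => c1 j.1 * (w3 j.2.1 * w2 j.2.2)),
  (fun j => col_mx ((x j.2.1)%:C%C * eta j.2.2)%:M ((y j.2.1)%:C%C *: xi1 j.1) : 'cV_(1 + M.+1)).
split=> [j|l al be lL].
  exact: (sphere_suspend (etaU j.2.2) (xiU j.1) (xyU j.2.1)).
pose a0 : C := (lsubmx (al : 'rV_(1 + M.+1))) 0 0; pose al' := rsubmx (al : 'rV_(1 + M.+1)).
pose b0 : C := (lsubmx (be : 'rV_(1 + M.+1))) 0 0; pose be' := rsubmx (be : 'rV_(1 + M.+1)).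
have split_mul (u : 'rV[C]_(1 + M.+1)) (z : C) t (v : 'cV[C]_M.+1) :
    (u *m col_mx z%:M (t *: v)) 0 0 = lsubmx u 0 0 * z + t * (rsubmx u *m v) 0 0.
  by rewrite -[in LHS](hsubmxK u) mul_row_col mul_mx_scalar -scalemxAr !mxE mulrC.
have dotE : (al *m be^t*) 0 0 = a0 * b0^* + (al' *m be'^t*) 0 0.
  exact: dot_hsplit.
pose A j := (al' *m xi1 j) 0 0; pose B j := (be' *m xi1 j) 0 0.
pose F j1 j3 j2 := c1 j1 * (w3 j3 * w2 j2) *
  ((a0 * (x j3)%:C%C * eta j2 + (y j3)%:C%C * A j1) ^+ l *
   (b0^* * (x j3)%:C%C * (eta j2)^* + (y j3)%:C%C * (B j1)^*) ^+ l).
transitivity (\sum_j1 \sum_j3 \sum_j2 F j1 j3 j2).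
  under [RHS]eq_bigr do rewrite pair_big.
  rewrite pair_big /=; apply: eq_bigr => j _; rewrite /F !split_mul -/a0 -/b0 -/al' -/be'.
  rewrite -/(A j.1) -/(B j.1) rmorphD !rmorphM /= ![(_%:C%C)^*]conjc_real.
  by congr (_ * (_ ^+ _ * _ ^+ _)); rewrite ?mulrA.
pose G s : C := 'C(l, s)%:R * 'C(l, s)%:R * (a0 * b0^*) ^+ s.
transitivity (\sum_(s < l.+1) \sum_j1 \sum_j3 G s *
   (c1 j1 * ((A j1) ^+ (l - s) * ((B j1)^*) ^+ (l - s))) *
   (w3 j3 * ((x j3)%:C%C ^+ (s + s) * (y j3)%:C%C ^+ ((l - s) + (l - s))))).
  rewrite [RHS]exchange_big; apply: eq_bigr => j1 _; rewrite [RHS]exchange_big /=.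
  apply: eq_bigr => j3 _.
  transitivity (c1 j1 * w3 j3 * \sum_j w2 j *
    ((a0 * (x j3)%:C%C * eta j + (y j3)%:C%C * A j1) ^+ l *
    (b0^* * (x j3)%:C%C * (eta j)^* + (y j3)%:C%C * (B j1)^*) ^+ l)).
    by rewrite mulr_sumr; apply: eq_bigr => j _; rewrite /F !mulrA.
  rewrite hw2 // !mulr_sumr; apply: eq_bigr => s _; rewrite /G !exprMn !exprD.
  by move: (_ ^+ s) (_ ^+ s) (_ ^+ s) (_ ^+ (l - s)) (_ ^+ (l - s)) (_ ^+ (l - s)) => *; ring.
(* Compared term by term with the binomial expansion of the inner product: the moments of the
   smaller sphere and those of [x] and [y] turn the squared binomial coefficient into a single
   one. *)
rewrite dotE addrC exprDn mulr_sumr; apply: eq_bigr => s _.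
have sl : (s <= l)%N by rewrite -ltnS.
under eq_bigr do rewrite -mulr_sumr.
rewrite -mulr_suml -mulr_sumr hxi; last by rewrite (leq_trans (leq_subr _ _)).
rewrite hw3; last by rewrite subnKC.
rewrite /G -[_ * _ *+ 'C(l, s)]mulr_natl; move: (nat_of_ord s) sl => t tl.
rewrite -(subnKC tl) addKn; move: (l - t)%N => k {tl lL}.
have f0 n : n`!%:R != 0 :> C by rewrite pnatr_eq0 -lt0n fact_gt0.
have e1 := poch_nat_fact C M k; have e2 := poch_nat_fact C M.+1 (t + k).
have q1 := poch_nat_neq0 C M k; have q2 := poch_nat_neq0 C M.+1 (t + k).
have eC := bin_fact (leq_addr k t); rewrite addKn in eC.
have {eC} <- : 'C(t + k, t)%:R * (t`!%:R * k`!%:R) = (t + k)`!%:R :> C.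
  by rewrite -!natrM eC.
have eM : (M + k + t).+1 = (M.+1 + (t + k))%N by lia.
have eF : (M.+1)`!%:R = M.+1%:R * M`!%:R :> C by rewrite factS natrM.
rewrite eM -e2 eF [(M.+1 * _ * _)%:R]natrM [(M.+1 * _)%:R]natrM -e1.
have nM : M.+1%:R != 0 :> C by rewrite pnatr_eq0.
move: q1 q2 nM (f0 M); move: (poch (M.+1%:R : C) k) (poch (M.+2%:R : C) (t + k)) (M.+1%:R : C) (M`!%:R : C).
move: (t`!%:R : C) (k`!%:R : C) ('C(t + k, t)%:R : C) (_ ^+ t) (_ ^+ k).
move=> tt kk cc z1 z2 p1 p2 u mm q1 q2 nM hM.
by field; rewrite q1 q2 hM nM.
Qed.

End Moments.

(** * The matrix coefficient of the highest weight vector of K *)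

Section Spherical.
Variable R : realType.
Local Notation C := R[i].

(** All Euler iterates of [x] are equal to [x]. *)
Lemma drep_fix n d (rho : 'M[C]_n.+1 -> 'M[C]_d) drho A (x : 'cV[C]_d) :
  drep rho drho -> su A -> drho A *m x = 0 -> rho (expmx A) *m x = x.
Proof.
move=> hr hA hx; have [K hK] := drep_euler x hr hA.
apply/eqP; rewrite -subr_eq0; apply/eqP/nm0_eq0/(@le0_archi _ _ K) => N.
suff e k : iter k (fun y => y + N.+1%:R^-1 *: (drho A *m y)) x = x by have := hK N; rewrite e.
by elim: k => //= k ->; rewrite hx scaler0 addr0.
Qed.

Lemma drep_invariant n d (rho : 'M[C]_n.+1 -> 'M[C]_d) drho A (x : 'cV[C]_d) :
  drep rho drho -> su A -> (forall s : R, rho (expmx (s%:C%C *: A)) *m x = x) ->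
  drho A *m x = 0.
Proof.
move=> hr hA hx; have [[K hK] _] := drep_tangent hr hA.
apply: (@quadratic_eq0 _ _ _ _ (K * nm x)) => s.
have -> : s%:C%C *: (drho A *m x) =
    - ((rho (expmx (s%:C%C *: A)) - 1%:M - s%:C%C *: drho A) *m x).
  by rewrite !mulmxBl hx mul1mx subrr sub0r opprK scalemxAl.
rewrite nmN; apply: le_trans (nmM _ _) _; rewrite mulrAC.
by rewrite ler_wpM2r ?nm_ge0.
Qed.

Lemma expmx_fix n (A : 'M[C]_n.+1) k : su A -> (forall l, A l k = 0) ->
  forall l, expmx A l k = (l == k)%:R.
Proof.
move=> hA hk l.
have := drep_fix (drep_std R n) hA (x := delta_mx k 0) _.
rewrite -!colE => e; have {e} : col k (expmx A) = delta_mx k 0.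
  by apply: e; apply/colP => s; rewrite !mxE hk.
move/colP/(_ l); rewrite [LHS]mxE [RHS]mxE => ->; by rewrite eqxx andbT.
Qed.

Variables (p d : nat).
Local Notation m := p.+2.
Local Notation n := p.+4.
Local Notation o0 := (0 : 'I_n).
Local Notation o1 := (1 : 'I_n).
Local Notation ol := (ord_max : 'I_n).

Lemma col_mulmx k (g h : 'M[C]_n) : col k (g *m h) = g *m col k h.
Proof. by rewrite !colE mulmxA. Qed.

Definition tail_row (k : 'I_n) (g : 'M[C]_n) : 'rV[C]_m := rsubmx (row k g : 'rV_(2 + m)).

Definition tail_col (xi : 'cV[C]_m) : 'cV[C]_n := col_mx (0 : 'cV_2) xi : 'cV_(2 + m).

Lemma mul_tail_col (g : 'M[C]_n) xi k : (g *m tail_col xi) k 0 = (tail_row k g *m xi) 0 0.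
Proof.
have E (u : 'rV[C]_(2 + m)) : u *m col_mx (0 : 'cV_2) xi = rsubmx u *m xi.
  by rewrite -[in LHS](hsubmxK u) mul_row_col mulmx0 add0r.
rewrite /tail_row -E; transitivity ((row k g *m tail_col xi) 0 0); last by [].
by rewrite -row_mul [RHS]mxE.
Qed.

Lemma dot_tail (g h : 'M[C]_n) k l :
  (tail_row k g *m (tail_row l h)^t*) 0 0 =
  (row k g *m (row l h)^t*) 0 0 - g k o0 * (h l o0)^* - g k o1 * (h l o1)^*.
Proof.
have E (u v : 'rV[C]_(2 + m)) : (u *m v^t*) 0 0 =
    u 0 (lshift m 0) * (v 0 (lshift m 0))^* + u 0 (lshift m 1) * (v 0 (lshift m 1))^* +
    (rsubmx u *m (rsubmx v)^t*) 0 0.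
  rewrite mxE big_split_ord /= big_ord_recl big_ord1 !mxE; congr (_ + _ + _).
    by have -> : lift ord0 ord0 = 1 :> 'I_2 by exact: val_inj.
  by apply: eq_bigr => i _; rewrite !mxE.
have := E (row k g) (row l h); rewrite -/(tail_row k g) -/(tail_row l h).
have -> : lshift m (0 : 'I_2) = o0 by exact: val_inj.
have -> : lshift m (1 : 'I_2) = o1 by exact: val_inj.
rewrite ![row _ _ 0 _]mxE; move: ((row k g *m _) 0 0) => x ->; ring.
Qed.

(** The combination of rows vanishes in column 0 and equals the minor in column 1, and the rows of
    [g] are orthonormal. Sphere moments thereby become functions of the upper left block. *)
Lemma SU_tail (g : 'M[C]_n) : SU g ->
  ((g o0 o0 *: tail_row o1 g - g o1 o0 *: tail_row o0 g) *m (tail_row o1 g)^t*) 0 0 =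
  g o0 o0 - minor2 g * (g o1 o1)^*.
Proof.
move=> hg.
have O k l : (row k g *m (row l g)^t*) 0 0 = (k == l)%:R.
  have <- : (g *m g^t*) k l = (k == l)%:R by rewrite (SU_mulV hg) mxE.
  by rewrite !mxE; apply: eq_bigr => i _; rewrite !mxE.
have sE (c : C) (M : 'M[C]_1) : (c *: M) 0 0 = c * M 0 0 by rewrite mxE.
have bE (M N : 'M[C]_1) : (M - N) 0 0 = M 0 0 - N 0 0 by rewrite !mxE.
rewrite mulmxBl -!scalemxAl bE !sE !dot_tail !O /minor2 /=.
by move: (g o0 o0) (g o0 o1) (g o1 o0) (g o1 o1) ((g o1 o0)^*) ((g o1 o1)^*) => *; ring.
Qed.

(** With [frame2] and up to [rsqrt2], an orthonormal basis of the plane of $e_2$ and $\xi$ when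
    [eta] is a phase. *)
Definition frame1 (eta : C) xi : 'cV[C]_n := (delta_mx o1 0 + eta *: tail_col xi).
Definition frame2 (eta : C) xi : 'cV[C]_n := (tail_col xi - eta^* *: delta_mx o1 0).
Definition rsqrt2 : C := (Num.sqrt 2^-1 : R)%:C%C.

Lemma rsqrt2_sqr : rsqrt2 * rsqrt2 = 2^-1.
Proof. by rewrite -expr2 -rmorphXn /= sqr_sqrtr ?invr_ge0 // fmorphV rmorph_nat. Qed.

Lemma rsqrt2_conj : rsqrt2^* = rsqrt2. Proof. exact: conjc_real. Qed.

Lemma rotated_frame N (z e t : 'cV[C]_N) (eta : C) : eta * eta^* = 1 ->
  e^t* *m e = 1%:M -> t^t* *m t = 1%:M -> e^t* *m t = 0 -> t^t* *m e = 0 ->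
  e^t* *m z = 0 -> t^t* *m z = 0 ->
  let y := rsqrt2 *: (e + eta *: t) in let ze := rsqrt2 *: (t - eta^* *: e) in
  [/\ y^t* *m y = 1%:M, ze^t* *m ze = 1%:M, y^t* *m z = 0, ze^t* *m z = 0
    & ze^t* *m y = 0].
Proof.
move=> eU ee tt et te ez tz y ze; rewrite /y /ze !trCZ rsqrt2_conj trCD trCB !trCZ conjCK.
have fin : rsqrt2 *: (rsqrt2 *: (1%:M + 1%:M)) = 1%:M :> 'M[C]_1.
  have half : rsqrt2 * (rsqrt2 * 2) = 1 by rewrite mulrA rsqrt2_sqr mulVf ?pnatr_eq0.
  by rewrite -mulr2n -scaler_nat !scalerA -mulrA half scale1r.
split; rewrite -!scalemxAl -?scalemxAr ?mulmxDl ?mulmxBl ?mulNmx -!scalemxAl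
  ?mulmxDr ?mulmxBr -?scalemxAr ?ee ?tt ?et ?te ?ez ?tz ?scaler0 ?addr0 ?add0r ?subr0 ?sub0r.
- by rewrite scalerA [eta^* * _]mulrC eU scale1r.
- by rewrite !mulmxN -!scalemxAr te ee scaler0 oppr0 addr0 scalerN opprK [eta *: (_ *: _)]scalerA eU scale1r.
- by rewrite scaler0.
- by rewrite oppr0 scaler0.
by rewrite subrr !scaler0.
Qed.

(* The translates by these h of a highest weight vector for SU(m+2) are averaged
   to a vector with the symmetries of a highest weight vector for S(U(2) x U(m)). *)
Lemma spherical_frame eta xi : eta * eta^* = 1 -> xi^t* *m xi = 1%:M ->
  exists2 h : 'M[C]_n, SU h &
  [/\ col 0 h = delta_mx o0 0, col 1 h = rsqrt2 *: frame1 eta xi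
    & col ord_max h = rsqrt2 *: frame2 eta xi].
Proof.
move=> eU xU.
have tdot (v : 'cV[C]_n) k : (delta_mx k 0 : 'cV[C]_n)^t* *m v = (v k 0)%:M.
  have -> : (delta_mx k 0 : 'cV[C]_n)^t* = delta_mx 0 k.
    by apply/matrixP => i j; rewrite !mxE andbC; case: (_ && _); rewrite ?conjC1 ?conjC0.
  by rewrite -rowE; apply/matrixP => i j; rewrite !ord1 [LHS]mxE [RHS]mxE mulr1n.
have ddot k l : (delta_mx k 0 : 'cV[C]_n)^t* *m delta_mx l 0 = (k == l)%:R%:M.
  by rewrite tdot mxE eqxx andbT.
have t0 (k : 'I_n) : (k < 2)%N -> tail_col xi k 0 = 0.
  have E (k' : 'I_(2 + m)) : (k' < 2)%N -> (col_mx (0 : 'cV_2) xi) k' 0 = 0.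
    by move=> h; have -> : k' = lshift m (Ordinal h) by [exact: val_inj]; rewrite col_mxEu mxE.
  exact: E.
have dt (k : 'I_n) : (k < 2)%N -> (delta_mx k 0 : 'cV[C]_n)^t* *m tail_col xi = 0.
  by move=> h; rewrite tdot t0 // raddf0.
have td (k : 'I_n) : (k < 2)%N -> (tail_col xi)^t* *m (delta_mx k 0 : 'cV[C]_n) = 0.
  move=> h; rewrite -[LHS]trmxCK trCM trmxCK.
  by rewrite dt // trmx0 map_mx0.
have tt : (tail_col xi)^t* *m tail_col xi = 1%:M.
  have E : (col_mx (0 : 'cV_2) xi)^t* *m col_mx (0 : 'cV_2) xi = 1%:M :> 'M[C]_1.
    by rewrite tr_col_mx map_row_mx mul_row_col mulmx0 add0r.
  exact: E.
have e00 : (delta_mx o0 0 : 'cV[C]_n)^t* *m delta_mx o0 0 = 1%:M by rewrite ddot eqxx.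
have e11 : (delta_mx o1 0 : 'cV[C]_n)^t* *m delta_mx o1 0 = 1%:M by rewrite ddot eqxx.
have e10 : (delta_mx o1 0 : 'cV[C]_n)^t* *m (delta_mx o0 0 : 'cV[C]_n) = 0 by rewrite ddot /= raddf0.
have [h1 h2 h3 h4 h5] := rotated_frame eU e11 tt (dt o1 isT) (td o1 isT) e10 (td o0 isT).
have [h hh hc] := frame_complete e00 h1 h2 h3 h4 h5.
by exists h.
Qed.

Section Projection.
Variable pi : 'M[C]_n -> 'M[C]_d.
Hypothesis hpi : unitary_rep (@SU R n) pi.
Hypothesis irr : irreducible_rep (@SU R n) pi.
Variables (P q r : nat) (hrq : (r <= q)%N) (w u : 'cV[C]_d).
Hypothesis hw : hw_vector pi P q r w.
Hypothesis w0 : w != 0.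
Hypothesis hu : khw_vector pi (P + r) (q - r) u.
Hypothesis u0 : u != 0.
Local Notation D := (dcplx pi).

(** What averaging leaves of [hw_fun] at [g *m h], with constants dropped; [coupling_expand] brings
    it to the form of the theorem. *)
Definition spherical (g : 'M[C]_n) : C := g o0 o0 ^+ P *
  \sum_(s < r.+1) 'C(q, s)%:R * 'C(r, s)%:R * (s`!%:R / poch m%:R s *
    (g o0 o0 - minor2 g * (g o1 o1)^*) ^+ s) *
    (minor2 g ^+ (q - s) * (- (g o1 o1)^*) ^+ (r - s)).

Lemma minor2_frame (g h : 'M[C]_n) eta xi : 
  col 0 h = delta_mx o0 0 -> col 1 h = rsqrt2 *: frame1 eta xi ->
  minor2 (g *m h) = rsqrt2 *
    (((g o0 o0 *: tail_row o1 g - g o1 o0 *: tail_row o0 g) *m xi) 0 0 * eta + minor2 g).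
Proof.
move=> h0 h1.
have E0 k : (g *m h) k o0 = g k o0.
  transitivity (col 0 (g *m h) k 0); first by rewrite [RHS]mxE.
  by rewrite col_mulmx h0 -colE [LHS]mxE.
have E1 k : (g *m h) k o1 = rsqrt2 * (g k o1 + eta * (tail_row k g *m xi) 0 0).
  transitivity (col 1 (g *m h) k 0); first by rewrite [RHS]mxE.
  rewrite col_mulmx h1 -scalemxAr [LHS]mxE; congr (_ * _).
  by rewrite /frame1 mulmxDr -colE -scalemxAr [LHS]mxE [X in X + _]mxE [X in _ + X]mxE mul_tail_col.
have sE (c : C) (M : 'M[C]_1) : (c *: M) 0 0 = c * M 0 0 by rewrite mxE.
have bE (M N : 'M[C]_1) : (M - N) 0 0 = M 0 0 - N 0 0 by rewrite !mxE.
rewrite /minor2 !E0 !E1 mulmxBl -!scalemxAl bE !sE.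
move: ((tail_row o0 g *m xi) 0 0) ((tail_row o1 g *m xi) 0 0) => x y.
by move: rsqrt2 (g o0 o0) (g o0 o1) (g o1 o0) (g o1 o1) => *; ring.
Qed.

Lemma corner_frame (g h : 'M[C]_n) eta xi : eta * eta^* = 1 ->
  col ord_max h = rsqrt2 *: frame2 eta xi ->
  ((g *m h) o1 ol)^* = rsqrt2 * eta *
    (((tail_row o1 g *m xi) 0 0)^* * eta^* - (g o1 o1)^*).
Proof.
move=> eU hl.
have -> : (g *m h) o1 ol = rsqrt2 * ((tail_row o1 g *m xi) 0 0 - eta^* * g o1 o1).
  transitivity (col ol (g *m h) o1 0); first by rewrite [RHS]mxE.
  rewrite col_mulmx hl -scalemxAr [LHS]mxE; congr (_ * _).
  by rewrite /frame2 mulmxBr -scalemxAr -colE [LHS]mxE mul_tail_col [X in _ + X]mxE [X in - X]mxE [X in _ * X]mxE.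
move: ((tail_row _ _ *m _) 0 0) (g o1 o1) => x y.
rewrite rmorphM rmorphB rmorphM /= conjCK [rsqrt2^*]rsqrt2_conj -mulrA; congr (_ * _).
by rewrite mulrBr mulrCA eU mulr1.
Qed.

Lemma spherical_witness : exists (I : finType) (c : I -> C) (h : I -> 'M[C]_n) (K : C),
  [/\ K != 0, forall j, SU (h j), forall j, col 0 (h j) = delta_mx o0 0
    & forall g, SU g -> (u^t* *m pi g *m \sum_j c j *: (pi (h j) *m w)) 0 0 = K * spherical g].
Proof.
have [k0 hk0] := khw_coef (isT : (1 < m)%N) hpi hrq hw hu.
have t0 (v : 'cV[C]_d) : v^t* = 0 -> v = 0.
  by move=> e; rewrite -[v]trmxCK e trmx0 map_mx0.
have k00 : k0 != 0.
  apply: contra_neq u0 => e; apply/t0/(hw_separate hpi irr w0) => g hg.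
  by rewrite hk0 // e mul0r.
have [I1 [c1 [xi [xiU hxi]]]] := sphere_cubature R p.+1 q.
have [I2 [w2 [eta [etaU hw2]]]] := phase_binomial R q.
have /choice[h hh] : forall j : I1 * I2, exists h : 'M[C]_n, SU h /\
  [/\ col 0 h = delta_mx o0 0, col 1 h = rsqrt2 *: frame1 (eta j.2) (xi j.1)
    & col ord_max h = rsqrt2 *: frame2 (eta j.2) (xi j.1)].
  by move=> j; have [h ? ?] := spherical_frame (etaU j.2) (xiU j.1); exists h.
(* The weight $\bar\eta^r$ cancels the factor $\eta^r$ produced by [corner_frame]; the constant
   collects one [rsqrt2] from each of the [q] minors and [r] corners. *)
exists (I1 * I2)%type, (fun j => c1 j.1 * (w2 j.2 * (eta j.2)^* ^+ r)), h, (k0 * rsqrt2 ^+ (q + r)).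
have r0 : rsqrt2 != 0.
  apply: (contra_neq _ (_ : (2^-1 : C) != 0)); last by rewrite invr_eq0 pnatr_eq0.
  by move=> e; rewrite -rsqrt2_sqr e mul0r.
split=> [|j|j|g hg]; [by rewrite mulf_neq0 ?expf_neq0| by have [] := hh j|by have [_ []] := hh j|].
have [_ piM _ _] := hpi.
pose A j := ((g o0 o0 *: tail_row o1 g - g o1 o0 *: tail_row o0 g) *m xi j) 0 0.
pose B j := ((tail_row o1 g *m xi j) 0 0)^*.
have sE (c : C) (M : 'M[C]_1) : (c *: M) 0 0 = c * M 0 0 by rewrite mxE.
transitivity (\sum_j1 \sum_j2 k0 * rsqrt2 ^+ (q + r) * g o0 o0 ^+ P * (c1 j1 *
  (w2 j2 * ((A j1 * eta j2 + minor2 g) ^+ q * (B j1 * (eta j2)^* + - (g o1 o1)^*) ^+ r)))).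
  rewrite pair_big mulmx_sumr summxE; apply: eq_bigr => j _ /=.
  have [hj [h0 h1 hl]] := hh j.
  rewrite -scalemxAr sE mulmxA -[u^t* *m _ *m _]mulmxA -(piM _ _ hg hj) hk0 //; last exact: SUM.
  rewrite /hw_fun (minor2_frame g h0 h1) (corner_frame g (etaU j.2) hl) -/(A _) -/(B _).
  have -> : (g *m h j) o0 o0 = g o0 o0.
    transitivity (col 0 (g *m h j) o0 0); first by rewrite [RHS]mxE.
    by rewrite col_mulmx h0 -colE [LHS]mxE.
  have e1 : (eta j.2)^* ^+ r * eta j.2 ^+ r = 1 by rewrite -exprMn mulrC etaU expr1n.
  rewrite !exprMn exprD.
  rewrite [LHS](_ : _ = (eta j.2)^* ^+ r * eta j.2 ^+ r * (k0 * (rsqrt2 ^+ q * rsqrt2 ^+ r) *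
    g o0 o0 ^+ P * (c1 j.1 * (w2 j.2 * ((A j.1 * eta j.2 + minor2 g) ^+ q *
     (B j.1 * (eta j.2)^* - (g o1 o1)^*) ^+ r))))); last by ring.
  by rewrite e1 mul1r.
rewrite /spherical mulrA.
under eq_bigr do rewrite -!mulr_sumr hw2 //.
rewrite -mulr_sumr; congr (_ * _); under eq_bigr do rewrite mulr_sumr.
rewrite exchange_big; apply: eq_bigr => s _ /=; have sr : (s <= r)%N by rewrite -ltnS.
rewrite -SU_tail // -hxi; last exact: leq_trans hrq.
rewrite mulr_sumr mulr_suml; apply: eq_bigr => j _.
rewrite -/(A j) -/(B j) exprMn.
by move: (_ ^+ s) (_ ^+ s) (_ ^+ (q - s)) (_ ^+ (r - s)) => *; ring.
Qed.

Lemma khw_separate (v : 'cV[C]_d) :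
  (forall g, SU g -> (u^t* *m pi g *m v) 0 0 = 0) -> v = 0.
Proof.
have [pi1 piM _ _] := hpi; move=> h.
suff v0 : v^t* = 0 by rewrite -[v]trmxCK v0 trmx0 map_mx0.
apply: (irreducible_separate (@SU1 R n) (@SUM R n) pi1 piM irr u0) => g hg.
have e : u^t* *m pi (g^t*) *m v = 0.
  by apply/matrixP => i j; rewrite !ord1 (h _ (SUV hg)) mxE.
have <- : (u^t* *m pi (g^t*) *m v)^t* = v^t* *m pi g *m u.
  by rewrite !trCM trmxCK (rep_trC hpi hg) trmxCK mulmxA.
by rewrite e trmx0 map_mx0.
Qed.

(** As [h] fixes $e_1$, conjugating $E_{12}$ by [h] gives a matrix living in the first row off the
    diagonal. It is strictly upper triangular, so it kills [w]. *)
Lemma dcplx_frame_eq0 (h : 'M[C]_n) : SU h -> col 0 h = delta_mx o0 0 ->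
  D (delta_mx o0 o1) *m (pi h *m w) = 0.
Proof.
move=> hh h0; have hr := unitary_rep_drep hpi; have [hw1 hw2] := hw.
have c0 k : h k o0 = (k == o0)%:R.
  transitivity (col 0 h k 0); first by rewrite [RHS]mxE.
  by rewrite h0 mxE eqxx andbT.
have r0 k : h o0 k = (k == o0)%:R.
  have e : (h^t* *m h) k o0 = (k == o0)%:R by rewrite (SU_Vmul hh) mxE.
  rewrite -[LHS]conjCK -[RHS]conjCK; congr (_^*); rewrite [RHS]rmorph_nat -e mxE.
  rewrite (bigD1 o0) //= big1 => [|i i0]; first by rewrite c0 eqxx mulr1 addr0 !mxE.
  by rewrite c0 (negPf i0) mulr0.
pose X := h^t* *m delta_mx o0 o1 *m h.
have XE k l : X k l = (h o0 k)^* * h o1 l.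
  rewrite /X -mulmxA mxE (bigD1 o0) //= big1 => [|i i0].
    rewrite addr0 !mxE; congr (_ * _); rewrite (bigD1 o1) //= big1 => [|i i1].
      by rewrite mxE !eqxx mul1r addr0.
    by rewrite mxE (negPf i1) andbF mul0r.
  rewrite [X in _ * X]mxE big1 ?mulr0 // => s _.
  by rewrite mxE (negPf i0) mul0r.
have Xd k : X k k = 0.
  rewrite XE r0; case: eqVneq => [->|_]; last by rewrite conjC0 mul0r.
  by rewrite c0 mulr0.
have X0 : \tr X = 0 by rewrite /mxtrace big1.
have Xlow (k l : 'I_n) : k != l -> ~~ (k < l)%N -> X k l = 0.
  move=> kl; rewrite -leqNgt => lk; rewrite XE r0 [(_%:R)^*]rmorph_nat.
  have [k0|/negPf k0] := eqVneq k o0; last by rewrite mul0r.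
  by move: lk kl; rewrite k0 leqn0 => l0; rewrite -val_eqE eq_sym /= l0.
have EX : delta_mx o0 o1 = h *m X *m h^t*.
  by rewrite /X !mulmxA (SU_mulV hh) mul1mx -mulmxA (SU_mulV hh) mulmx1.
rewrite EX mulmxA -(drep_Ad hr hh X0) -mulmxA.
have := @drep_eigen _ n.-1 d pi D w (wt (P + q) q r) (fun k l => (k < l)%N) X hr.
move=> -> //.
- have -> : \row_i X i i = 0 by apply/rowP => i; rewrite [LHS]mxE [RHS]mxE Xd.
  by rewrite /wt !mxE !mul0rn addr0 subr0 scale0r mulmx0.
- by move=> z hz; exact: dcplx_weight.
- by move=> k l _; exact: hw2.
Qed.

(** The minor scales by $t_1t_2$ and $\overline{g_{22}}$ by $t_2^{-1}$, so all summands have the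
    same weight whatever [s] is. *)
Lemma spherical_diag g (t : 'rV[C]_n) : SU (diag_mx t) ->
  spherical (g *m diag_mx t) = wt_char (P + r + (q - r)) (q - r) 0 t * spherical g.
Proof.
move=> ht; have gE k l : (g *m diag_mx t) k l = g k l * t 0 l by rewrite mul_mx_diag mxE.
have tt : t 0 o1 * (t 0 o1)^* = 1.
  have := congr1 (fun M : 'M[C]_n => M o1 o1) (SU_mulV ht).
  by rewrite mul_diag_mx !mxE eqxx mulr1n.
rewrite /spherical /minor2 !gE -addnA subnKC // /wt_char expr0 mulr1 exprMn exprD.
rewrite [LHS](_ : _ = t 0 0 ^+ P * g o0 o0 ^+ P *
   \sum_(s < r.+1) t 0 0 ^+ q * t 0 1 ^+ (q - r) * ('C(q, s)%:R * 'C(r, s)%:R *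
     (s`!%:R / poch m%:R s * (g o0 o0 - minor2 g * (g o1 o1)^*) ^+ s) *
    (minor2 g ^+ (q - s) * (- (g o1 o1)^*) ^+ (r - s)))).
  by rewrite -mulr_sumr /minor2; move: (\sum_(_ < _) _) => S; ring.
rewrite [_ ^+ P * _ ^+ P]mulrC; congr (_ * _); apply: eq_bigr => s _.
have sr : (s <= r)%N by rewrite -ltnS.
rewrite -/(minor2 g) rmorphM /=.
have -> : g 0 0 * t 0 0 * (g 1 1 * t 0 1) - g 0 1 * t 0 1 * (g 1 0 * t 0 0) =
   t 0 0 * t 0 1 * minor2 g by rewrite /minor2; ring.
have -> : g 0 0 * t 0 0 - t 0 0 * t 0 1 * minor2 g * ((g 1 1)^* * (t 0 1)^*) =
   t 0 0 * (g 0 0 - minor2 g * (g 1 1)^*).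
  rewrite [X in _ - X](_ : _ = t 0 0 * (t 0 o1 * (t 0 o1)^*) * (minor2 g * (g 1 1)^*)); last by ring.
  by rewrite tt; ring.
rewrite -[- ((g 1 1)^* * _)]mulNr !exprMn.
have e1 : t 0 o1 ^+ (r - s) * (t 0 o1)^* ^+ (r - s) = 1 by rewrite -exprMn tt expr1n.
have e2 (y : C) : y ^+ (q - s) = y ^+ (q - r) * y ^+ (r - s).
  by rewrite -exprD; congr (_ ^+ _); lia.
have e3 : t 0 0 ^+ q = t 0 0 ^+ s * (t 0 0 ^+ (q - r) * t 0 0 ^+ (r - s)).
  by rewrite -!exprD; congr (_ ^+ _); lia.
rewrite e3 (e2 (t 0 0)) (e2 (t 0 1)); move: e1.
move: ((- (g o1 o1)^*) ^+ _) ((t 0 o1)^* ^+ _) (t 0 o1 ^+ (r - s)) (minor2 g ^+ _) => a b c e e1.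
rewrite [LHS](_ : _ = c * b * (t 0 0 ^+ s * (t 0 0 ^+ (q - r) * t 0 0 ^+ (r - s)) * t 0 1 ^+ (q - r) *
  ('C(q, s)%:R * 'C(r, s)%:R * (s`!%:R / poch m%:R s *
   (g 0 0 - minor2 g * (g 1 1)^*) ^+ s) * (e * a)))); last by ring.
by rewrite e1 mul1r.
Qed.

Lemma spherical_stab g k : SU g -> SU k -> (forall l, k l o0 = (l == o0)%:R) ->
  (forall l, k l o1 = (l == o1)%:R) -> spherical (g *m k) = spherical g.
Proof.
move=> hg hk k0 k1.
have E i j : (forall l, k l j = (l == j)%:R) -> (g *m k) i j = g i j.
  move=> h; rewrite mxE (bigD1 j) //= big1 => [|l lj].
    by rewrite h eqxx mulr1 addr0.
  by rewrite h (negPf lj) mulr0.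
have E0 i := E i o0 k0; have E1 i := E i o1 k1.
by rewrite /spherical /minor2 !E0 !E1.
Qed.

(** The torus weight of the averaged vector [x] and its invariance under SU(m) are read off
    [spherical], while $E_{12}$ kills each translate. By multiplicity one [x] is a multiple of [u],
    and a nonzero one since [spherical] is $(-1)^r$ at 1. *)
Lemma spherical_coef : exists kappa, forall g, SU g ->
  (u^t* *m pi g *m u) 0 0 = kappa * spherical g.
Proof.
have [I [c [h [K [K0 hh h0 hK]]]]] := spherical_witness.
have [pi1 piM _ _] := hpi; have hr := unitary_rep_drep hpi.
pose x := \sum_j c j *: (pi (h j) *m w).
have sE (e : C) (M : 'M[C]_1) : (e *: M) 0 0 = e * M 0 0 by rewrite mxE.
have bE (M N : 'M[C]_1) : (M - N) 0 0 = M 0 0 - N 0 0 by rewrite !mxE.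
have xE g k e : SU g -> SU k -> spherical (g *m k) = e * spherical g ->
    (u^t* *m pi g *m (pi k *m x - e *: x)) 0 0 = 0.
  move=> hg hk es; rewrite mulmxBr -scalemxAr bE sE mulmxA -[u^t* *m _ *m _]mulmxA.
  rewrite -(piM _ _ hg hk) (hK _ hg) (hK _ (SUM hg hk)) es.
  by rewrite mulrCA subrr.
have hx : khw_vector pi (P + r) (q - r) x.
  split=> [t ht|].
    apply/eqP; rewrite -subr_eq0; apply/eqP/khw_separate => g hg.
    by apply: xE => //; exact: spherical_diag.
  have fixA A : su A -> (forall l, A l o0 = 0) -> (forall l, A l o1 = 0) -> D A *m x = 0.
    move=> hA A0 A1; apply: (drep_invariant hr hA) => s.
    have hsA := suZ s hA; have hsE := su_expSU s hA.
    have k0 := expmx_fix hsA (k := o0); have k1 := expmx_fix hsA (k := o1).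
    apply/eqP; rewrite -subr_eq0 -[X in _ - X]scale1r; apply/eqP/khw_separate => g hg.
    apply: xE => //; rewrite mul1r; apply: spherical_stab => //.
      by apply: k0 => l; rewrite mxE A0 mulr0.
    by apply: k1 => l; rewrite mxE A1 mulr0.
  move=> k l kl /orP[/andP[/eqP -> /eqP ->]|/andP[k1 l1]].
    rewrite mulmx_sumr big1 // => j _; rewrite -scalemxAr.
    by rewrite (dcplx_frame_eq0 (hh j) (h0 j)) scaler0.
  have t0 := trace_delta0 R kl.
  have col0 (a b s j : 'I_n) : (1 < a)%N -> (j < 2)%N -> (delta_mx b a : 'M[C]_n) s j = 0.
    move=> a1 j2; rewrite mxE; have -> : (j == a) = false; last by rewrite andbF.
    by apply: contraTF a1 => /eqP <-; rewrite -leqNgt -ltnS.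
  have dtr : (delta_mx k l : 'M[C]_n)^t* = delta_mx l k.
    by apply/matrixP => i j; rewrite !mxE andbC; case: (_ && _); rewrite ?conjC1 ?conjC0.
  have rE : D (re_su (delta_mx k l)) *m x = 0.
    by apply: (fixA _ (re_su_su t0)) => s; rewrite /re_su dtr [LHS]mxE [X in _ * X]mxE
      [X in _ + X]mxE !col0 // subr0 mulr0.
  have iE : D (im_su (delta_mx k l)) *m x = 0.
    by apply: (fixA _ (im_su_su t0)) => s; rewrite /im_su dtr [LHS]mxE [X in _ * X]mxE
      !col0 // addr0 mulr0.
  have [_ tr1] := re_su_su t0; have [_ tr2] := im_su_su t0.
  rewrite -(re_im_su (delta_mx k l)) addrC (drep_linear hr _ tr2 tr1).
  by move: (D _) (D _) iE rE => E F hE hF; rewrite mulmxDl -scalemxAl hE hF scaler0 addr0.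
have [e xu] := khw_vector_unique (isT : (1 < m)%N) hpi hrq hw irr w0 hu hx u0.
have s1 : spherical 1%:M = (-1) ^+ r.
  rewrite /spherical /minor2 !mxE !eqxx /= !mulr1n mulr0 subr0 mulr1 expr1n mul1r.
  rewrite big_ord_recl /= big1 => [|i _].
    rewrite !bin0 !expr0 !mulr1 fact0 /poch big_ord0 divr1 !subn0 expr1n !mul1r.
    by rewrite [(1 : C)^*]conjC1 addr0.
  by rewrite [(1 : C)^*]conjC1 mulr1 subrr expr0n /= !mulr0 mul0r.
have e0 : e != 0.
  have := hK _ (@SU1 R n); rewrite -/x xu s1 -scalemxAr sE.
  by apply: contra_eq_neq => ->; rewrite mul0r eq_sym mulf_neq0 // signr_eq0.
exists (K / e) => g hg.
have := hK _ hg; rewrite -/x xu -scalemxAr sE => h1.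
by apply: (mulfI e0); rewrite h1; move: (spherical g) => z; field.
Qed.

End Projection.

End Spherical.

(** * Explicit elements of the group *)

Section GroupElements.
Variable R : realType.
Local Notation C := R[i].

(** Two block triangular factorisations of the same matrix. *)
Lemma det_sylvester (F : comNzRingType) n k (A : 'M[F]_(n, k)) (B : 'M[F]_(k, n)) :
  \det (1%:M + A *m B) = \det (1%:M + B *m A).
Proof.
have e1 : block_mx 1%:M A (- B) 1%:M = block_mx 1%:M 0 (- B) 1%:M *m block_mx 1%:M A 0 (1%:M + B *m A).
  by rewrite mulmx_block !mul1mx !mul0mx ?mulmx1 ?mulmx0 !addr0 mulNmx addrCA addNr addr0.
have e2 : block_mx 1%:M A (- B) 1%:M = block_mx 1%:M A 0 1%:M *m block_mx (1%:M + A *m B) 0 (- B) 1%:M.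
  by rewrite mulmx_block !mul1mx !mul0mx !mulmx1 ?mulmx0 !add0r mulmxN addrK.
have := congr1 determinant e2; rewrite e1 !det_mulmx !det_ublock !det_lblock !det1.
by rewrite !mulr1 !mul1r.
Qed.

Lemma det_mx22 (F : comNzRingType) (A : 'M[F]_2) :
  \det A = A 0 0 * A 1 1 - A 0 1 * A 1 0.
Proof.
rewrite (expand_det_row A 0) big_ord_recl big_ord1 /cofactor !det_mx11 !mxE /=.
have -> : lift 0 0 = 1 :> 'I_2 by exact: val_inj.
have -> : lift 1 0 = 0 :> 'I_2 by exact: val_inj.
by rewrite addn0 expr0 mul1r expr1 mulN1r mulrN.
Qed.

Section Plane.
Variable n : nat.
Implicit Types k l r s : 'I_n.

Definition plane k l : 'M[C]_(n, 2) := \matrix_(r, c) (r == (if c == 0 then k else l))%:R.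

(** [X] acting on the span of $e_k$ and $e_l$, the identity elsewhere; in this form [det_sylvester]
    gives the determinant. *)
Definition plane_mx k l (X : 'M[C]_2) : 'M[C]_n :=
  1%:M + plane k l *m (X - 1%:M) *m (plane k l)^T.

Lemma plane_mxE k l X r s : plane_mx k l X r s = (r == s)%:R +
  ((r == k)%:R * ((X 0 0 - 1) * (s == k)%:R + X 0 1 * (s == l)%:R) +
   (r == l)%:R * (X 1 0 * (s == k)%:R + (X 1 1 - 1) * (s == l)%:R)).
Proof.
rewrite mxE [in LHS]mxE; congr (_ + _).
rewrite -mulmxA mxE big_ord_recl big_ord1 ![plane k l _ _]mxE /=.
have l1 : lift ord0 ord0 = 1 :> 'I_2 by exact: val_inj.
by congr (_ * _ + _ * _); rewrite mxE big_ord_recl big_ord1 l1 !mxE /= ?mulr0n ?mulr1n ?subr0.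
Qed.

Lemma planeTM k l : k != l -> (plane k l)^T *m plane k l = 1%:M.
Proof.
move=> kl; apply/matrixP => c c'; rewrite !mxE.
under eq_bigr do rewrite !mxE.
have D (x y : 'I_n) : \sum_i (i == x)%:R * (i == y)%:R = (x == y)%:R :> C.
  rewrite (bigD1 x) //= big1 => [|i /negPf ->]; last by rewrite mul0r.
  by rewrite eqxx mul1r addr0.
rewrite D; case: c c' => [[|[|c]] hc] [[|[|c']] hc'] //=; rewrite ?eqxx //.
  by rewrite (negPf kl).
by rewrite eq_sym (negPf kl).
Qed.

Lemma plane_mx_SU k l X : k != l -> SU X -> SU (plane_mx k l X).
Proof.
move=> kl hX; have PP := planeTM kl.
have Pr : (plane k l)^t* = (plane k l)^T.
  by apply/matrixP => i j; rewrite !mxE; exact: rmorph_nat.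
have PT : (plane k l)^T^t* = plane k l by rewrite -Pr trmxCK.
split; last first.
  rewrite /plane_mx -mulmxA det_sylvester -mulmxA PP mulmx1 addrC subrK.
  by case: hX.
apply/unitarymxP; rewrite /plane_mx trCD trC1 !trCM PT Pr trCB trC1 mulmxA.
move: (SU_mulV hX) PP; move: (X^t*) (plane k l) => Y P XY PP.
have EE : (P *m (X - 1%:M) *m P^T) *m (P *m (Y - 1%:M) *m P^T) =
    P *m ((X - 1%:M) *m (Y - 1%:M)) *m P^T.
  by rewrite !mulmxA -[_ *m P^T *m P]mulmxA PP mulmx1.
have : P *m (Y - 1%:M) *m P^T + (P *m (X - 1%:M) *m P^T + P *m ((X - 1%:M) *m (Y - 1%:M)) *m P^T) = 0.
  rewrite -!mulmxDl -!mulmxDr (_ : _ + _ = 0) ?mulmx0 ?mul0mx //.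
  rewrite mulmxBl !mulmxBr XY !mul1mx mulmx1.
  by apply/matrixP => i j; rewrite !mxE; ring.
rewrite -EE; move: (P *m _ *m _) (P *m _ *m _) => E E' e0.
by rewrite mulmxDl mul1mx mulmxDr mulmx1 -addrA e0 addr0.
Qed.

Lemma plane_mxM k l k' l' X Y : k != k' -> k != l' -> l != k' -> l != l' ->
  plane_mx k l X *m plane_mx k' l' Y = plane_mx k l X + plane_mx k' l' Y - 1%:M.
Proof.
move=> h1 h2 h3 h4; have P0 : (plane k l)^T *m plane k' l' = 0.
  apply/matrixP => c c'; rewrite !mxE big1 // => i _; rewrite !mxE.
  have D (x y : 'I_n) : x != y -> (i == x)%:R * (i == y)%:R = 0 :> C.
    by move=> xy; case: eqVneq => [->|]; rewrite ?(negPf xy) ?mulr0 // mul0r.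
  by case: ifP; case: ifP => _ _; exact: D.
rewrite /plane_mx; have : plane k l *m (X - 1%:M) *m (plane k l)^T *m
    (plane k' l' *m (Y - 1%:M) *m (plane k' l')^T) = 0.
  by rewrite !mulmxA -[_ *m (plane k l)^T *m _]mulmxA P0 mulmx0 !mul0mx.
move: (_ *m _ *m _) (plane k' l' *m _ *m _) => E E' e0.
rewrite mulmxDl mul1mx mulmxDr mulmx1 e0 addr0.
by apply/matrixP => i j; rewrite !mxE; ring.
Qed.

End Plane.

Lemma rotation_SU (c s : R) : c ^+ 2 + s ^+ 2 = 1 ->
  SU (\matrix_(i, j) (if i == j then c%:C%C else 'i%C * s%:C%C) : 'M[C]_2).
Proof.
move=> cs; have e : c%:C%C ^+ 2 + s%:C%C ^+ 2 = 1 :> C.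
  by rewrite -!rmorphXn -rmorphD /= cs.
have cC : (c%:C%C : C)^* = c%:C%C by exact: conjc_real.
have sC : (('i%C : C) * s%:C%C)^* = - ('i%C * s%:C%C).
  transitivity (('i%C : C)^* * (s%:C%C)^*); first by rewrite rmorphM.
  by rewrite conj_i [(s%:C%C)^*]conjc_real mulNr.
have i2 := mul_ii R.
split.
  apply/unitarymxP/matrixP => i j; rewrite mxE big_ord_recl big_ord1 !mxE.
  case: i j => [[|[|i]] hi] [[|[|j]] hj] //=; rewrite ?cC ?sC.
  - by rewrite mulrN mulrACA i2 mulN1r opprK -!expr2 e.
  - by rewrite mulrN mulrC addNr.
  - by rewrite mulrN mulrC addrN.
  by rewrite mulrN mulrACA i2 mulN1r opprK -!expr2 addrC e.
by rewrite det_mx22 !mxE /= mulrACA i2 mulN1r opprK -!expr2 e.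
Qed.

Lemma a_tE (m : nat) (t1 t2 : R) : (2 < m)%N ->
  let X t : 'M[C]_2 := \matrix_(i, j) (if i == j then (cos t)%:C%C else 'i%C * (sin t)%:C%C) in
  a_t m t1 t2 = plane_mx 0 ord_max (X t1) *m plane_mx 1 (Ordinal (leqnSn m.+1)) (X t2).
Proof.
move=> hm X; set om := Ordinal _; have m2 : (m == 0)%N = false /\ (m == 1)%N = false.
  by case: m hm @om => [|[|]].
have [m0 m1] := m2; have mS : (m == m.+1) = false by apply/negP => /eqP; lia.
have Sm : (m.+1 == m) = false by apply/negP => /eqP; lia.
have S0 : (m.+1 == 1)%N = false by case: m hm {om m2 mS Sm m0 m1}.
rewrite plane_mxM -?val_eqE //= ?m0 ?m1 ?Sm ?S0 1?eq_sym ?m0 ?m1 ?S0 //.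
apply/matrixP => r s; rewrite [RHS]mxE [X in _ = X + _]mxE [X in _ = _ + X]mxE [X in _ = _ - X]mxE !plane_mxE.
rewrite ![X _ _ _]mxE /= /a_t [LHS]mxE.
have zE (x : 'I_m.+2) : [/\ (x == 0) = (x == 0%N :> nat), (x == 1) = (x == 1%N :> nat),
    (x == ord_max) = (x == m.+1 :> nat) & (x == om) = (x == m :> nat)] by split.
have [-> -> -> ->] := zE r; have [-> -> -> ->] := zE s.
rewrite -val_eqE /=; move: (nat_of_ord r) (nat_of_ord s) => x y.
move: (cos t1)%:C%C ('i%C * (sin t1)%:C%C) (cos t2)%:C%C ('i%C * (sin t2)%:C%C) => c1 s1 c2 s2.
have [->|y0] := eqVneq y 0%N.
  rewrite ![0%N == _]eq_sym /= m0; case: (x == 0%N); case: (x == m.+1) => /=; rewrite ?mulr0n ?mulr1n; ring.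
have [->|yl] := eqVneq y m.+1.
  rewrite S0 Sm; case: (x == 0%N); case: (x == m.+1) => /=; rewrite ?mulr0n ?mulr1n; ring.
have [->|y1] := eqVneq y 1%N.
  rewrite ![1%N == _]eq_sym m1; case: (x == 1%N); case: (x == m) => /=; rewrite ?mulr0n ?mulr1n; ring.
have [->|ym] := eqVneq y m.
  case: (x == 1%N); case: (x == m) => /=; rewrite ?mulr0n ?mulr1n; ring.
case: (x == y); rewrite /= ?mulr0n ?mulr1n; ring.
Qed.

Lemma a_t_SU (m : nat) (t1 t2 : R) : (2 < m)%N -> SU (a_t m t1 t2).
Proof.
move=> hm; rewrite a_tE //; apply: SUM; apply: plane_mx_SU => //.
- exact: rotation_SU (cos2Dsin2 t1).
- by rewrite -val_eqE /=; case: m hm => [|[|]].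
exact: rotation_SU (cos2Dsin2 t2).
Qed.

Lemma mul_a_t (m : nat) (h : 'M[C]_m.+2) (t1 t2 : R) (k : 'I_m.+2) : (2 < m)%N ->
  SU2m h -> (k < 2)%N ->
  (h *m a_t m t1 t2) k 0 = h k 0 * (cos t1)%:C%C /\
  (h *m a_t m t1 t2) k 1 = h k 1 * (cos t2)%:C%C.
Proof.
move=> hm [_ hb] k2.
have m0 : (0 == m)%N = false by case: m hm {h hb k k2}.
have m1 : (1 == m)%N = false by case: m hm {h hb k k2 m0} => [|[|]].
have E s : (h *m a_t m t1 t2) k s = h k 0 * a_t m t1 t2 0 s + h k 1 * a_t m t1 t2 1 s.
  rewrite mxE (bigD1 0) //= (bigD1 1) //= big1 ?addr0 // => l /andP[l0 l1].
  by rewrite hb ?mul0r // k2; case: (l) l0 l1 => [[|[|j]] hj].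
have e1 : (1 == m.+1)%N = false by case: m hm {h hb k k2 m0 m1 E}.
by rewrite !E; split; rewrite ![a_t _ _ _ _ _]mxE /= ?m1 ?m0 ?e1 ?mulr0n ?mulr1n ?addr0 ?add0r ?mulr0 ?addr0 ?add0r.
Qed.

Lemma phase_SU (x y : C) : x * x^* + y * y^* = 1 ->
  SU (\matrix_(i, j) (if j == 0 then (if i == 0 then x else y)
     else (if i == 0 then - y^* else x^*)) : 'M[C]_2).
Proof.
move=> xy; split.
  apply/unitarymxP/matrixP => i j; rewrite mxE big_ord_recl big_ord1 !mxE.
  case: i j => [[|[|i]] hi] [[|[|j]] hj] //=; rewrite ?rmorphN /= ?conjCK -?[RHS]xy; ring.
by rewrite det_mx22 !mxE /= -xy; ring.
Qed.

End GroupElements.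

(** * Restriction to K *)

Section Transfer.
Variable R : realType.
Local Notation C := R[i].

(** The kernel of [L] is stable under each Euler step, hence under the limit. *)
Lemma drep_ker n d k (rho : 'M[C]_n.+1 -> 'M[C]_d) drho A (L : 'M[C]_(k, d)) (B : 'M[C]_k)
    (x : 'cV[C]_d) :
  drep rho drho -> su A -> L *m drho A = B *m L -> L *m x = 0 ->
  L *m (rho (expmx A) *m x) = 0.
Proof.
move=> hr hA hL Lx; have [K hK] := drep_euler x hr hA.
apply/nm0_eq0/(@le0_archi _ _ (nm L * K)) => N.
set T := (fun y : 'cV[C]_d => y + N.+1%:R^-1 *: (drho A *m y)).
have e l : L *m iter l T x = 0.
  by elim: l => //= l ih; rewrite mulmxDr -scalemxAr mulmxA hL -mulmxA ih mulmx0 scaler0 addr0.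
have := hK N; rewrite -/T => h; rewrite -[rho _ *m x](subrK (iter N.+1 T x)) mulmxDr e addr0.
by rewrite -mulrA; apply: le_trans (nmM _ _) _; rewrite ler_wpM2l ?nm_ge0.
Qed.

Definition block_diag m (X : 'M[C]_m.+2) : Prop :=
  forall k l : 'I_m.+2, (k < 2)%N != (l < 2)%N -> X k l = 0.

Lemma expmx_block m (A : 'M[C]_m.+2) : su A -> block_diag A -> SU2m (expmx A).
Proof.
move=> hA bA; have [_ _ _] := expmx_su hA.
have hS : SU (expmx A) by have := su_expSU 1 hA; rewrite scale1r.
split=> // k l kl.
(* The projection onto the block that contains [k]: it commutes with [A] and kills the basis vector
   of index [l]. *)
pose J : 'M[C]_m.+2 := diag_mx (\row_i ((i < 2)%N == (k < 2)%N)%:R).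
have JA : J *m A = A *m J.
  apply/matrixP => r s; rewrite mul_diag_mx mul_mx_diag !mxE.
  have [e|/bA ->] := eqVneq (r < 2)%N (s < 2)%N; first by rewrite e mulrC.
  by rewrite mulr0 mul0r.
have Jl : J *m (delta_mx l 0 : 'cV[C]_m.+2) = 0.
  apply/colP => s; rewrite mul_diag_mx !mxE; have [->|_] := eqVneq s l; last by rewrite mulr0.
  by rewrite eq_sym (negPf kl) mul0r.
have := drep_ker (drep_std R m.+1) hA JA Jl.
move/colP/(_ k); rewrite mul_diag_mx -colE !mxE eqxx mul1r.
by [].
Qed.

Lemma SU2m1 m : SU2m (1%:M : 'M[C]_m.+2).
Proof.
split; first exact: SU1.
by move=> k l kl; rewrite mxE; have [e|] := eqVneq k l; rewrite // e eqxx in kl.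
Qed.

Lemma SU2mM m (g h : 'M[C]_m.+2) : SU2m g -> SU2m h -> SU2m (g *m h).
Proof.
move=> [hg bg] [hh bh]; split; first exact: SUM.
move=> k l kl; rewrite mxE big1 // => s _.
have [e|ks] := eqVneq (k < 2)%N (s < 2)%N; last by rewrite bg ?mul0r.
by rewrite bh ?mulr0 // -e.
Qed.

Lemma SU2mV m (g : 'M[C]_m.+2) : SU2m g -> SU2m (g^t*).
Proof.
move=> [hg bg]; split; first exact: SUV.
by move=> k l kl; rewrite !mxE bg ?conjC0 // eq_sym.
Qed.

Variables (m dK dG : nat).
Variables (piK : 'M[C]_m.+2 -> 'M[C]_dK) (piG : 'M[C]_m.+2 -> 'M[C]_dG) (j : 'M[C]_(dG, dK)).
Hypothesis hpi : unitary_rep (@SU R m.+2) piG.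
Hypothesis hj : intertwiner (@SU2m R m) piK piG j.
Hypothesis hj1 : j^t* *m j = 1%:M.

Lemma piK_coef g : SU2m g -> piK g = j^t* *m piG g *m j.
Proof. by move=> hg; rewrite -mulmxA (hj hg) mulmxA hj1 mul1mx. Qed.

(** On K, [piK] is the compression of [piG] by [j], so its derivative is computed from that of
    [piG]. As the image of [j] is stable under K, the component outside it, cut out by [Q], vanishes
    to first order. *)
Lemma dreal_transfer A : su A -> block_diag A -> dreal piG A *m j = j *m dreal piK A.
Proof.
move=> hA bA; have [[K hK] _] := dreal_tangent hpi hA.
have hE s : SU2m (expmx (s%:C%C *: A)).
  apply: expmx_block; first exact: suZ.
  by move=> k l kl; rewrite mxE bA ?mulr0.
have -> : dreal piK A = j^t* *m dreal piG A *m j.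
  apply: (@dreal_eq _ _ _ _ _ _ (nm (j^t*) * K * nm j)) => s _.
  rewrite (piK_coef (hE s)) -hj1.
  rewrite (_ : _ - _ - _ = j^t* *m (piG (expmx (s%:C%C *: A)) - 1%:M - s%:C%C *: dreal piG A) *m j).
    apply: le_trans (nmM _ _) _; rewrite mulrAC ler_wpM2r ?nm_ge0 //.
    by apply: le_trans (nmM _ _) _; rewrite -mulrA ler_wpM2l ?nm_ge0.
  move: (piG _) (dreal piG A) => P Y.
  by rewrite 2!mulmxBr 2!mulmxBl mulmx1 -scalemxAr -scalemxAl.
apply/eqP; rewrite -subr_eq0; apply/eqP.
pose Q := 1%:M - j *m j^t*.
have Qj : Q *m j = 0 by rewrite /Q mulmxBl mul1mx -mulmxA hj1 mulmx1 subrr.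
have -> : dreal piG A *m j - j *m (j^t* *m dreal piG A *m j) = Q *m dreal piG A *m j.
  by rewrite /Q mulmxBl mul1mx mulmxBl !mulmxA.
apply: (@quadratic_eq0 _ _ _ _ (nm Q * K * nm j)) => s.
have -> : s%:C%C *: (Q *m dreal piG A *m j) =
    - (Q *m (piG (expmx (s%:C%C *: A)) - 1%:M - s%:C%C *: dreal piG A) *m j).
  have QP : Q *m piG (expmx (s%:C%C *: A)) *m j = 0 by rewrite -mulmxA (hj (hE s)) mulmxA Qj mul0mx.
  move: (piG _) (dreal piG A) QP => P Y QP; clearbody Q.
  rewrite 2!mulmxBr 2!mulmxBl mulmx1 Qj QP -scalemxAr -scalemxAl.
  by rewrite subrr sub0r opprK.
rewrite nmN mulrAC; apply: le_trans (nmM _ _) _; rewrite ler_wpM2r ?nm_ge0 //.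
by apply: le_trans (nmM _ _) _; rewrite -mulrA ler_wpM2l ?nm_ge0.
Qed.

Lemma dcplx_transfer X : \tr X = 0 -> block_diag X -> dcplx piG X *m j = j *m dcplx piK X.
Proof.
move=> X0 bX.
have bC : block_diag (X^t*) by move=> k l kl; rewrite !mxE bX ?conjC0 // eq_sym.
have h1 := dreal_transfer (re_su_su X0); have h2 := dreal_transfer (im_su_su X0).
have {}h1 : dreal piG (re_su X) *m j = j *m dreal piK (re_su X).
  by apply: h1 => k l kl; rewrite /re_su mxE [X in _ * X]mxE [X in _ + X]mxE bX // bC // subr0 mulr0.
have {}h2 : dreal piG (im_su X) *m j = j *m dreal piK (im_su X).
  by apply: h2 => k l kl; rewrite /im_su mxE [X in _ * X]mxE bX // bC // addr0 mulr0.
rewrite !dcplxE; move: h1 h2; move: (dreal _ _) (dreal _ _) (dreal _ _) (dreal _ _) => a b c e h1 h2.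
by rewrite mulmxDl mulmxDr -scalemxAl -scalemxAr h1 h2.
Qed.

End Transfer.

(** * Characters, rotations in SU(2) and values of the coefficients *)

Section Characters.
Variable R : realType.
Local Notation C := R[i].

Lemma SU_diag_mx n (t : 'rV[C]_n) : (forall l, t 0 l * (t 0 l)^* = 1) -> \prod_l t 0 l = 1 ->
  SU (diag_mx t).
Proof.
move=> tt t1; split; last by rewrite det_diag.
by have := unitary_conj_diag (unitary1 R n) tt; rewrite trC1 mul1mx mulmx1.
Qed.

Lemma SU_diag_entries n (t : 'rV[C]_n) : SU (diag_mx t) ->
  (forall l, t 0 l * (t 0 l)^* = 1) /\ \prod_l t 0 l = 1.
Proof.
move=> [h h1]; split; last by rewrite -det_diag.
move=> l; have := congr1 (fun M : 'M[C]_n => M l l) (SU_mulV (conj h h1)).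
by rewrite mul_diag_mx !mxE eqxx mulr1n.
Qed.

Lemma prod_expr_delta (N : nat) (x : 'I_N -> C) (a : nat) (k : 'I_N) :
  \prod_i x i ^+ (a * (i == k)) = x k ^+ a.
Proof.
rewrite (bigD1 k) //= eqxx muln1 big1 ?mulr1 // => i /negPf ->.
by rewrite muln0 expr0.
Qed.

(** For determinant 1 the last fundamental weight is the inverse, hence the conjugate, of the last
    coordinate; $\omega_2$ involves both of the first two coordinates, whence [a + b]. *)
Lemma wchar_wt (m a b c : nat) (t : 'rV[C]_m.+3) : SU (diag_mx t) ->
  wchar (omega m.+2 1 *+ a + omega m.+2 2 *+ b + omega m.+2 m.+2 *+ c) t =
  wt_char (a + b) b c t.
Proof.
move=> /SU_diag_entries[tt t1]; rewrite /wchar.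
pose x (i : 'I_m.+2) := \prod_(l < m.+3 | (l <= i)%N) t 0 l.
pose k1 : 'I_m.+2 := 1.
transitivity ((\prod_i x i ^+ (a * (i == 0))) * (\prod_i x i ^+ (b * (i == k1))) *
    (\prod_i x i ^+ (c * (i == ord_max)))).
  rewrite -!big_split /=; apply: eq_bigr => i _; rewrite -/(x i) -!exprD.
  rewrite [RHS]exprnP; congr (exprz _ _).
  have N (e : bool) (k : nat) : (e%:R *+ k : int) = (k * e)%N%:Z.
    by rewrite -mulrnA natz mulnC.
  by rewrite !mxE !mulmxnE !mxE !eqSS !N -!PoszD -!val_eqE.
rewrite !prod_expr_delta /wt_char.
have -> : x 0 = t 0 0.
  rewrite /x (bigD1 0) //= big1 ?mulr1 // => l /andP[l0 /negPf ln].
  by case: l l0 ln => [[|l] hl].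
have -> : x k1 = t 0 0 * t 0 1.
  rewrite /x (bigD1 0) //= (bigD1 1) //= big1 ?mulr1 // => l /andP[/andP[l2 l0] l1].
  by case: l l2 l0 l1 => [[|[|l]] hl].
have -> : x ord_max = (t 0 ord_max)^*.
  have : x ord_max * t 0 ord_max = 1.
    rewrite -t1 [in RHS](bigD1 ord_max) //= mulrC; congr (_ * _); apply: eq_bigl => l.
    by rewrite -val_eqE /= neq_ltn; have := ltn_ord l; lia.
  move=> e; rewrite -[LHS]mulr1 -(tt ord_max) mulrA e mul1r //.
by rewrite exprMn exprD; ring.
Qed.

Lemma SU2m_rows m (h : 'M[C]_m.+2) (k l : 'I_m.+2) : SU2m h -> (k < 2)%N ->
  h k 0 * (h l 0)^* + h k 1 * (h l 1)^* = (k == l)%:R.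
Proof.
move=> [hh hb] k2.
have <- : (h *m h^t*) k l = (k == l)%:R by rewrite (SU_mulV hh) mxE.
rewrite mxE (bigD1 0) //= (bigD1 1) //= big1 ?addr0 => [|s /andP[s0 s1]].
  by rewrite !mxE.
by rewrite hb ?mul0r // k2; case: (s) s0 s1 => [[|[|?]] ?].
Qed.

(** Cramer's rule for the unitary upper left block. It eliminates conjugates on K. *)
Lemma SU2m_minor m (h : 'M[C]_m.+2) : SU2m h ->
  minor2 h * (h 1 1)^* = h 0 0 /\ minor2 h * (h 1 0)^* = - h 0 1.
Proof.
move=> hh; have e0 := @SU2m_rows m h 0 1 hh isT; have e1 := @SU2m_rows m h 1 1 hh isT.
rewrite eqxx /= in e1; rewrite /= in e0; rewrite /minor2; move: e0 e1.
move: (h 0 0) (h 0 1) (h 1 0) (h 1 1) ((h 1 0)^*) ((h 1 1)^*) => x y z w z' w' e0 e1; split.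
  rewrite [LHS](_ : _ = x * (z * z' + w * w') - z * (x * z' + y * w')); last by ring.
  by rewrite e0 e1; ring.
rewrite [LHS](_ : _ = w * (x * z' + y * w') - y * (z * z' + w * w')); last by ring.
by rewrite e0 e1; ring.
Qed.

Lemma SU2m_mul m (g h : 'M[C]_m.+2) (k l : 'I_m.+2) : SU2m g -> (k < 2)%N ->
  (g *m h) k l = g k 0 * h 0 l + g k 1 * h 1 l.
Proof.
move=> [_ gb] k2; rewrite mxE (bigD1 0) //= (bigD1 1) //= big1 ?addr0 // => s /andP[s0 s1].
by rewrite gb ?mul0r // k2; case: (s) s0 s1 => [[|[|?]] ?].
Qed.

Lemma minor2M m (g h : 'M[C]_m.+2) : SU2m g -> minor2 (g *m h) = minor2 g * minor2 h.
Proof.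
move=> hg; rewrite /minor2 !(SU2m_mul _ _ hg) //.
by move: (g 0 0) (g 0 1) (g 1 0) (g 1 1) (h 0 0) (h 0 1) (h 1 0) (h 1 1) => *; ring.
Qed.

Definition rot2 (al : R) (x : nat) : 'M[C]_2 := \matrix_(i, j)
  (if j == 0 then (if i == 0 then al%:C%C else al%:C%C * x%:R)
   else (if i == 0 then - (al%:C%C * x%:R) else al%:C%C)).

(** The cosine of the angle with tangent [x]; integral tangents are the interpolation nodes of
    [Zv]. *)
Definition cosn (x : nat) : R := (Num.sqrt (1 + x%:R ^+ 2))^-1.

Lemma cosn_gt0 x : 0 < cosn x.
Proof. by rewrite invr_gt0 sqrtr_gt0 ltr_pwDl // exprn_ge0. Qed.

Lemma cosn_sqr x : (cosn x)%:C%C ^+ 2 * (1 + x%:R ^+ 2) = 1 :> C.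
Proof.
have h : 0 <= 1 + x%:R ^+ 2 :> R by rewrite addr_ge0 // exprn_ge0.
have e : cosn x ^+ 2 * (1 + x%:R ^+ 2) = 1.
  by rewrite exprVn sqr_sqrtr // mulVf // gt_eqF // ltr_pwDl // exprn_ge0.
have := congr1 (fun z => z%:C%C : C) e.
by rewrite rmorphM rmorphD !rmorphXn rmorph1 rmorph_nat.
Qed.

Definition rotn m (x : nat) : 'M[C]_m.+2 := plane_mx 0 1 (rot2 (cosn x) x).

Lemma rot2_SU x : SU (rot2 (cosn x) x).
Proof.
have cC : ((cosn x)%:C%C : C)^* = (cosn x)%:C%C by exact: conjc_real.
have nC : (x%:R : C)^* = x%:R by exact: rmorph_nat.
have pC : ((cosn x)%:C%C * x%:R : C)^* = (cosn x)%:C%C * x%:R.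
  by transitivity (((cosn x)%:C%C)^* * (x%:R)^* : C); [rewrite rmorphM | rewrite cC nC].
have := @phase_SU R (cosn x)%:C%C ((cosn x)%:C%C * x%:R).
rewrite cC pC; apply.
by rewrite -[RHS](cosn_sqr x); ring.
Qed.

Lemma rotn_SU m x : SU (rotn m x).
Proof. by apply: plane_mx_SU => //; exact: rot2_SU. Qed.

Lemma rotn_SU2m m x : SU2m (rotn m x).
Proof.
split; first exact: rotn_SU.
move=> k l kl; rewrite /rotn plane_mxE.
have -> : (k == l) = false by apply/negP => /eqP e; rewrite e eqxx in kl.
move: kl; rewrite -!val_eqE /=; case: k l => [[|[|k]] hk] [[|[|l]] hl] //= _;
  by rewrite ?mulr0 ?mul0r ?addr0 ?mulr0 ?addr0.
Qed.

Lemma mul_rotn m (g : 'M[C]_m.+2) x k :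
  (g *m rotn m x) k 0 = (cosn x)%:C%C * (g k 0 + g k 1 * x%:R) /\
  (g *m rotn m x) k 1 = (cosn x)%:C%C * (g k 1 - g k 0 * x%:R).
Proof.
have E (s : 'I_m.+2) : (s < 2)%N -> (g *m rotn m x) k s = g k 0 * rotn m x 0 s + g k 1 * rotn m x 1 s.
  move=> s2; rewrite mxE (bigD1 0) //= (bigD1 1) //= big1 ?addr0 // => l /andP[l0 l1].
  have [_ rb] := rotn_SU2m m x; rewrite rb ?mulr0 // s2.
  by case: (l) l0 l1 => [[|[|?]] ?].
by rewrite !E // /rotn !plane_mxE /rot2 !mxE /=; split; ring.
Qed.

Lemma minor2_rotn m (g : 'M[C]_m.+2) x : minor2 (g *m rotn m x) = minor2 g.
Proof.
have [a0 a1] := mul_rotn g x 0; have [b0 b1] := mul_rotn g x 1.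
rewrite /minor2 a0 a1 b0 b1.
rewrite [LHS](_ : _ = (cosn x)%:C%C ^+ 2 * (1 + x%:R ^+ 2) * minor2 g); last by rewrite /minor2; ring.
by rewrite cosn_sqr mul1r.
Qed.

Lemma a_t0 m : (2 < m)%N -> a_t m 0 0 = 1%:M :> 'M[C]_m.+2.
Proof.
move=> hm; rewrite a_tE //= cos0 sin0.
rewrite (_ : \matrix_(i, j) _ = 1%:M) /plane_mx ?subrr ?mulmx0 ?mul0mx ?addr0 ?mulmx1 //.
by apply/matrixP => i j; rewrite !mxE rmorph0 mulr0; case: (_ == _).
Qed.

(** Presents [q_] as a coefficient of a generating polynomial, the form in which the coefficient
    function at $h\,a_{\mathbf t}\,k'$ produces it. *)
Lemma q_coef a b r k (t1 t2 : R) : (r <= a)%N -> (k <= a)%N ->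
  let c1 := (cos t1)%:C%C in let c2 := (cos t2)%:C%C in
  (c1 * c2) ^+ (b + r) * ((c1%:P + c2 *: 'X) ^+ (a - r) * (c2%:P + c1 *: 'X) ^+ r)`_k =
  'C(a, k)%:R * (q_ a b r k t1 t2)%:C%C :> C.
Proof.
move=> ra ka c1 c2; rewrite (coef_cross _ _ _ ra ka) /q_.
rewrite -[_%:R](rmorph_nat (@real_complex R)) -rmorphM /= mulrCA.
rewrite [RHS]rmorphM rmorphXn /=; congr (_ * _).
rewrite [in RHS]mulr_sumr [RHS]rmorph_sum.
apply: eq_bigr => p _; have pk : (p <= minn r k)%N by rewrite -ltnS.
have := poch_ratio R ra ka pk; set pr := _ / _ => h.
have -> : (-1) ^+ p * 'C(r, p)%:R * 'C(a - p, k - p)%:R = (pr * 'C(a, k)%:R)%:C%C :> C.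
  by rewrite h !rmorphM rmorphXn rmorphN rmorph1 !rmorph_nat.
rewrite /c1 /c2 -!rmorphXn -rmorphB -rmorphXn -!rmorphM; congr (_%:C%C); ring.
Qed.

Lemma q_at0 a b r k : q_ a b r k 0 0 = 1 :> R.
Proof.
rewrite /q_ cos0 !expr1n mul1r subrr big_ord_recl big1 ?addr0 => [|p _].
  by rewrite /poch !big_ord0 fact0 !mulr1 invr1 ?expr1n ?mulr1 ?mul1r.
by rewrite expr0n /= mulr0 mul0r.
Qed.

(** With all variables equal to 1, only [s = 0] survives in [coupling_expand]. This is the
    normalisation $\Phi(1)=1$. *)
Lemma coupling_sum1 (m b i : nat) : (0 < m)%N -> \sum_(r < i.+1) coupling C m b i (i - r) = 1.
Proof.
move=> m0; have := @coupling_expand C m b i 0 1 1 1 m0.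
rewrite expr0 mul1r big_ord_recl big1 ?addr0 => [|s _]; last first.
  by rewrite mul1r subrr expr0n /= !mulr0 mul0r.
rewrite !bin0 fact0 /poch big_ord0 divr1 expr0 !expr1n !mul1r subn0 => e.
have s0 : (-1) ^+ i != 0 :> C by rewrite signr_eq0.
apply: (mulfI s0); rewrite mulr1 [RHS]e; congr (_ * _).
by apply: eq_bigr => r _; rewrite !expr1n !mulr1.
Qed.

End Characters.

(** From $XY^{l+1}x=(l+1)(a-l)Y^lx$, where the factor is nonzero for $l<a$. *)
Lemma sl2_string_neq0 (F : numFieldType) d (X Y H : 'M[F]_d) (x : 'cV[F]_d) (a k : nat) :
  X *m Y = Y *m X + H -> H *m Y = Y *m H - 2 *: Y -> H *m x = a%:R *: x -> X *m x = 0 ->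
  x != 0 -> (k <= a)%N -> iter k (mulmx Y) x != 0.
Proof.
move=> XY HY Hx Xx x0.
have Hk l : H *m iter l (mulmx Y) x = (a%:R - 2 * l%:R) *: iter l (mulmx Y) x.
  elim: l => [|l ih] /=; first by rewrite Hx mulr0 subr0.
  rewrite mulmxA HY mulmxBl -mulmxA ih -scalemxAr -scalemxAl -scalerBl; congr (_ *: _).
  by rewrite -natr1; ring.
have Xk l : X *m iter l.+1 (mulmx Y) x = (l.+1%:R * (a%:R - l%:R)) *: iter l (mulmx Y) x.
  elim: l => [|l ih]; rewrite [iter _ _ _]/= mulmxA XY mulmxDl -mulmxA.
    by rewrite Xx mulmx0 add0r Hx subr0 mul1r.
  rewrite -/(iter l.+1 (mulmx Y) x) ih Hk -scalemxAr -/(iter l.+1 (mulmx Y) x) -scalerDl.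
  by congr (_ *: _); rewrite -!natr1; ring.
elim: k => [|k ih] ka; first exact: x0.
apply: contra_neq (ih (ltnW ka)) => e; have := Xk k; rewrite e mulmx0 => /esym/eqP.
rewrite scaler_eq0 mulf_eq0 pnatr_eq0 /= subr_eq0 eqr_nat => /orP[/eqP h|/eqP //].
by rewrite h ltnn in ka.
Qed.

(** * The eigenvalues of the spherical function *)

Section Assembly.
Variable R : realType.
Local Notation C := R[i].
Variables (p a b i : nat) (hi : (i <= a)%N).
Local Notation m := p.+3.
Local Notation n := p.+3.+2.
Variables (dK dG : nat) (piK : 'M[C]_n -> 'M[C]_dK) (piG : 'M[C]_n -> 'M[C]_dG).
Hypothesis hpi : unitary_rep (@SU R n) piG.
Hypothesis irrG : irreducible_rep (@SU R n) piG.
Hypothesis hpK : unitary_rep (@SU2m R m) piK.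
Hypothesis irrK : irreducible_rep (@SU2m R m) piK.
Variables (w : 'cV[C]_dG) (v : 'cV[C]_dK) (j : 'M[C]_(dG, dK)).
Hypothesis hw : highest_weight_vector (@SU R n) (@posG m) (nu m a b i) piG w.
Hypothesis hv : highest_weight_vector (@SU2m R m) (@posK m) (mu m a b) piK v.
Hypothesis hj : intertwiner (@SU2m R m) piK piG j.
Hypothesis hj1 : j^t* *m j = 1%:M.
Local Notation D := (dcplx piG).
Local Notation u := (j *m v).

Let sE (c : C) (M : 'M[C]_1) : (c *: M) 0 0 = c * M 0 0.
Proof. by rewrite mxE. Qed.

Let bE (M N : 'M[C]_1) : (M - N) 0 0 = M 0 0 - N 0 0.
Proof. by rewrite !mxE. Qed.

Lemma hw_vector_nu : hw_vector piG (a - i) (b + i) i w.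
Proof.
have [_ h1 h2] := hw; split=> [t ht|k l kl]; last exact: h2.
by rewrite h1 // /nu (wchar_wt _ _ _ ht) [(i + b)%N]addnC.
Qed.

Lemma SU2m_diag (t : 'rV[C]_n) : SU (diag_mx t) -> SU2m (diag_mx t).
Proof.
split=> // k l kl; rewrite mxE; have [e|_] := eqVneq k l; last by rewrite mulr0n.
by rewrite e eqxx in kl.
Qed.

(** The positive root vectors of K kill [u] through the intertwiner; the negative ones of U(m) kill
    it because its weight is trivial there. *)
Lemma khw_vector_mu : khw_vector piG a b u.
Proof.
have [_ h1 h2] := hv.
have wu : weight_vector piG (a + b) b 0 u.
  move=> t ht; rewrite mulmxA (hj (SU2m_diag ht)) -mulmxA (h1 _ (SU2m_diag ht)) -scalemxAr.
  congr (_ *: _); have := @wchar_wt _ p.+2 a b 0 t ht; rewrite /mu mulr0n addr0 => ->.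
  by [].
have hpos k l : posK k l -> D (delta_mx k l) *m u = 0.
  move=> kl; have := h2 k l kl; move: kl => /andP[kl s].
  have nkl : k != l by rewrite -val_eqE neq_ltn kl.
  have bl : block_diag (delta_mx k l : 'M[C]_n).
    move=> r s' rs; rewrite mxE; have [e1|] := eqVneq r k; have [e2|] := eqVneq s' l; rewrite ?andbF //.
    by rewrite e1 e2 (eqP s) eqxx in rs.
  by rewrite mulmxA (dcplx_transfer hpi hj hj1 (trace_delta0 R nkl) bl) -mulmxA => ->; rewrite mulmx0.
split=> // k l kl /orP[/andP[/eqP -> /eqP ->]|/andP[k1 l1]]; first exact: hpos.
have [klt|] := ltnP k l.
  by apply: hpos; rewrite /posK klt ![(_ < 2)%N]ltnNge k1 l1.
rewrite leq_eqVlt eq_sym val_eqE (negPf kl) /= => lk.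
have lk' : l != k by rewrite eq_sym.
apply: (lowering_vanish hpi wu lk'); last by apply: hpos; rewrite /posK lk ![(_ < 2)%N]ltnNge k1 l1.
have E (s : 'I_n) : (s < 2)%N -> (s == l) = false /\ (s == k) = false.
  by move=> h; split; apply/negP => /eqP e; rewrite e ltnNge ?k1 ?l1 in h.
have [a1 a2] := E 0 isT; have [b1 b2] := E 1 isT.
by rewrite /wt !mxE a1 a2 b1 b2 !subr0 !mul0rn ?addr0 ?mulr0n ?subr0.
Qed.

Lemma v_neq0 : v != 0. Proof. by case: hv. Qed.

Lemma u_neq0 : u != 0.
Proof.
apply: contra_neq v_neq0 => u0.
by rewrite -[v]mul1mx -hj1 -mulmxA u0 mulmx0.
Qed.

Definition zonal (g : 'M[C]_n) : C := \sum_(r < i.+1) coupling C m b i (i - r) *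
  (g 0 0 ^+ (a - r) * minor2 g ^+ (b + r) * (g 1 1)^* ^+ r).

(** [N] is nonzero because the coefficient at 1 is the squared norm of [u]. *)
Lemma zonal_coef : exists2 N : C, N != 0 &
  forall g, SU g -> (u^t* *m piG g *m u) 0 0 = N * zonal g.
Proof.
have hu : khw_vector piG (a - i + i) (b + i - i) u.
  by rewrite subnK // addnK; exact: khw_vector_mu.
have w0 : w != 0 by case: hw.
have [kap hkap] := spherical_coef hpi irrG (leq_addl b i) hw_vector_nu w0 hu u_neq0.
have szE g : spherical (a - i) (b + i) i g = (-1) ^+ i * zonal g.
  rewrite /spherical (coupling_expand b i (a - i) (g 0 0) (g 1 1)^* (minor2 g) (isT : (0 < m)%N)).
  congr (_ * _); apply: eq_bigr => r _; congr (_ * (_ ^+ _ * _ * _)).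
  by have := ltn_ord r; lia.
have hN g : SU g -> (u^t* *m piG g *m u) 0 0 = kap * (-1) ^+ i * zonal g.
  by move=> hg; rewrite hkap // szE mulrA.
exists (kap * (-1) ^+ i) => //.
have := hN _ (@SU1 R n); have [-> _ _ _] := hpi; rewrite mulmx1 => h.
apply: contra_neq u_neq0 => e; apply: trC_mul_eq0.
by apply/matrixP => r s; rewrite !ord1 h e mul0r mxE.
Qed.

Lemma weights_exist : exists wt0 : nat -> 'I_a.+1 -> C, forall k l, (l <= a)%N ->
  \sum_x wt0 k x * (x : nat)%:R ^+ l = (l == k)%:R.
Proof.
have inj : injective (fun x : 'I_a.+1 => (x : nat)%:R : C).
  by move=> x y /eqP; rewrite eqr_nat => /eqP/val_inj.
have /choice[f hf] : forall k : nat, exists f : 'I_a.+1 -> C, forall l, (l <= a)%N ->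
    \sum_x f x * (x : nat)%:R ^+ l = (l == k)%:R.
  by move=> k; have [f hf] := vandermonde_moments (fun l => (l == k)%:R) inj; exists f => l la; rewrite hf.
by exists f.
Qed.

Section Basis.
Variable N : C.
Hypothesis N0 : N != 0.
Hypothesis hN : forall g, SU g -> (u^t* *m piG g *m u) 0 0 = N * zonal g.
Variable wts : nat -> 'I_a.+1 -> C.
Hypothesis hwts : forall k l, (l <= a)%N ->
  \sum_x wts k x * (x : nat)%:R ^+ l = (l == k)%:R.

Lemma coef_weights k (q : {poly C}) : (k <= a)%N -> (size q <= a.+1)%N ->
  \sum_x wts k x * q.[(x : nat)%:R] = q`_k.
Proof.
move=> ka sq.
under eq_bigr do rewrite (horner_coef_wide _ sq) mulr_sumr.
rewrite exchange_big /= (bigD1 (Ordinal (ka : (k < a.+1)%N))) //= [X in _ + X]big1 ?addr0 => [|l lk].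
  under eq_bigr do rewrite mulrCA.
  by rewrite -mulr_sumr hwts // eqxx mulr1.
under eq_bigr do rewrite mulrCA.
rewrite -mulr_sumr hwts; last by rewrite -ltnS.
by move: lk; rewrite -val_eqE /= => /negPf ->; rewrite mulr0.
Qed.

(* The coefficient of h_00^(a-k) h_10^k in piK h v for h in SU(2), extracted by
   interpolation at the points h_10 / h_00 = 0, ..., a. *)
Definition Zv k : 'cV[C]_dK :=
  \sum_x (wts k x / (cosn R x)%:C%C ^+ a) *: (piK (rotn R m x) *m v).

Lemma adjK g : SU2m g -> v^t* *m piK g *m j^t* = u^t* *m piG g.
Proof.
move=> hg; have [hgS _] := hg; have hV := SU2mV hg.
have e := congr1 (fun M => M^t*) (hj hV); rewrite !trCM in e.
have eG : (piG (g^t*))^t* = piG g by rewrite (rep_trC hpi hgS) trmxCK.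
have eK : (piK (g^t*))^t* = piK g.
  by rewrite (piK_coef hj hj1 hV) !trCM trmxCK eG mulmxA -(piK_coef hj hj1 hg).
by rewrite eG eK in e; rewrite trCM -mulmxA -e mulmxA.
Qed.

(** Under right translation by [rotn] the minor is unchanged, and the other two factors become
    [cosn ^+ a] times a polynomial of degree at most [a] in the tangent; interpolation picks its
    coefficient. *)
Lemma ZvE g k : SU g -> (k <= a)%N -> (u^t* *m piG g *m (j *m Zv k)) 0 0 =
  N * \sum_(r < i.+1) coupling C m b i (i - r) * (minor2 g ^+ (b + r) *
   (((g 0 0)%:P + g 0 1 *: 'X) ^+ (a - r) * (((g 1 1)^*)%:P + (- (g 1 0)^*) *: 'X) ^+ r)`_k).
Proof.
move=> hg ka; have [_ piM _ _] := hpi.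
pose q (r : nat) : {poly C} :=
  ((g 0 0)%:P + g 0 1 *: 'X) ^+ (a - r) * (((g 1 1)^*)%:P + (- (g 1 0)^*) *: 'X) ^+ r.
transitivity (\sum_x \sum_(r < i.+1) N * (coupling C m b i (i - r) * (minor2 g ^+ (b + r) *
    (wts k x * (q r).[(x : nat)%:R])))).
  rewrite /Zv !mulmx_sumr summxE; apply: eq_bigr => x _.
  have hx := rotn_SU R m x; have hx2 := rotn_SU2m R m x.
  have -> (c : C) : j *m (c *: (piK (rotn R m x) *m v)) = c *: (piG (rotn R m x) *m u).
    have e1 : j *m (piK (rotn R m x) *m v) = piG (rotn R m x) *m u.
      by rewrite [LHS]mulmxA [RHS]mulmxA (hj hx2).
    by rewrite -scalemxAr e1.
  rewrite -scalemxAr sE [_ *m (piG _ *m _)]mulmxA -[u^t* *m _ *m piG _]mulmxA -(piM _ _ hg hx).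
  rewrite (hN (SUM hg hx)) /zonal.
  rewrite mulrCA mulr_sumr [LHS]mulr_sumr; apply: eq_bigr => r _; congr (_ * _).
  rewrite minor2_rotn.
  have [-> _] := mul_rotn g x 0; have [_ ->] := mul_rotn g x 1.
  have -> : ((cosn R x)%:C%C * (g 1 1 - g 1 0 * (x : nat)%:R))^* =
      (cosn R x)%:C%C * ((g 1 1)^* - (g 1 0)^* * (x : nat)%:R) :> C.
    rewrite rmorphM rmorphB rmorphM /= rmorph_nat; congr (_ * _); exact: conjc_real.
  rewrite /q hornerM !horner_exp !hornerD !hornerZ !hornerC !hornerX mulNr.
  have c0 : (cosn R x)%:C%C ^+ a != 0 :> C.
    by rewrite expf_neq0 // (inj_eq (@complexI R)) gt_eqF // cosn_gt0.
  have ra : (r <= a)%N by have := ltn_ord r; lia.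
  have cE : (cosn R x)%:C%C ^+ a = (cosn R x)%:C%C ^+ (a - r) * (cosn R x)%:C%C ^+ r :> C.
    by rewrite -exprD subnK.
  rewrite !exprMn; rewrite cE in c0 *.
  move: c0; move: (_%:C%C ^+ (a - r)) (_%:C%C ^+ r) => y z.
  rewrite mulf_eq0 negb_or => /andP[y0 z0].
  move: (_ ^+ (a - r)) (_ ^+ r) (minor2 g ^+ _) => *; field; by rewrite y0 z0.
rewrite exchange_big /= mulr_sumr; apply: eq_bigr => r _.
have ra : (r <= a)%N by have := ltn_ord r; lia.
rewrite -!mulr_sumr coef_weights // (leq_trans (size_binomials _ _ _ _ _ _)) //.
by rewrite subnK.
Qed.

Local Notation lam k t1 t2 :=
  (\sum_(r < i.+1) coupling C m b i (i - r) * (q_ a b r k t1 t2)%:C%C).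

(** The minor acquires the factor $\cos t_1\cos t_2$, and [SU2m_minor] replaces the conjugate
    entries of [h] by those of its first row. By homogeneity [h] then factors out in the same way
    for all [r], and [q_coef] identifies what is left. *)
Lemma Zv_coef h t1 t2 k : SU2m h -> (k <= a)%N ->
  (v^t* *m piK h *m (Phi piG j (a_t m t1 t2) *m Zv k)) 0 0 =
  N * (minor2 h ^+ b * (h 0 0 ^+ (a - k) * h 0 1 ^+ k) * 'C(a, k)%:R) * lam k t1 t2.
Proof.
move=> hh ka; have [_ piM _ _] := hpi; have [hS _] := hh.
have hA : SU (a_t m t1 t2) by apply: a_t_SU.
have -> : v^t* *m piK h *m (Phi piG j (a_t m t1 t2) *m Zv k) =
    u^t* *m piG (h *m a_t m t1 t2) *m (j *m Zv k).
  by rewrite /Phi !mulmxA (adjK hh) (piM _ _ hS hA) !mulmxA.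
rewrite (ZvE (SUM hS hA) ka) -[RHS]mulrA; congr (_ * _).
rewrite mulr_sumr; apply: eq_bigr => r _; rewrite [RHS]mulrCA; congr (_ * _).
have ra : (r <= a)%N by have := ltn_ord r; lia.
set c1 : C := (cos t1)%:C%C; set c2 : C := (cos t2)%:C%C.
have [g00 g01] := @mul_a_t R m h t1 t2 0 isT hh isT.
have [g10 g11] := @mul_a_t R m h t1 t2 1 isT hh isT.
have dE : minor2 (h *m a_t m t1 t2) = minor2 h * (c1 * c2).
  by rewrite /minor2 g00 g01 g10 g11 -/c1 -/c2; ring.
have c1C : c1^* = c1 by exact: conjc_real.
have c2C : c2^* = c2 by exact: conjc_real.
have [d11 d10] := SU2m_minor hh.
have h11 : (h 1 1 * c2)^* = (h 1 1)^* * c2.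
  by transitivity ((h 1 1)^* * c2^*); rewrite ?rmorphM // c2C.
have h10 : (h 1 0 * c1)^* = (h 1 0)^* * c1.
  by transitivity ((h 1 0)^* * c1^*); rewrite ?rmorphM // c1C.
rewrite dE g00 g01 g10 g11 -/c1 -/c2 h11 h10.
have -> : (minor2 h * (c1 * c2)) ^+ (b + r) *
    (((h 0 0 * c1)%:P + (h 0 1 * c2) *: 'X) ^+ (a - r) *
     (((h 1 1)^* * c2)%:P + - ((h 1 0)^* * c1) *: 'X) ^+ r)`_k =
    minor2 h ^+ b * (c1 * c2) ^+ (b + r) *
    (((h 0 0 * c1)%:P + (h 0 1 * c2) *: 'X) ^+ (a - r) *
     ((h 0 0 * c2)%:P + (h 0 1 * c1) *: 'X) ^+ r)`_k.
  have -> : (h 0 0 * c2)%:P + (h 0 1 * c1) *: 'X =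
      (minor2 h)%:P * (((h 1 1)^* * c2)%:P + - ((h 1 0)^* * c1) *: 'X).
    rewrite mulrDr -polyCM mulrA d11 mul_polyC scalerA; congr (_ + _ *: _).
    by rewrite mulrN mulrA d10; ring.
  move: (((h 0 0 * c1)%:P + (h 0 1 * c2) *: 'X) ^+ (a - r)) => A.
  move: (((h 1 1)^* * c2)%:P + - ((h 1 0)^* * c1) *: 'X) => B.
  rewrite [((minor2 h)%:P * B) ^+ r]exprMn -polyC_exp [A * (_ * _)]mulrCA coefCM.
  by move: ((A * B ^+ r)`_k) => z; rewrite !exprMn !exprD; ring.
rewrite coef_binomials_scale; last by rewrite subnK.
have := q_coef b t1 t2 ra ka; rewrite -/c1 -/c2 => e.
rewrite subnK // -mulrA [(c1 * c2) ^+ _ * _]mulrCA e; ring.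
Qed.

Lemma K_separate (L : 'rV[C]_dK) : (forall h, SU2m h -> L *m piK h *m v = 0) -> L = 0.
Proof.
have [pi1 piM _ _] := hpK => h.
exact: (irreducible_separate (@SU2m1 R m) (@SU2mM R m) pi1 piM irrK v_neq0 h).
Qed.

Lemma K_separate_dual (y : 'cV[C]_dK) :
  (forall h, SU2m h -> (v^t* *m piK h *m y) 0 0 = 0) -> y = 0.
Proof.
move=> H; suff y0 : y^t* = 0 by rewrite -[y]trmxCK y0 trmx0 map_mx0.
apply: K_separate => h hh; have hV := SU2mV hh; have [hS _] := hh.
have e : v^t* *m piK (h^t*) *m y = 0.
  by apply/matrixP => r s; rewrite !ord1 (H _ hV) mxE.
have eK : (piK (h^t*))^t* = piK h.
  rewrite (piK_coef hj hj1 hV) !trCM trmxCK (rep_trC hpi hS) trmxCK mulmxA.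
  by rewrite -(piK_coef hj hj1 hh).
have <- : (v^t* *m piK (h^t*) *m y)^t* = y^t* *m piK h *m v.
  by rewrite !trCM trmxCK eK mulmxA.
by rewrite e trmx0 map_mx0.
Qed.

Lemma lam0 k : lam k 0 0 = 1.
Proof.
rewrite -(@coupling_sum1 R m b i isT); apply: eq_bigr => r _.
by rewrite q_at0 mulr1.
Qed.

Lemma Zv_gram h k : SU2m h -> (k <= a)%N -> (v^t* *m piK h *m Zv k) 0 0 =
  N * (minor2 h ^+ b * (h 0 0 ^+ (a - k) * h 0 1 ^+ k) * 'C(a, k)%:R).
Proof.
move=> hh ka; have := Zv_coef 0 0 hh ka; rewrite lam0 mulr1 => <-.
rewrite a_t0 // /Phi; have [-> _ _ _] := hpi.
by rewrite mulmx1 hj1 mul1mx.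
Qed.

(** In [Zv_coef] the dependence on [h] is separate from that on [t1] and [t2], so both sides pair
    equally with the whole orbit of [v]. *)
Lemma Phi_Zv t1 t2 k : (k <= a)%N -> Phi piG j (a_t m t1 t2) *m Zv k = lam k t1 t2 *: Zv k.
Proof.
move=> ka; apply/eqP; rewrite -subr_eq0; apply/eqP/K_separate_dual => h hh.
by rewrite mulmxBr bE -scalemxAr sE Zv_coef // Zv_gram // mulrC subrr.
Qed.

(** Pairing with the orbit gives the zonal function at [g *m h], and the binomial theorem separates
    [h] from [g]. *)
Lemma orbit_Zv h : SU2m h ->
  piK h *m v = \sum_(k < a.+1) (minor2 h ^+ b * (h 0 0 ^+ (a - k) * h 1 0 ^+ k)) *: Zv k.
Proof.
move=> hh; apply/eqP; rewrite -subr_eq0; apply/eqP/K_separate_dual => g hg.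
have [gS _] := hg; have [hS _] := hh; have [_ piM _ _] := hpi; have [_ pKM _ _] := hpK.
have hgh := SU2mM hg hh; have [ghS _] := hgh.
rewrite mulmxBr bE.
have -> : v^t* *m piK g *m (piK h *m v) = u^t* *m piG (g *m h) *m u.
  rewrite mulmxA -[v^t* *m _ *m _]mulmxA -(pKM _ _ hg hh) [RHS]mulmxA -(adjK hgh).
  by rewrite -[_ *m j^t* *m j]mulmxA hj1 mulmx1.
rewrite (hN ghS) mulmx_sumr summxE; apply/eqP; rewrite subr_eq0; apply/eqP.
(* On K all summands of [zonal] coincide by [SU2m_minor], and their coefficients add up to 1. *)
have -> : zonal (g *m h) = minor2 (g *m h) ^+ b * (g *m h) 0 0 ^+ a.
  rewrite /zonal -[RHS]mul1r -(@coupling_sum1 R m b i isT) mulr_suml.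
  apply: eq_bigr => r _; congr (_ * _); have ra : (r <= a)%N by have := ltn_ord r; lia.
  have [d11 _] := SU2m_minor hgh.
  rewrite -[in RHS](subnK ra) [_ ^+ (b + r)]exprD [_ ^+ (a - r + r)]exprD.
  rewrite [LHS](_ : _ = minor2 (g *m h) ^+ b * ((g *m h) 0 0 ^+ (a - r) *
    (minor2 (g *m h) * ((g *m h) 1 1)^*) ^+ r)); last by rewrite [in RHS]exprMn; ring.
  by rewrite d11.
have -> : (g *m h) 0 0 = g 0 0 * h 0 0 + g 0 1 * h 1 0 by apply: SU2m_mul.
rewrite (minor2M _ hg) [(_ + _) ^+ a]exprDn.
rewrite exprMn mulr_sumr [LHS]mulr_sumr; apply: eq_bigr => k _.
have ka : (k <= a)%N by rewrite -ltnS.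
rewrite -scalemxAr sE (Zv_gram hg ka) -mulr_natl !exprMn.
by move: (g 0 0) (g 0 1) (h 0 0) (h 1 0) (minor2 g) (minor2 h) => *; ring.
Qed.

Local Notation F := (delta_mx 1 0 : 'M[C]_n).
Local Notation zv k := (iter k (mulmx (dcplx piK F)) v).
Local Notation uv k := (iter k (mulmx (D F)) u).

Lemma trF : \tr F = 0. Proof. exact: trace_delta0. Qed.

Lemma uvE k : j *m zv k = uv k.
Proof.
have bF : block_diag F.
  move=> r s rs; rewrite mxE; have [e1|] := eqVneq r 1; have [e2|] := eqVneq s 0; rewrite ?andbF //.
  by rewrite e1 e2 in rs.
elim: k => //= k <-; rewrite !mulmxA; congr (_ *m _).
by rewrite (dcplx_transfer hpi hj hj1 trF bF).
Qed.

Lemma zvE k : zv k = j^t* *m uv k.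
Proof. by rewrite -uvE mulmxA hj1 mul1mx. Qed.

Lemma uv_neq0 k : (k <= a)%N -> uv k != 0.
Proof.
have [hwt hE] := khw_vector_mu.
pose Hm := D (diag_mx (\row_l ((l == 0)%:R - (l == 1)%:R))).
pose Em := D (delta_mx 0 1 : 'M[C]_n).
have n01 : (0 : 'I_n) != 1 by [].
have EF : Em *m D F = D F *m Em + Hm := dcplx_bracket_delta hpi n01.
have HF : Hm *m D F = D F *m Hm - 2 *: D F.
  have tH : \tr (diag_mx (\row_l ((l == 0)%:R - (l == 1)%:R)) : 'M[C]_n) = 0.
    by rewrite mxtrace_diag; exact: sum_root.
  have := dcplx_bracket hpi tH trF; rewrite -/Hm.
  have -> : diag_mx (\row_l ((l == 0)%:R - (l == 1)%:R)) *m F - F *m diag_mx (\row_l ((l == 0)%:R - (l == 1)%:R)) = (-2) *: F.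
    apply/matrixP => r s; rewrite [LHS]mxE [X in _ + X]mxE mul_diag_mx mul_mx_diag !mxE.
    have [->|] := eqVneq r 1; have [->|] := eqVneq s 0; rewrite /= ?mulr0 ?mul0r ?subrr ?mulr1 ?mul1r ?mulr0 //; ring.
  rewrite (dcplxZ hpi _ trF) => e.
  clearbody Hm; move: e; move: (Hm *m D F) (D F *m Hm) (D F) => X Y Z e.
  by rewrite -scaleNr e addrC subrK.
have Hu : Hm *m u = a%:R *: u.
  rewrite (dcplx_weight hpi hwt (sum_root _ _ _)); congr (_ *: _).
  by rewrite /wt !mxE /= !(mulr1n, mulr0n, subr0, sub0r) mulNrn natrD addrK.
exact: sl2_string_neq0 EF HF Hu (hE 0 1 n01 isT) u_neq0.
Qed.

Lemma zv_neq0 k : (k <= a)%N -> zv k != 0.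
Proof.
by move=> ka; apply: contra_neq (uv_neq0 ka) => e; rewrite -uvE e mulmx0.
Qed.

(** Acts trivially on $e_1$ and by [eta] on $e_2$, with $e_3$ compensating the determinant, so its
    eigenvalue on $F_1^kv$ records [k]. *)
Definition torus (eta : C) : 'rV[C]_n :=
  \row_l (if l == 1 then eta else if l == 2 then eta^* else 1).

Lemma torus_SU eta : eta * eta^* = 1 -> SU (diag_mx (torus eta)).
Proof.
move=> eU; apply: SU_diag_mx => [l|].
  rewrite mxE; case: ifP => // _; case: ifP => _; first by rewrite conjCK mulrC.
  by rewrite conjC1 mulr1.
rewrite (bigD1 1) //= (bigD1 2) //= big1 => [|l /andP[/negPf l1 /negPf l2]].
  by rewrite !mxE /= mulr1.
by rewrite mxE l1 l2.
Qed.

Lemma torus_uv eta k : eta * eta^* = 1 ->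
  piG (diag_mx (torus eta)) *m uv k = eta ^+ (b + k) *: uv k.
Proof.
move=> eU; have ht := torus_SU eU; have hr := unitary_rep_drep hpi.
have Ad : piG (diag_mx (torus eta)) *m D F = eta *: (D F *m piG (diag_mx (torus eta))).
  rewrite (drep_Ad hr ht trF).
  have -> : diag_mx (torus eta) *m F *m (diag_mx (torus eta))^t* = eta *: F.
    rewrite tr_diag_mx map_diag_mx mul_diag_mx mul_mx_diag; apply/matrixP => r s; rewrite !mxE.
    have [r1|_] := eqVneq r 1; last by rewrite !(mulr0, mul0r).
    have [s0|_] := eqVneq s 0; last by rewrite !(mulr0, mul0r).
    by rewrite s0 /= !mulr1 rmorph1 mulr1.
  by rewrite (dcplxZ hpi _ trF) scalemxAl.
elim: k => [|k ih] /=.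
  have [hwt _] := khw_vector_mu; rewrite hwt // /wt_char !mxE /= expr1n mul1r expr0 mulr1.
  by rewrite addn0.
by rewrite mulmxA Ad -scalemxAl -mulmxA ih -scalemxAr scalerA -exprS addnS.
Qed.

Lemma torus_zv eta k : eta * eta^* = 1 ->
  piK (diag_mx (torus eta)) *m zv k = eta ^+ (b + k) *: zv k.
Proof.
move=> eU; rewrite (piK_coef hj hj1 (SU2m_diag (torus_SU eU))) -!mulmxA uvE torus_uv //.
by rewrite -scalemxAr -zvE.
Qed.

Lemma torus_Zv eta k : eta * eta^* = 1 -> (k <= a)%N ->
  piK (diag_mx (torus eta)) *m Zv k = eta ^+ (b + k) *: Zv k.
Proof.
move=> eU ka; have ht := SU2m_diag (torus_SU eU); have [_ pKM _ _] := hpK.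
apply/eqP; rewrite -subr_eq0; apply/eqP/K_separate_dual => h hh.
rewrite mulmxBr bE mulmxA -[v^t* *m _ *m _]mulmxA -(pKM _ _ hh ht) -scalemxAr sE.
rewrite (Zv_gram (SU2mM hh ht) ka) (Zv_gram hh ka) (minor2M _ hh).
have E r s : (h *m diag_mx (torus eta)) r s = h r s * torus eta 0 s by rewrite mul_mx_diag mxE.
rewrite !E; have -> : minor2 (diag_mx (torus eta)) = eta.
  by rewrite /minor2 !mxE /= !mulr1n mul1r mulr0 subr0.
by rewrite !mxE /= mulr1 !exprMn exprD; ring.
Qed.

(** Vectors of different weights for unitary operators are orthogonal. Averaging over the phases of
    [phase_cubature] spares the choice of one that separates [b + k] from [b + l]. *)
Lemma Zv_orth k l : (k <= a)%N -> (l <= a)%N -> k != l -> (Zv l)^t* *m zv k = 0.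
Proof.
move=> ka la kl; have [_ _ pKU _] := hpK.
have [I [ph [eta [etaU hph]]]] := phase_cubature R (a + b).
have E x : (Zv l)^t* *m zv k = (eta x ^+ (b + k) * (eta x)^* ^+ (b + l)) *: ((Zv l)^t* *m zv k).
  have ht := SU2m_diag (torus_SU (etaU x)); have U := pKU _ ht.
  transitivity ((piK (diag_mx (torus (eta x))) *m Zv l)^t* *m (piK (diag_mx (torus (eta x))) *m zv k)).
    by rewrite trCM mulmxA (unitary_mulVK _ U).
  rewrite (torus_zv k (etaU x)) (torus_Zv (etaU x) la) trCZ -scalemxAl -scalemxAr scalerA.
  by rewrite rmorphXn mulrC.
have S s s' : (s <= a + b)%N -> (s' <= a + b)%N ->
    \sum_x ph x * (eta x ^+ s * (eta x)^* ^+ s') = (s == s')%:R by exact: hph.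
have : \sum_x ph x *: ((Zv l)^t* *m zv k) = \sum_x ph x *:
    ((eta x ^+ (b + k) * (eta x)^* ^+ (b + l)) *: ((Zv l)^t* *m zv k)).
  by apply: eq_bigr => x _; rewrite -E.
rewrite -scaler_suml; under [RHS]eq_bigr do rewrite scalerA.
rewrite -scaler_suml S; [|by lia|by lia].
rewrite eqn_add2l (negPf kl) scale0r => <-.
have -> : \sum_x ph x = 1; last by rewrite scale1r.
have <- : \sum_x ph x * (eta x ^+ 0 * (eta x)^* ^+ 0) = 1 by exact: (S 0%N 0%N isT isT).
by apply: eq_bigr => x _; rewrite !expr0 !mulr1.
Qed.

(** $F_1^kv$ is orthogonal to all [Zv l] with $l\ne k$, so by [orbit_Zv] its pairing with the orbit
    of [v] is proportional to that of [Zv k]. *)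
Lemma zv_Zv k : (k <= a)%N -> exists c, Zv k = c *: zv k.
Proof.
move=> ka; pose e := ((Zv k)^t* *m zv k) 0 0.
have adj h : SU2m h -> v^t* *m piK h *m zv k =
    (minor2 h ^+ b * (h 0 0 ^+ (a - k) * h 0 1 ^+ k)) *: ((Zv k)^t* *m zv k).
  move=> hh; have hV := SU2mV hh; have [hS _] := hh.
  have eK : (piK (h^t*))^t* = piK h.
    rewrite (piK_coef hj hj1 hV) !trCM trmxCK (rep_trC hpi hS) trmxCK mulmxA.
    by rewrite -(piK_coef hj hj1 hh).
  have -> : v^t* *m piK h = (piK (h^t*) *m v)^t* by rewrite trCM eK.
  have trS (G : nat -> C) : (\sum_(l < a.+1) G l *: Zv l)^t* = \sum_(l < a.+1) (G l)^* *: (Zv l)^t*.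
    rewrite raddf_sum /= map_mx_sum; apply: eq_bigr => l _; exact: trCZ.
  rewrite (orbit_Zv hV) (trS (fun l => minor2 (h^t*) ^+ b * ((h^t*) 0 0 ^+ (a - l) * (h^t*) 1 0 ^+ l))).
  rewrite mulmx_suml (bigD1 (Ordinal (ka : (k < a.+1)%N))) //= big1 ?addr0 => [|l lk].
    rewrite -scalemxAl; congr (_ *: _).
    have -> : minor2 (h^t*) = (minor2 h)^*.
      by rewrite /minor2 !mxE rmorphB !rmorphM; congr (_ - _); exact: mulrC.
    by rewrite !mxE !rmorphM !rmorphXn /= !conjCK.
  rewrite -scalemxAl Zv_orth ?scaler0 //; last by rewrite eq_sym.
  by rewrite -ltnS.
have eM : (Zv k)^t* *m zv k = e%:M by rewrite /e -mx11_scalar.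
pose c := e / (N * 'C(a, k)%:R).
have C0 : 'C(a, k)%:R != 0 :> C by rewrite pnatr_eq0 -lt0n bin_gt0.
have zE : zv k = c *: Zv k.
  apply/eqP; rewrite -subr_eq0; apply/eqP/K_separate_dual => h hh.
  rewrite mulmxBr bE -scalemxAr sE (adj h hh) sE (Zv_gram hh ka) eM mxE eqxx mulr1n /c.
  move: (minor2 h ^+ b) (h 0 0 ^+ _) (h 0 1 ^+ _) ('C(a, k)%:R : C) C0 => x y z t t0; field.
  by rewrite t0 N0.
have c0 : c != 0 by apply: contra_neq (zv_neq0 ka) => c0; rewrite zE c0 scale0r.
by exists c^-1; rewrite zE scalerA mulVf // scale1r.
Qed.

(** The orbit of [v] lies in the span of the [Zv k], and separates by irreducibility. *)
Lemma Zv_total (M : 'M[C]_dK) : (forall k, (k <= a)%N -> M *m Zv k = 0) -> M = 0.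
Proof.
move=> hM; apply/row_matrixP => r; rewrite row0; apply: K_separate => h hh.
rewrite -mulmxA (orbit_Zv hh) mulmx_sumr big1 // => k _.
by rewrite -scalemxAr -row_mul hM ?row0 ?scaler0 // -ltnS.
Qed.

(** Both sides have the same eigenvalue on each [Zv k], which is a multiple of the vector on which
    [Q] is prescribed. *)
Lemma Phi_decomposition (Q : nat -> 'M[C]_dK) t1 t2 :
  (forall r k, (r <= a)%N -> (k <= a)%N -> Q r *m zv k = (q_ a b r k t1 t2)%:C%C *: zv k) ->
  Phi piG j (a_t m t1 t2) = \sum_(r < i.+1) coupling C m b i (i - r) *: Q r.
Proof.
move=> hQ; apply/eqP; rewrite -subr_eq0; apply/eqP/Zv_total => k ka.
rewrite mulmxBl Phi_Zv // mulmx_suml scaler_suml -sumrB big1 // => r _.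
have ra : (r <= a)%N by have := ltn_ord r; lia.
have [c ->] := zv_Zv ka.
by rewrite -scalemxAl -scalemxAr (hQ _ _ ra ka) !scalerA mulrAC subrr.
Qed.

End Basis.

End Assembly.

Theorem proposition6p4 (R : realType) (m a b : nat) (hm : (2 < m)%N)
  (dK : nat) (piK : 'M[R[i]]_m.+2 -> 'M[R[i]]_dK)
  (hK : irrep_of_hw (@SU2m R m) (@posK m) (mu m a b) piK)
  (v : 'cV[R[i]]_dK)
  (hv : highest_weight_vector (@SU2m R m) (@posK m) (mu m a b) piK v)
  (Q : nat -> R -> R -> 'M[R[i]]_dK)
  (hQ : forall (r k : nat) (t1 t2 : R), (r <= a)%N -> (k <= a)%N ->
    Q r t1 t2 *m iter k (mulmx (dcplx piK (E21 R m))) v =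
    (q_ a b r k t1 t2)%:C%C *: iter k (mulmx (dcplx piK (E21 R m))) v)
  (i : nat) (hi : (i <= a)%N)
  (dG : nat) (piG : 'M[R[i]]_m.+2 -> 'M[R[i]]_dG)
  (hG : irrep_of_hw (@SU R m.+2) (@posG m) (nu m a b i) piG)
  (j : 'M[R[i]]_(dG, dK)) (hj : intertwiner (@SU2m R m) piK piG j)
  (hj1 : j^t* *m j = 1%:M) (t1 t2 : R) :
  Phi piG j (a_t m t1 t2) =
  (poch (m + b + i)%:R i / poch m%:R i) *:
    \sum_(r < i.+1)
      (poch (- i%:R) (i - r) * poch (- i%:R - b%:R) (i - r) /
       ((i - r)`!%:R * poch (1 - m%:R - (2 * i)%:R - b%:R) (i - r))) *:
      Q r t1 t2.
Proof.
case: m hm piK hK hv hQ piG hG hj => [|[|[|p]]] // hm piK hK hv hQ piG hG hj.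
have [hpK irrK _] := hK; have [hpi irrG [w hw]] := hG.
have [N N0 hN] := zonal_coef hi hpi irrG hw hv hj hj1.
have [wts hwts] := weights_exist R a.
have hQ' r k : (r <= a)%N -> (k <= a)%N -> Q r t1 t2 *m iter k (mulmx (dcplx piK (E21 R p.+3))) v =
    (q_ a b r k t1 t2)%:C%C *: iter k (mulmx (dcplx piK (E21 R p.+3))) v by exact: hQ.
rewrite (@Phi_decomposition _ _ _ _ _ hi _ _ _ _ hpi hpK irrK _ _ hv hj hj1 _ N0 hN _ hwts
  (fun r => Q r t1 t2) t1 t2 hQ').
by rewrite scaler_sumr; apply: eq_bigr => r _; rewrite scalerA.
Qed.
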